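(* Let $f(x,y)=u_1x+v_1y$ and $g(x,y)=u_2x+v_2y$, where for $i=1,2$ the integers $u_i,v_i$ satisfy $u_i\ge|v_i|>0$, $\gcd(u_i,v_i)=1$ and $(u_i,v_i)\ne(1,1)$, and where $(u_2,v_2)\ne(u_1,\pm v_1)$. Let $\alpha:\mathbb{Z}_{\ne0}^2\to\mathbb{Q}$ be given by $$\alpha(u,v):=\frac{1}{u^2}\left(\frac{|v|}{3}+\frac{u-|v|}{2}\right)=\frac{3u-|v|}{6u^2}.$$ The following two situations can be distinguished. (i) Suppose $u_1+|v_1|\ge u_2+|v_2|$ and $\alpha(u_1,v_1)<\alpha(u_2,v_2)$. Then $f$ dominates $g$ for all $p$ such that $N^{-3/5}=o(p)$ and $p=o(1)$. In particular, every other difference form dominates the form $x-y$ in this range. (ii) Suppose $u_1+|v_1|>u_2+|v_2|$ and $\alpha(u_1,v_1)>\alpha(u_2,v_2)$. Then there exists a real number $c_{f,g}>0$ such that: - $g$ dominates $f$ whenever $N^{-3/5}=o(p)$ and $p=o(N^{-1/2})$, or $p=cN^{-1/2}$ for any $0<c<c_{f,g}$; and - $f$ dominates $g$ whenever $p=cN^{-1/2}$ for any $c>c_{f,g}$, or $N^{-1/2}=o(p)$. Specifically, $c_{f,g}$ is the unique positive root (in $c$) of the equation $$g_{u_1,v_1}\left(\frac{c^2}{u_1}\right)=g_{u_2,v_2}\left(\frac{c^2}{u_2}\right),$$ where $g_{u,v}:\mathbb{R}^+\to(0,u+|v|)$ is given by $$g_{u,v}(x):=(u+|v|)-2|v|\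left(\frac{1-e^{-x}}{x}\right)-(u-|v|)e^{-x}.$$
   Context: Throughout, $p=p(N)$ is a function $p:\mathbb{N}\to(0,1)$ satisfying $N^{-1}=o(p(N))$ and $p(N)=o(1)$ as $N\to\infty$, where $f=o(g)$ means $\lim_{N\to\infty}f(N)/g(N)=0$. A binary linear form is a function $h(x,y)=ux+vy$ with $u,v$ non-zero integers, $u\ge|v|$ and $\gcd(u,v)=1$. For a set $A$ of integers, $h(A)=\{ua_1+va_2:a_1,a_2\in A\}$. The ''difference forms'' other than $x-y$ are the binary linear forms with $u>|v|$ (equivalently, all binary linear forms other than $x+y$ and $x-y$). Domination: for two binary linear forms $f,g$, $f$ dominates $g$ for the parameter $p$ if the probability that $|f(A)|>|g(A)|$ tends to $1$ as $N\to\infty$, where $A$ is a random subset of $I_N=\{0,1,\dots,N\}$ obtained by choosing each $n\in I_N$ independently with probability $p(N)$. *)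

(* Defs.v *)
From HB Require Import structures.
From mathcomp Require Import all_boot all_order all_algebra.
From mathcomp Require Import finmap.
From mathcomp Require Import all_classical all_reals all_analysis.
From mathcomp Require Import ring lra.

Set Implicit Arguments.
Unset Strict Implicit.
Unset Printing Implicit Defensive.

Import Order.TTheory GRing.Theory Num.Theory.
Import numFieldNormedType.Exports.

Local Open Scope classical_set_scope.
Local Open Scope ring_scope.

(* The form u x + v y is represented by the pair (u, v). *)
Definition binary_linear_form (h : int * int) : Prop :=
  [/\ h.1 != 0, h.2 != 0, `|h.2| <= h.1 & gcdz h.1 h.2 = 1].

(* A subset A of I_N = {0, ..., N} is a term of {set 'I_N.+1}. *)
Definition form_image (h : int * int) (N : nat) (A : {set 'I_N.+1}) :
    {fset int} :=
  [fset (h.1 * (a : nat)%:Z + h.2 * (b : nat)%:Z)%R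
  | a : 'I_N.+1 in A, b : 'I_N.+1 in A]%fset.

(* The law of the binomial random subset of I_N: each element is chosen
   independently with probability q. *)
Definition subset_weight (R : realType) (N : nat) (q : R)
    (A : {set 'I_N.+1}) : R :=
  \prod_(i < N.+1) (if i \in A then q else 1 - q).

Definition subset_prob (R : realType) (N : nat) (q : R)
    (E : pred {set 'I_N.+1}) : R :=
  \sum_(A : {set 'I_N.+1} | E A) subset_weight q A.

Lemma subset_probT (R : realType) (N : nat) (q : R) :
  subset_prob q (fun _ : {set 'I_N.+1} => true) = 1.
Proof.
transitivity (\prod_(i < N.+1) (q + (1 - q))); last first.
  by apply: big1 => i _; rewrite addrC subrK.
by rewrite bigA_distr; apply: eq_bigl => A; rewrite inE.
Qed.

Definition dominates (R : realType) (p : nat -> R) (f g : int * int) : Prop :=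
  (fun N => subset_prob (p N)
     (fun A : {set 'I_N.+1} =>
        (#|` form_image f A| > #|` form_image g A|)%N)) @ \oo --> (1 : R).

Definition is_o (R : realType) (a b : nat -> R) : Prop :=
  (fun N => a N / b N) @ \oo --> (0 : R).

Definition npow (R : realType) (s : R) : nat -> R := fun N => N%:R `^ s.

Definition parameter (R : realType) (p : nat -> R) : Prop :=
  [/\ forall N, 0 < p N < 1, is_o (npow (- 1)) p & is_o p (fun=> 1)].

(* c N^(-1/2) lies in (0, 1) only for large N, hence the equality is required
   eventually. *)
Definition eventually_critical (R : realType) (c : R) (p : nat -> R) : Prop :=
  \forall N \near \oo, p N = c * npow (- (1 / 2)) N.

Definition alpha (u v : int) : rat :=
  1 / u%:Q ^+ 2 * (`|v|%:Q / 3 + (u - `|v|)%:Q / 2).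

Lemma alphaE (u v : int) : u != 0 ->
  alpha u v = (3 * u - `|v|)%:Q / (6 * u%:Q ^+ 2).
Proof.
move=> u0; have u0' : u%:Q != 0 by rewrite intr_eq0.
by rewrite /alpha !rmorphB rmorphM /=; field.
Qed.

Definition g_ (R : realType) (u v : int) (x : R) : R :=
  (u + `|v|)%:~R - 2 * `|v|%:~R * ((1 - expR (- x)) / x)
  - (u - `|v|)%:~R * expR (- x).

Lemma g_range (R : realType) (u v : int) (x : R) :
  binary_linear_form (u, v) -> 0 < x -> 0 < g_ u v x < (u + `|v|)%:~R.
Proof.
case=> /= u0 v0 vu _ x0.
have V0 : 0 < `|v|%:~R :> R by rewrite ltr0z normr_gt0.
have UV : `|v|%:~R <= u%:~R :> R by rewrite ler_int.
have e0 : 0 < expR (- x) by exact: expR_gt0.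
have e1 : expR (- x) < 1 by rewrite -expR0 ltr_expR oppr_lt0.
have ex : 1 + - x < expR (- x) by apply: expR_gt1Dx; rewrite oppr_eq0 gt_eqF.
set q := (1 - expR (- x)) / x.
have q0 : 0 < q by rewrite divr_gt0// subr_gt0.
have q1 : q < 1 by rewrite ltr_pdivrMr// mul1r; lra.
rewrite /g_ -/q rmorphD rmorphB /=; apply/andP; split; nra.
Qed.

(* Main.v *)
Require Import Defs.
From HB Require Import structures.
From mathcomp Require Import all_boot all_order all_algebra.
From mathcomp Require Import finmap.
From mathcomp Require Import all_classical all_reals all_analysis.
From mathcomp Require Import ring lra zify.

Set Implicit Arguments.
Unset Strict Implicit.
Unset Printing Implicit Defensive.

Import Order.TTheory GRing.Theory Num.Theory.
Import numFieldNormedType.Exports.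

Local Open Scope classical_set_scope.
Local Open Scope ring_scope.

(* Second moment method.  Let p be the density of the random set A, and put
   lambda = N p^2.  A value k with r(k) representations h(a, b) = k is missed by
   h(A) with probability between (1 - p^2)^r(k) and (1 - p^2 (1 - p)^8)^r(k), up to
   the diagonal representations a = b: the representations of k form a graph of
   bounded degree on I_N, the lower bound is positive correlation of decreasing
   events, and the upper bound is a Janson-type inequality.  The same upper bound
   for pairs of values controls the variance of the number of missed values, which
   is therefore concentrated around sum_k exp(- p^2 r(k)); and r(k) is, up to O(1),
   the trapezoid min(k, |v| N, (u + |v|) N - k) / (u |v|).
   For bounded lambda this gives
     |h(A)| = p^2 N (N + 1) - N Gamma_h(lambda) + o(N lambda^2),
   where lambda - Gamma_h(lambda) = g_{u,v}(lambda / u), uniformly as lambda -> 0,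
   so that the cases p = o(N^(-1/2)) and p = c N^(-1/2) are treated together; for
   large lambda about 2 u |v| / p^2 values are missed.  Splitting at a threshold for
   lambda that depends only on the error probability covers every p in (i), also
   those for which lambda oscillates.
   The sign of g_{u1,v1}(lambda / u1) - g_{u2,v2}(lambda / u2) is found by
   differentiating until only a monotone function, whose value at 0 is
   6 (alpha_2 - alpha_1), is left, and then integrating the sign pattern back. *)

(** * Random subsets *)

(** The obstacle is cancellation. The term p^2 N (N + 1) counts ordered pairs of distinct elements
    and is the same for every form, so the comparison is decided by collisions, which for small
    lambda are of order N lambda^2 = N^3 p^4. Means have to be known up to o(N lambda^2), and
    fluctuations have to be smaller as well. The variance is at most a multiple of (N p)^3 + N, and
    (N p)^3 is negligible against (N lambda^2)^2 = N^6 p^8 exactly when N^3 p^5 tends to infinity: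
    this is the origin of N^(-3/5). Replacing p^2 by p^2 (1 - p)^8 is a relative error O(p); it
    moves the means by O(N^2 p^3), which is below N^3 p^4 once N p is large. For large lambda the
    lengths (u + |v|) N of the ranges decide if they differ; if they agree, the form with the
    smaller u |v| misses fewer values and wins. The form x + y is excluded because a pair and its
    reversal would represent the same value, so that the edges of a value would not be independent
    even to first order. *)

Section RandomSubset.
Context {R : realType} {N : nat} (p : R).
Hypothesis p01 : 0 < p < 1.
Implicit Types (A : {set 'I_N.+1}) (f g : {set 'I_N.+1} -> R).

Definition mean f : R := \sum_A subset_weight p A * f A.

Local Notation E := mean.
Local Notation Pr := (subset_prob p).

Lemma weight_ge0 A : 0 <= subset_weight p A.
Proof.
by case/andP: p01 => p0 p1; apply: prodr_ge0 => i _; case: ifP => _; lra.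
Qed.

Lemma prE (B : pred {set 'I_N.+1}) : Pr B = E (fun A => (B A)%:R).
Proof.
rewrite /subset_prob /mean big_mkcond; apply: eq_bigr => A _.
by case: (B A); rewrite ?mulr1 ?mulr0.
Qed.

Lemma mean_const (c : R) : E (fun=> c) = c.
Proof.
rewrite /mean -mulr_suml.
have := @subset_probT R N p; rewrite /subset_prob /= => ->.
by rewrite mul1r.
Qed.

Lemma mean_le f g : (forall A, f A <= g A) -> E f <= E g.
Proof. by move=> fg; apply: ler_sum => A _; rewrite ler_wpM2l ?weight_ge0. Qed.

Lemma meanD f g : E (fun A => f A + g A) = E f + E g.
Proof. by rewrite -big_split; apply: eq_bigr => A _; rewrite mulrDr. Qed.

Lemma meanZ (c : R) f : E (fun A => c * f A) = c * E f.
Proof. by rewrite mulr_sumr; apply: eq_bigr => A _; rewrite mulrCA. Qed.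

Lemma eq_mean f g : f =1 g -> E f = E g.
Proof. by move=> fg; apply: eq_bigr => A _; rewrite fg. Qed.

Lemma mean_sum (I : finType) (F : I -> {set 'I_N.+1} -> R) :
  E (fun A => \sum_i F i A) = \sum_i E (F i).
Proof.
by rewrite [RHS]exchange_big; apply: eq_bigr => A _; rewrite mulr_sumr.
Qed.

Lemma pr_ge0 (B : pred {set 'I_N.+1}) : 0 <= Pr B.
Proof. by apply: sumr_ge0 => A _; exact: weight_ge0. Qed.

Lemma pr_le (B C : pred {set 'I_N.+1}) : (forall A, B A -> C A) -> Pr B <= Pr C.
Proof.
move=> BC; rewrite !prE; apply: mean_le => A.
by have := BC A; case: (B A) => [->|] //; rewrite ler_nat.
Qed.

Lemma pr_le1 (B : pred {set 'I_N.+1}) : Pr B <= 1.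
Proof. by rewrite -(@subset_probT R N p); exact: pr_le. Qed.

Lemma prC (B : pred {set 'I_N.+1}) : Pr (fun A => ~~ B A) = 1 - Pr B.
Proof.
apply/eqP; rewrite eq_sym subr_eq addrC !prE -meanD; apply/eqP.
rewrite -[LHS](mean_const 1); apply: eq_mean => A.
by case: (B A); rewrite ?addr0 ?add0r.
Qed.

Lemma pr_or (B C : pred {set 'I_N.+1}) :
  Pr (fun A => B A || C A) <= Pr B + Pr C.
Proof.
rewrite !prE -meanD; apply: mean_le => A.
by case: (B A); case: (C A) => /=; lra.
Qed.

Let weight1 (x : 'I_N.+1) A : R :=
  \prod_(i < N.+1 | i != x) (if i \in A then p else 1 - p).

Let weightE x A :
  subset_weight p A = (if x \in A then p else 1 - p) * weight1 x A.
Proof. by rewrite /subset_weight (bigD1 x). Qed.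

Let weight1D x A : weight1 x (A :\ x) = weight1 x A.
Proof. by apply: eq_bigr => i ix; rewrite !inE ix. Qed.

(* Resampling the membership of [x]: both sides average [f] with [x] put in,
   over the law of the other elements. *)
Lemma mean_in x f :
  E (fun A => (x \in A)%:R * f A) = p * E (fun A => f (x |: A)).
Proof.
rewrite /mean (bigID (fun A : {set 'I_N.+1} => x \in A)) /= [X in _ + X]big1 ?addr0; last first.
  by move=> A /negPf ->; rewrite mul0r mulr0.
rewrite [in RHS](bigID (fun A : {set 'I_N.+1} => x \in A)) /= mulrDr.
have -> : \sum_(A : {set 'I_N.+1} | x \notin A) subset_weight p A * f (x |: A) =
    \sum_(A : {set 'I_N.+1} | x \in A) (1 - p) * weight1 x A * f A.
  rewrite (reindex_onto (fun A : {set 'I_N.+1} => A :\ x) (fun A => x |: A)) /=; last first.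
    by move=> A xA; rewrite finset.setU1K.
  apply: eq_big => [A|A].
    rewrite !inE eqxx /=; apply/eqP/idP => [h|/finset.setD1K//].
    by rewrite -h finset.setU11.
  rewrite !inE eqxx /= => /eqP xA.
  by rewrite (weightE x) !inE eqxx /= weight1D xA.
rewrite !mulr_sumr -big_split /=; apply: eq_bigr => A xA.
rewrite (weightE x) xA (finset.setUidPr _) ?finset.sub1set// mul1r.
by ring.
Qed.

Lemma mean_notin x f :
  E (fun A => (x \notin A)%:R * f A) = (1 - p) * E (fun A => f (A :\ x)).
Proof.
have -> : E (fun A => (x \notin A)%:R * f A) =
    E (fun A => (x \notin A)%:R * f (A :\ x)).
  apply: eq_mean => A; case: (boolP (x \in A)) => xA; rewrite ?mul0r//.
  by rewrite (finset.setDidPl _) // disjoint_sym disjoints1 xA.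
have -> : E (fun A => (x \notin A)%:R * f (A :\ x)) =
    E (fun A => f (A :\ x)) + (-1) * E (fun A => (x \in A)%:R * f (A :\ x)).
  rewrite -meanZ -meanD; apply: eq_mean => A.
  by case: (x \in A) => /=; lra.
rewrite (mean_in x (fun A => f (A :\ x))).
suff -> : E (fun A => f ((x |: A) :\ x)) = E (fun A => f (A :\ x)) by ring.
apply: eq_mean => A; congr f; apply/setP => i; rewrite !inE.
by case: (i == x).
Qed.

Lemma chebyshev_upper f (m t b : R) : 0 < t -> E f <= m ->
  E (fun A => (f A) ^+ 2) - (E f) ^+ 2 <= b ->
  Pr (fun A => m + t <= f A) <= b / t ^+ 2.
Proof.
move=> t0 fm vb; rewrite ler_pdivlMr ?exprn_gt0// mulrC.
apply: le_trans vb.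
have -> : E (fun A => f A ^+ 2) - E f ^+ 2 = E (fun A => (f A - E f) ^+ 2).
  have -> : E (fun A => (f A - E f) ^+ 2) =
      E (fun A => f A ^+ 2 + ((- 2 * E f) * f A + E f ^+ 2)).
    by apply: eq_mean => A; ring.
  by rewrite !meanD meanZ mean_const; ring.
rewrite prE -meanZ; apply: mean_le => A.
case: (leP (m + t) (f A)) => [h|_]; last by rewrite mulr0 sqr_ge0.
rewrite mulr1; nra.
Qed.

Lemma chebyshev_lower f (m t b : R) : 0 < t -> m <= E f ->
  E (fun A => (f A) ^+ 2) - (E f) ^+ 2 <= b ->
  Pr (fun A => f A <= m - t) <= b / t ^+ 2.
Proof.
move=> t0 fm vb.
have EN : E (fun A => - f A) = - E f.
  by rewrite -mulN1r -meanZ; apply: eq_mean => A; rewrite mulN1r.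
have -> : Pr (fun A => f A <= m - t) = Pr (fun A => - m + t <= - f A).
  by rewrite !prE; apply: eq_mean => A; congr (nat_of_bool _)%:R; apply/idP/idP; lra.
apply: chebyshev_upper => //; first by rewrite EN; lra.
rewrite EN sqrrN; apply: le_trans vb; rewrite lerD2r.
by apply: mean_le => A; rewrite sqrrN.
Qed.

Lemma markov_upper f (t b : R) : 0 < t -> (forall A, 0 <= f A) -> E f <= b ->
  Pr (fun A => t <= f A) <= b / t.
Proof.
move=> t0 f0 fb; rewrite ler_pdivlMr// mulrC; apply: le_trans fb.
rewrite prE -meanZ; apply: mean_le => A.
by case: (leP t (f A)) => [|_]; rewrite ?mulr1// mulr0.
Qed.

Lemma mean_card : E (fun A => #|A|%:R) = p * N.+1%:R.
Proof.
have -> : E (fun A => #|A|%:R) = E (fun A => \sum_(x < N.+1) (x \in A)%:R * 1).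
  apply: eq_mean => A.
  rewrite -sum1_card natr_sum big_mkcond /=; apply: eq_bigr => i _.
  by case: (i \in A); rewrite ?mulr1// mul0r.
rewrite mean_sum (eq_bigr (fun=> p)) => [|i _].
  by rewrite sumr_const card_ord mulr_natr.
by rewrite (mean_in i (fun=> 1)) mean_const mulr1.
Qed.

Definition edge_free (S : seq ('I_N.+1 * 'I_N.+1)) A : bool :=
  all (fun e => ~~ ((e.1 \in A) && (e.2 \in A))) S.

Lemma edge_free_sub S (A B : {set 'I_N.+1}) : A \subset B -> edge_free S B -> edge_free S A.
Proof.
move=> /fintype.subsetP AB /allP h; apply/allP => e eS.
by apply: contra (h _ eS) => /andP[/AB -> /AB ->].
Qed.

(** The subtracted term is the probability that [S] is free while [e] lies in the random set;
    resampling its two distinct endpoints produces the factor p^2. *)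
Let pr_free_cons e S : e.1 != e.2 ->
  Pr (edge_free (e :: S)) = Pr (edge_free S) -
    p ^+ 2 * Pr (fun A => edge_free S (e.1 |: (e.2 |: A))).
Proof.
move=> e12.
have -> : p ^+ 2 * Pr (fun A => edge_free S (e.1 |: (e.2 |: A))) =
    E (fun A => (e.1 \in A)%:R * ((e.2 \in A)%:R * (edge_free S A)%:R)).
  rewrite (mean_in e.1) expr2 -mulrA prE; congr (_ * _).
  rewrite -(mean_in e.2 (fun A => (edge_free S (e.1 |: A))%:R)).
  apply: eq_mean => A.
  by rewrite !inE (eq_sym e.2) (negPf e12).
rewrite !prE -mulN1r -meanZ -meanD; apply: eq_mean => A /=.
by case: (e.1 \in A); case: (e.2 \in A); case: (edge_free S A) => /=; lra.
Qed.

(** Freeness is a decreasing event, so forcing the endpoints of one more edge into the set can only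
    lower its probability. *)
Lemma pr_free_ge S : all (fun e => e.1 != e.2) S ->
  (1 - p ^+ 2) ^+ size S <= Pr (edge_free S).
Proof.
case/andP: (p01) => p0 p1.
elim: S => [|e S ih] /=; first by rewrite expr0 prE mean_const.
case/andP=> e12 /ih{}ih; rewrite (pr_free_cons S e12) exprS.
have h : Pr (fun A => edge_free S (e.1 |: (e.2 |: A))) <= Pr (edge_free S).
  apply: pr_le => A; apply: edge_free_sub.
  by rewrite (fintype.subset_trans (finset.subsetUr [set e.2] A))// finset.subsetUr.
have p21 : p ^+ 2 <= 1 by rewrite exprn_ile1//; lra.
have p20 : 0 <= p ^+ 2 by rewrite sqr_ge0.
apply: (@le_trans _ _ ((1 - p ^+ 2) * Pr (edge_free S))); last by nra.
by apply: ler_wpM2l => //; lra.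
Qed.

Definition neighbours (S : seq ('I_N.+1 * 'I_N.+1)) x : {set 'I_N.+1} :=
  [set y | ((x, y) \in S) || ((y, x) \in S)].

Let pr_free_avoid S (W : seq 'I_N.+1) :
  (1 - p) ^+ size W * Pr (edge_free S) <= Pr (fun A => edge_free S A && ~~ has (mem A) W).
Proof.
case/andP: (p01) => p0 p1.
elim: W => [|x W ih].
  by rewrite expr0 mul1r; apply: pr_le => A /= ->.
rewrite exprS -mulrA.
have -> : Pr (fun A => edge_free S A && ~~ has (mem A) (x :: W)) =
    (1 - p) * E (fun A => (edge_free S (A :\ x) && ~~ has (mem (A :\ x)) W)%:R).
  rewrite -(mean_notin x (fun A => (edge_free S A && ~~ has (mem A) W)%:R)).
  rewrite prE; apply: eq_mean => A /=.
  by case: (x \in A); rewrite /= ?andbF ?mul0r ?mul1r.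
apply: ler_wpM2l; first lra.
apply: le_trans ih _; rewrite -prE; apply: pr_le => A /andP[fA hA].
apply/andP; split; first by apply: edge_free_sub fA; exact: finset.subD1set.
apply: contra hA => /hasP[y yW]; rewrite inE => /finset.setD1P[_ yA].
by apply/hasP; exists y.
Qed.

(* Given that [e] lies in the random set, freeness of the other pairs is implied
   by freeness together with avoidance of the neighbours of [e]; the latter costs
   only a factor [1 - p] per neighbour, by monotonicity. *)
Lemma pr_free_le (d : nat) S : uniq S -> all (fun e => e.1 != e.2) S ->
    {in S, forall e, (e.2, e.1) \notin S} ->
    (forall x, (#|neighbours S x| <= d)%N) ->
  Pr (edge_free S) <= (1 - p ^+ 2 * (1 - p) ^+ (d + d)) ^+ size S.
Proof.
case/andP: (p01) => p0 p1.
elim: S => [|e S ih]; first by move=> *; rewrite expr0 pr_le1.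
rewrite [uniq _]/= => /andP[eS uS]; rewrite [all _ _]/= => /andP[e12 dS] rev deg.
have rev' : {in S, forall e, (e.2, e.1) \notin S}.
  by move=> e' e'S; have := rev e'; rewrite !inE e'S orbT negb_or => /(_ isT)/andP[].
have sub x : neighbours S x \subset neighbours (e :: S) x.
  by apply/fintype.subsetP => y; rewrite !inE => /orP[] ->; rewrite ?orbT.
have {}ih := ih uS dS rev' (fun x => leq_trans (subset_leq_card (sub x)) (deg x)).
rewrite (pr_free_cons S e12) [size _]/= [_ ^+ (size S).+1]exprS.
set W := enum (neighbours S e.1) ++ enum (neighbours S e.2).
have sW : (size W <= d + d)%N.
  rewrite size_cat -!cardE leq_add// (leq_trans (subset_leq_card (sub _)))//.
have eSr : (e.2, e.1) \notin S.
  by have := rev e; rewrite inE eqxx inE negb_or => /(_ isT)/andP[].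
have h : (1 - p) ^+ (d + d) * Pr (edge_free S) <=
    Pr (fun A => edge_free S (e.1 |: (e.2 |: A))).
  apply: (@le_trans _ _ ((1 - p) ^+ size W * Pr (edge_free S))).
    rewrite ler_wpM2r ?pr_ge0// ler_wiXn2l//; lra.
  apply: le_trans (pr_free_avoid S W) _; apply: pr_le => A /andP[/allP fA hW].
  apply/allP => e' e'S; apply/negP => /andP[].
  have e'12 := allP dS _ e'S.
  have nW y : ((e.1, y) \in S) || ((y, e.1) \in S) || ((e.2, y) \in S) || ((y, e.2) \in S) -> y \notin A.
    move=> h; apply: contra hW => yA; apply/hasP; exists y => //.
    by rewrite mem_cat !mem_enum !inE -orbA in h *.
  (* Each end of the edge is [e.1], [e.2] or in [A]. Both ends in [e] would make it a loop, [e]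
     itself or the reversal of [e], all excluded; one end in [e] puts the other into [W]; both in
     [A] contradicts freeness. *)
  move: e'S e'12 (fA _ e'S); case: e' => x y /= e'S xy; rewrite negb_and.
  have eE : e = (e.1, e.2) by case: (e).
  rewrite !inE => nA /orP[/eqP xE|/orP[/eqP xE|xA]] /orP[/eqP yE|/orP[/eqP yE|yA]].
  - by rewrite xE yE eqxx in xy.
  - by rewrite xE yE -eE (negPf eS) in e'S.
  - by have := nW y; rewrite -xE e'S => /(_ isT); rewrite yA.
  - by rewrite xE yE (negPf eSr) in e'S.
  - by rewrite xE yE eqxx in xy.
  - by have := nW y; rewrite -xE e'S !orbT => /(_ isT); rewrite yA.
  - by have := nW x; rewrite -yE e'S !orbT => /(_ isT); rewrite xA.
  - by have := nW x; rewrite -yE e'S !orbT => /(_ isT); rewrite xA.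
  - by rewrite xA yA in nA.
have q0 : 0 <= p ^+ 2 * (1 - p) ^+ (d + d) by rewrite mulr_ge0// exprn_ge0//; lra.
have q1 : p ^+ 2 * (1 - p) ^+ (d + d) <= 1 by rewrite mulr_ile1 ?exprn_ge0 ?exprn_ile1//; lra.
have p2 : 0 <= p ^+ 2 by rewrite exprn_ge0//; lra.
have P0 := pr_ge0 (edge_free S).
set x := (1 - p) ^+ (d + d) in h q0 q1 ih *.
set y := Pr (edge_free S) in h ih P0 *; set z := Pr _ in h *.
apply: (@le_trans _ _ ((1 - p ^+ 2 * x) * y)); first nra.
by apply: ler_wpM2l => //; lra.
Qed.

End RandomSubset.

(** * Representations by a binary linear form *)

Section Representations.
Variables (U V N : nat) (neg : bool).
Implicit Types A : {set 'I_N.+1}.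
Hypotheses (V_gt0 : (0 < V)%N) (leVU : (V <= U)%N) (neg_eq : U = V -> neg).

(* Up to the shift by [V * N], which makes all values nonnegative, this is
   [U a + V b] or [U a - V b]. *)
Definition fval (a b : 'I_N.+1) : nat := (U * a + V * (if neg then N - b else b))%N.

(** Diagonal pairs are left out, since (a, a) lies in the random set with probability p instead of
    p^2; [diag_only] accounts for them. *)
Definition reps (k : nat) : seq ('I_N.+1 * 'I_N.+1) :=
  enum [set e : 'I_N.+1 * 'I_N.+1 | (e.1 != e.2) && (fval e.1 e.2 == k)]%SET.

Lemma mem_reps k e : (e \in reps k) = (e.1 != e.2) && (fval e.1 e.2 == k).
Proof. by rewrite mem_enum inE. Qed.

Lemma fval_injr a b b' : fval a b = fval a b' -> b = b'.
Proof.
move=> h; apply/val_inj => /=.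
have := ltn_ord b; have := ltn_ord b'.
by move: h; rewrite /fval; case: neg; nia.
Qed.

Lemma fval_injl a a' b : fval a b = fval a' b -> a = a'.
Proof. by move=> h; apply/val_inj => /=; move: h; rewrite /fval; nia. Qed.

Lemma fval_le a b : (fval a b < ((U + V) * N).+1)%N.
Proof.
rewrite ltnS mulnDl leq_add// leq_mul2l ?leq_ord ?orbT//.
by case: neg; rewrite ?leq_subr ?leq_ord ?orbT.
Qed.

(** This is where x + y has to be excluded: for it [fval] is symmetric. *)
Lemma fval_swap a b : fval a b = fval b a -> a = b.
Proof.
move=> h; apply/val_inj => /=.
have := ltn_ord a; have := ltn_ord b.
move: h neg_eq; rewrite /fval; case: neg => h hn; last first.
  have : U <> V by move=> /hn.
  nia.
nia.
Qed.

(** A pair with value l whose reversal has value k solves a linear system of determinant U^2 - V^2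
    up to sign. The determinant vanishes only for U = V; then the two values add up to 2 N U, which
    the hypothesis on l forbids. *)
Lemma fval_swap_uniq k l e e' : (U = V -> l <> (2 * N * U - k)%N) ->
  e \in reps l -> e' \in reps l ->
  (e.2, e.1) \in reps k -> (e'.2, e'.1) \in reps k -> e = e'.
Proof.
case: e e' => [a b] [a' b'] hUV; rewrite !mem_reps /=.
move=> /andP[_ /eqP h1] /andP[_ /eqP h2] /andP[_ /eqP h3] /andP[_ /eqP h4].
have := ltn_ord a; have := ltn_ord b; have := ltn_ord a'; have := ltn_ord b'.
move=> ltb' lta' ltb lta.
have nUV : U <> V.
  move=> UV; apply: (hUV UV); move: h1 h3; rewrite /fval (neg_eq UV) -UV; nia.
suff aa' : (a : nat) = a'.
  have -> : a = a' by exact: val_inj.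
  congr pair; apply: (@fval_injr a'); rewrite h2 -h1 /fval.
  by rewrite aa'.
suff h : (U%:Z ^+ 2 - V%:Z ^+ 2) * (a%:Z - a'%:Z) = 0.
  by move/eqP: h; rewrite mulf_eq0 subr_sqr mulf_eq0; lia.
have leV (c : 'I_N.+1) : (V * c <= V * N)%N by rewrite leq_mul2l -ltnS ltn_ord orbT.
have := (leV a, leV a', (leV b, leV b')) => -[[la la'] [lb lb']].
have eq1 : fval a b = fval a' b' by rewrite h1 h2.
have eq2 : fval b a = fval b' a' by rewrite h3 h4.
move: eq1 eq2; rewrite /fval; clear -la la' lb lb'; case: neg; rewrite ?mulnBr => eq1 eq2.
  have e1 : U%:Z * (a%:Z - a'%:Z) = V%:Z * (b%:Z - b'%:Z) by lia.
  have e2 : U%:Z * (b%:Z - b'%:Z) = V%:Z * (a%:Z - a'%:Z) by lia.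
  by rewrite mulrBl !expr2 -!mulrA e1 -e2; ring.
have e1 : U%:Z * (a%:Z - a'%:Z) = - V%:Z * (b%:Z - b'%:Z) by lia.
have e2 : U%:Z * (b%:Z - b'%:Z) = - V%:Z * (a%:Z - a'%:Z) by lia.
rewrite mulrBl !expr2 -!mulrA e1 mulNr mulrN mulrCA e2; ring.
Qed.

Definition nreps (k : nat) : nat := size (reps k).

Lemma neighbours_reps k x :
  neighbours (reps k) x = [set y | (x, y) \in reps k] :|: [set y | (y, x) \in reps k].
Proof. by apply/setP => y; rewrite !inE. Qed.

Lemma card_neighbours_reps k x : (#|neighbours (reps k) x| <= 2)%N.
Proof.
rewrite neighbours_reps (leq_trans (leq_card_setU _ _))// -[2%N]/(1 + 1)%N leq_add//.
  apply/card_le1_eqP => y y'; rewrite !inE !mem_reps /= => /andP[_ /eqP h] /andP[_ /eqP h'].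
  by apply: (@fval_injr x); rewrite h h'.
apply/card_le1_eqP => y y'; rewrite !inE !mem_reps /= => /andP[_ /eqP h] /andP[_ /eqP h'].
by apply: (@fval_injl _ _ x); rewrite h h'.
Qed.

Lemma neighbours_cat (S S' : seq ('I_N.+1 * 'I_N.+1)) x :
  (#|neighbours (S ++ S') x| <= #|neighbours S x| + #|neighbours S' x|)%N.
Proof.
rewrite (leq_trans _ (leq_card_setU _ _))// subset_leq_card//; apply/fintype.subsetP => y.
by rewrite !inE !mem_cat => /orP[/orP[->|->]|/orP[->|->]]; rewrite ?orbT.
Qed.

Lemma sub_neighbours (S S' : seq ('I_N.+1 * 'I_N.+1)) x : {subset S <= S'} ->
  (#|neighbours S x| <= #|neighbours S' x|)%N.
Proof.
move=> SS; apply/subset_leq_card/fintype.subsetP => y.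
by rewrite !inE => /orP[] /SS ->; rewrite ?orbT.
Qed.

Section Probability.
Context {R : realType} (p : R).
Hypothesis p01 : 0 < p < 1.
Local Notation Pr := (subset_prob p).
Local Notation E := (mean p).

(* The exponent [4 + 4] counts the neighbours of a pair in the union of the
   representations of two values. *)
Definition hit_prob : R := p ^+ 2 * (1 - p) ^+ (4 + 4).
Local Notation q := hit_prob.

Lemma hit_prob_gt0 : 0 < q.
Proof. by rewrite mulr_gt0 ?exprn_gt0//; case/andP: p01 => *; lra. Qed.

Lemma hit_prob_lt1 : q < 1.
Proof.
rewrite /hit_prob; case/andP: p01 => p0 p1; rewrite mulr_ilt1 ?exprn_ge0 ?exprn_ilt1//; lra.
Qed.

Lemma reps_offdiag k : all (fun e => e.1 != e.2) (reps k).
Proof. by apply/allP => e; rewrite mem_reps => /andP[]. Qed.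

Lemma reps_swap k : {in reps k, forall e, (e.2, e.1) \notin reps k}.
Proof.
move=> e; rewrite !mem_reps /= => /andP[e12 /eqP h]; apply/negP => /andP[_ /eqP h'].
by move/eqP: e12; apply; apply: fval_swap; rewrite h h'.
Qed.

Lemma pr_free_reps k :
  (1 - p ^+ 2) ^+ nreps k <= Pr (edge_free (reps k)) <= (1 - q) ^+ nreps k.
Proof.
rewrite pr_free_ge ?reps_offdiag//=; apply: pr_free_le => //.
- exact: enum_uniq.
- exact: reps_offdiag.
- exact: reps_swap.
- by move=> x; rewrite (leq_trans (card_neighbours_reps k x)).
Qed.

(** An edge of l that reverses an edge of k imposes the same condition on the set. There is at most
    one, by [fval_swap_uniq]; dropping it from the union costs the factor (1 - q)^-1. For x - y the
    values k and 2 N - k have the same edges up to reversal, whence the exception. *)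
Lemma pr_free_reps2 k l : k <> l -> (U = V -> l <> (2 * N * U - k)%N) ->
  Pr (fun A : {set 'I_N.+1} => edge_free (reps k) A && edge_free (reps l) A) <=
    (1 - q)^-1 * (1 - q) ^+ nreps k * (1 - q) ^+ nreps l.
Proof.
move=> kl hl.
have q1 := hit_prob_lt1; have q0 := hit_prob_gt0.
set L := [seq e <- reps l | (e.2, e.1) \notin reps k].
have subL : {subset L <= reps l} by move=> e; rewrite mem_filter => /andP[].
have disj e : e \in reps k -> e \in reps l -> False.
  rewrite !mem_reps => /andP[_ /eqP h] /andP[_ /eqP h'].
  by apply: kl; rewrite -h -h'.
have sL : (nreps l <= (size L).+1)%N.
  rewrite /nreps -(count_predC (fun e => (e.2, e.1) \in reps k) (reps l)).
  rewrite -[X in (_ <= X)%N]add1n leq_add//; last by rewrite size_filter.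
  rewrite -size_filter.
  case E1 : [seq _ <- _ | _] => [|e [|e' s]] //.
  have u : uniq (e :: e' :: s) by rewrite -E1 filter_uniq ?enum_uniq.
  have : e \in e :: e' :: s by rewrite inE eqxx.
  have : e' \in e :: e' :: s by rewrite !inE eqxx orbT.
  rewrite -E1 2!(mem_filter _ _ (reps l)) => /andP[h1 h2] /andP[h3 h4].
  by move: u; rewrite (fval_swap_uniq hl h4 h2 h3 h1) /= inE eqxx.
apply: (@le_trans _ _ (Pr (edge_free (reps k ++ L)))).
  apply: pr_le => // A /andP[fk /allP fl]; rewrite /edge_free all_cat; apply/andP; split => //.
  by apply/allP => e /subL /fl.
apply: (@le_trans _ _ ((1 - q) ^+ size (reps k ++ L))); last first.
  rewrite size_cat exprD -mulrA mulrCA ler_wpM2l ?exprn_ge0//; first by lra.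
  rewrite ler_pdivlMl; last lra.
  rewrite -exprS ler_wiXn2l//; lra.
apply: pr_free_le => //.
- rewrite cat_uniq enum_uniq /= filter_uniq ?enum_uniq ?andbT//.
  by apply/hasPn => e /subL el; apply/negP => ek; exact: (disj e).
- rewrite all_cat reps_offdiag; apply/allP => e /subL; exact: (allP (reps_offdiag l)).
- move=> e; rewrite !mem_cat => /orP[ek|eL]; rewrite negb_or.
    rewrite reps_swap//=; apply/negP; rewrite mem_filter /= => /andP[].
    by rewrite -surjective_pairing ek.
  apply/andP; split; first by move: eL; rewrite mem_filter => /andP[].
  by apply: (contra (@subL _)); apply: reps_swap; exact: subL.
- move=> x; rewrite (leq_trans (neighbours_cat _ _ _))// -[4%N]/(2 + 2)%N leq_add//.
    exact: card_neighbours_reps.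
  by rewrite (leq_trans (sub_neighbours x subL))// card_neighbours_reps.
Qed.

Definition nfree (A : {set 'I_N.+1}) : R :=
  \sum_(k < ((U + V) * N).+1) (edge_free (reps k) A)%:R.

(** The enumerator of the values by their number of off-diagonal representations; evaluated at 1 -
    p^2 and at 1 - q it encloses the mean of [nfree]. *)
Definition gen_missing (y : R) : R := \sum_(k < ((U + V) * N).+1) y ^+ nreps k.
Local Notation S := gen_missing.

Lemma mean_nfree : S (1 - p ^+ 2) <= E nfree <= S (1 - q).
Proof.
rewrite /nfree mean_sum; apply/andP; split; apply: ler_sum => k _.
  by rewrite -prE; case/andP: (pr_free_reps k).
by rewrite -prE; case/andP: (pr_free_reps k).
Qed.

(** For each k, at most two l escape [pr_free_reps2]: k itself and its reflection. They are bounded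
    by the event for k alone, which gives the summand 2 S. *)
Lemma mean_nfree2 :
  E (fun A => nfree A ^+ 2) <= (1 - q)^-1 * S (1 - q) ^+ 2 + 2 * S (1 - q).
Proof.
have q1 := hit_prob_lt1; have q0 := hit_prob_gt0.
have -> : E (fun A => nfree A ^+ 2) = \sum_(k < ((U + V) * N).+1) \sum_(l < ((U + V) * N).+1)
    Pr (fun A : {set 'I_N.+1} => edge_free (reps k) A && edge_free (reps l) A).
  transitivity (E (fun A => \sum_(k < ((U + V) * N).+1) \sum_(l < ((U + V) * N).+1)
      (edge_free (reps k) A && edge_free (reps l) A)%:R)).
    apply: eq_mean => A; rewrite expr2 /nfree mulr_suml; apply: eq_bigr => k _.
    by rewrite mulr_sumr; apply: eq_bigr => l _; rewrite -natrM mulnb.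
  rewrite mean_sum; apply: eq_bigr => k _.
  by rewrite mean_sum; apply: eq_bigr => l _; rewrite prE.
rewrite expr2 mulrA -mulrDl {2}/S mulr_sumr; apply: ler_sum => k _.
have yk : 0 <= (1 - q) ^+ nreps k by rewrite exprn_ge0//; lra.
set c := (2 * N * U - k)%N.
have one (d : nat) : \sum_(l < ((U + V) * N).+1) ((l : nat) == d)%:R <= (1 : R).
  by rewrite -natr_sum -big_mkcond /= (big_ord1_eq addn (fun=> 1%N)); case: ifP.
apply: (@le_trans _ _ (\sum_(l < ((U + V) * N).+1)
   ((1 - q)^-1 * (1 - q) ^+ nreps k * (1 - q) ^+ nreps l
    + (1 - q) ^+ nreps k * (((l : nat) == k)%:R + ((l : nat) == c)%:R)))).
  apply: ler_sum => l _.
  have t0 : 0 <= (1 - q)^-1 * (1 - q) ^+ nreps k * (1 - q) ^+ nreps l.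
    by rewrite !mulr_ge0 ?invr_ge0 ?exprn_ge0//; lra.
  have ub : Pr (fun A : {set 'I_N.+1} => edge_free (reps k) A && edge_free (reps l) A) <= (1 - q) ^+ nreps k.
    case/andP: (pr_free_reps k) => _; apply: le_trans.
    by apply: pr_le => // A /andP[].
  case: (eqVneq (l : nat) k) => [kl|/eqP kl].
    by have := mulr_ge0 yk (ler0n R ((l : nat) == c)); rewrite mulrDr mulr1; lra.
  case: (eqVneq (l : nat) c) => [cl|/eqP cl]; first by rewrite add0r mulr1; lra.
  rewrite addr0 mulr0 addr0; apply: pr_free_reps2 => //; exact/nesym.
rewrite big_split /= -!mulr_sumr big_split /= -/(S (1 - q)).
have h := ler_wpM2l yk (lerD (one k) (one c)).
set i := (1 - q)^-1; set T := S _; move: h.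
set x := (1 - q) ^+ _ => h; lra.
Qed.

Definition covered (A : {set 'I_N.+1}) (k : nat) : bool :=
  [exists a in A, exists b in A, fval a b == k].

Definition image_size (A : {set 'I_N.+1}) : nat :=
  #|[set k : 'I_((U + V) * N).+1 | covered A k]%SET|.

Lemma image_sizeE A :
  (image_size A)%:R = \sum_(k < ((U + V) * N).+1) (covered A k)%:R :> R.
Proof.
rewrite /image_size -sum1_card natr_sum big_mkcond; apply: eq_bigr => k _.
by rewrite inE; case: covered.
Qed.

Lemma coveredP A (k : nat) :
  reflect (exists a b, [/\ a \in A, b \in A & fval a b = k]) (covered A k).
Proof.
apply: (iffP existsP) => [[a /andP[aA /existsP[b /andP[bA /eqP h]]]]|[a [b [aA bA h]]]].
  by exists a, b.
by exists a; rewrite aA; apply/existsP; exists b; rewrite bA h eqxx.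
Qed.

Lemma image_size_ge A : ((U + V) * N).+1%:R <= (image_size A)%:R + nfree A.
Proof.
rewrite image_sizeE /nfree -big_split /= -[X in X%:R <= _]card_ord -sum1_card natr_sum.
apply: ler_sum => k _; rewrite -natrD ler_nat.
case: (boolP (covered A k)) => //= nc; rewrite add0n lt0b.
apply/allP => e; rewrite mem_reps => /andP[_ /eqP h]; apply: contra nc => /andP[h1 h2].
by apply/coveredP; exists e.1, e.2.
Qed.

(** A value is both hit and counted by [nfree] exactly when all its representations inside [A] are
    diagonal; the elements responsible for this are counted here. *)
Definition diag_only (A : {set 'I_N.+1}) : R :=
  \sum_a (a \in A)%:R * (edge_free (reps (fval a a)) A)%:R.

Lemma image_size_le A :
  (image_size A)%:R + nfree A <= ((U + V) * N).+1%:R + diag_only A.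
Proof.
have -> : diag_only A = \sum_(k < ((U + V) * N).+1) \sum_a
    (a \in A)%:R * (edge_free (reps (fval a a)) A)%:R * ((k : nat) == fval a a)%:R.
  rewrite exchange_big; apply: eq_bigr => a _; rewrite -mulr_sumr /=.
  rewrite (_ : \sum_k _ = 1) ?mulr1//.
  by rewrite -natr_sum -big_mkcond /= (big_ord1_eq addn (fun=> 1%N)) fval_le.
rewrite image_sizeE /nfree -[X in X%:R + _]card_ord -sum1_card natr_sum -!big_split /=.
apply: ler_sum => k _.
have g0 a : 0 <= (a \in A)%:R * (edge_free (reps (fval a a)) A)%:R *
   ((k : nat) == fval a a)%:R :> R by rewrite -!natrM ler0n.
have s0 : 0 <= \sum_a (a \in A)%:R * (edge_free (reps (fval a a)) A)%:R *
   ((k : nat) == fval a a)%:R :> R by exact: sumr_ge0.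
case: (boolP (covered A k)) => [|_]; last first.
  by case: (edge_free (reps k) A) => /=; lra.
case: (boolP (edge_free (reps k) A)) => [fk|_ _]; last by rewrite /=; lra.
move/coveredP => [a [b [aA bA h]]]; rewrite lerD2l.
have ab : a = b.
  apply/eqP; apply/idP/idP; apply: contraT => ab.
  by move/allP: fk => /(_ (a, b)); rewrite mem_reps /= ab h eqxx aA bA => /(_ isT).
rewrite (bigD1 a)//= aA ab in h *; rewrite h fk eqxx !mulr1 lerDl.
exact: sumr_ge0.
Qed.

Lemma diag_only_le A : diag_only A <= #|A|%:R.
Proof.
rewrite -sum1_card natr_sum big_mkcond /=; apply: ler_sum => a _.
by case: (a \in A); rewrite ?mul0r// mul1r lern1 leq_b1.
Qed.

(** Resampling a gives the factor p, and freeness survives the removal of a. As a -> [fval a a] is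
    injective for U <> V, the resulting events belong to different summands of [nfree]. For large
    lambda the bound by the size of [A] would be too weak. *)
Lemma mean_diag_only : U <> V -> E diag_only <= p * E nfree.
Proof.
move=> nUV; case/andP: (p01) => p0 p1.
rewrite /diag_only mean_sum.
apply: (@le_trans _ _ (\sum_(a < N.+1) p * Pr (edge_free (reps (fval a a))))).
  apply: ler_sum => a _; rewrite mean_in ler_wpM2l//; first lra.
  rewrite -prE; apply: pr_le => // A; apply: edge_free_sub; exact: finset.subsetUr.
rewrite -mulr_sumr ler_wpM2l//; first lra.
rewrite mean_sum.
rewrite [leRHS](eq_bigr (fun k : 'I_((U + V) * N).+1 => Pr (edge_free (reps k)))); last first.
  by move=> k _; rewrite prE.
pose g (a : 'I_N.+1) : 'I_((U + V) * N).+1 := Ordinal (fval_le a a).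
have gi : injective g.
  move=> a a' /(congr1 val) /= h; apply/val_inj => /=.
  have := ltn_ord a; have := ltn_ord a'; move: h; rewrite /fval; case: neg; nia.
rewrite (bigID (fun k => k \in [set g a | a in 'I_N.+1]%SET)) /=.
rewrite [X in _ <= X + _]big_imset /=; last by move=> a a' _ _; exact: gi.
rewrite lerDl; apply: sumr_ge0 => k _; exact: pr_ge0.
Qed.

End Probability.

Definition ndiag (k : nat) : nat := #|[set a | fval a a == k]%SET|.
Definition nrep_all (k : nat) : nat :=
  #|[set e : 'I_N.+1 * 'I_N.+1 | fval e.1 e.2 == k]%SET|.

Lemma nrep_allE k : nrep_all k = (nreps k + ndiag k)%N.
Proof.
rewrite /nrep_all -(finset.cardsID [set e : 'I_N.+1 * 'I_N.+1 | e.1 != e.2]%SET).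
congr addn.
  rewrite /nreps /reps -cardE; apply: eq_card => e; rewrite !inE andbC; reflexivity.
rewrite -[RHS](card_imset _ (f := fun a => (a, a))); last by move=> a b [].
apply: eq_card => -[a b]; rewrite !inE /= negbK; apply/andP/imsetP.
  by case=> /eqP -> h; exists b; rewrite ?inE.
by case=> c; rewrite inE => h [-> ->]; rewrite eqxx.
Qed.

Lemma sum_card_fiber (T : finType) (n : nat) (f : T -> nat) :
  (forall x, (f x < n)%N) -> (\sum_(k < n) #|[set x | f x == k]%SET|)%N = #|T|.
Proof.
move=> fn; rewrite -[RHS]sum1_card (partition_big (fun x => Ordinal (fn x)) xpredT)//=.
by apply: eq_bigr => k _; rewrite -sum1_card; apply: eq_bigl => x; rewrite inE.
Qed.

Lemma sum_ndiag : (\sum_(k < ((U + V) * N).+1) ndiag k)%N = N.+1.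
Proof. by rewrite sum_card_fiber ?card_ord// => a; exact: fval_le. Qed.

Lemma sum_nreps : (\sum_(k < ((U + V) * N).+1) nreps k)%N = (N * N.+1)%N.
Proof.
apply: (@addIn N.+1).
transitivity (\sum_(k < ((U + V) * N).+1) (nreps k + ndiag k))%N.
  by rewrite big_split /= sum_ndiag.
under [LHS]eq_bigr => k _ do rewrite -nrep_allE.
rewrite sum_card_fiber => [|e]; last exact: fval_le.
by rewrite card_prod card_ord; lia.
Qed.

Lemma ndiag_le1 k : U <> V -> (ndiag k <= 1)%N.
Proof.
move=> nUV; apply/card_le1_eqP => a a'; rewrite !inE => /eqP h /eqP h'.
apply/val_inj => /=; have := ltn_ord a; have := ltn_ord a'.
by move: h h'; rewrite /fval; case: neg; nia.
Qed.

End Representations.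

(** * Counting representations *)

Lemma count_residue (V a0 n : nat) : (a0 < V)%N ->
  (\sum_(0 <= a < n) (a %% V == a0))%N = (n %/ V + (a0 < n %% V))%N.
Proof.
move=> a0V; elim: n => [|n ih]; first by rewrite big_nil div0n mod0n.
have V0 : (0 < V)%N by apply: leq_ltn_trans a0V.
rewrite big_nat_recr//= ih.
have := ltn_pmod n V0; have := divn_eq n V.
set q := (n %/ V)%N; set r := (n %% V)%N => nE rV.
case: (ltnP r.+1 V) => h.
  have -> : (n.+1 %/ V)%N = q by rewrite nE -addnS divnMDl// divn_small// addn0.
  have -> : (n.+1 %% V)%N = r.+1 by rewrite nE -addnS modnMDl modn_small.
  lia.
have rE : r = V.-1 by lia.
have -> : n.+1 = (q.+1 * V)%N by rewrite nE rE; nia.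
by rewrite mulnK// modnMl; lia.
Qed.

Lemma residue_bound (V a0 n : nat) : (0 < V)%N ->
  (V * (n %/ V + (a0 < n %% V)) <= n + V)%N /\
  (n <= V * (n %/ V + (a0 < n %% V)) + V)%N.
Proof.
move=> V0; have := divn_eq n V; have := ltn_pmod n V0.
set x := (n %/ V)%N; set y := (n %% V)%N => h1 h2; rewrite mulnDr (mulnC V x).
by case: (a0 < y)%N; rewrite ?muln1 ?muln0; lia.
Qed.

Lemma residue_exists (U V k : nat) : (0 < V)%N -> (0 < U)%N -> coprime U V ->
  exists2 a0, (a0 < V)%N &
    forall a, (U * a = k %[mod V]) <-> (a %% V)%N = a0.
Proof.
move=> V0 U0 cUV; case: (egcdnP V U0) => x y h _.
move: h; rewrite (eqP cUV) => h.
have key : (U * (k * x) = k %[mod V])%N.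
  by rewrite mulnC -mulnA h mulnDr muln1 mulnA modnMDl.
exists ((k * x) %% V)%N; first by rewrite ltn_mod.
have cancel a : (x * (U * a) = a %[mod V])%N by rewrite mulnA h mulnDl mul1n mulnAC modnMDl.
move=> a; rewrite -key; split => h'.
  by rewrite -[LHS]cancel -modnMmr h' modnMmr cancel.
by rewrite -[LHS]modnMmr h' modnMmr.
Qed.

Section Counting.
Variables (U V N : nat) (neg : bool).
Hypotheses (V_gt0 : (0 < V)%N) (leVU : (V <= U)%N) (cUV : coprime U V) (neg_eq : U = V -> neg).

Definition profile (k : nat) : nat := minn (minn k (V * N)) ((U + V) * N - k).

(** A representation is determined by its first entry, and the reflection b -> N - b turns both
    signs into the same count. *)
Lemma nrep_all_filter k : nrep_all U V N neg k =
  (\sum_(0 <= a < N.+1) [&& U * a <= k, k <= U * a + V * N & V %| k - U * a])%N.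
Proof.
rewrite /nrep_all big_mkord.
pose P (a : 'I_N.+1) := [&& U * a <= k, k <= U * a + V * N & V %| k - U * a]%N.
transitivity #|[set a | P a]%SET|; last first.
  by rewrite -sum1_card big_mkcond; apply: eq_bigr => a _; rewrite inE /P.
rewrite -(card_in_imset (f := fun e : 'I_N.+1 * 'I_N.+1 => e.1)); last first.
  move=> [a b] [a' b']; rewrite !inE /= => /eqP h /eqP h' aa; subst a'.
  by congr pair; apply: (fval_injr V_gt0 leVU neg_eq (a := a)); rewrite h h'.
apply: eq_card => a; rewrite inE; apply/imsetP/and3P.
  case=> -[a' b] /=; rewrite inE /= /fval => /eqP <- ->; have := ltn_ord b => bN.
  split; [exact: leq_addr| |by rewrite addKn dvdn_mulr].
  rewrite leq_add2l leq_mul2l; case: neg; lia.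
case=> h1 h2 /dvdnP[b bE].
have bN : (b <= N)%N by rewrite -(leq_pmul2l V_gt0); lia.
pose b' := if neg then (N - b)%N else b.
have b'N : (b' < N.+1)%N by rewrite /b'; case: neg; lia.
exists (a, Ordinal b'N) => //; rewrite inE /fval /= /b'; apply/eqP.
by case: neg; rewrite ?subKn//; lia.
Qed.

(** The first entry runs through an interval [[lo, hi)] intersected with one residue class modulo V.
    In units of U V, rounding the class at both ends costs at most 2 and rounding the ends of the
    interval at most 1, which explains the 3. *)
Lemma nrep_all_bounds k : (k <= (U + V) * N)%N ->
  (profile k <= U * V * (nrep_all U V N neg k + 3))%N /\
  (U * V * nrep_all U V N neg k <= profile k + 3 * (U * V))%N.
Proof.
move=> kM; have U_gt0 : (0 < U)%N by apply: leq_trans leVU.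
rewrite nrep_all_filter.
case: (residue_exists k V_gt0 U_gt0 cUV) => a0 a0V a0P.
set lo := ((k - V * N + U.-1) %/ U)%N.
set hi := (minn N (k %/ U)).+1.
have loP a : (k <= U * a + V * N)%N = (lo <= a)%N.
  rewrite -[RHS]ltnS /lo ltn_divLR// mulSn; lia.
have hiP a : (a <= N)%N -> (U * a <= k)%N = (a < hi)%N.
  by move=> aN; rewrite /hi ltnS leq_min aN leq_divRL// mulnC.
have lohi : (lo <= hi)%N.
  rewrite -ltnS /lo ltn_divLR// /hi.
  have := ltn_ceil k U_gt0; rewrite !mulSn => h.
  by move: kM; rewrite mulnDl; case: (leqP N (k %/ U)) => _ kM; lia.
have hiN : (hi <= N.+1)%N by rewrite /hi ltnS geq_minl.
have -> : (\sum_(0 <= a < N.+1) [&& U * a <= k, k <= U * a + V * N & V %| k - U * a] =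
    \sum_(lo <= a < hi) (a %% V == a0))%N.
  rewrite (big_cat_nat (n := lo))//=; last exact: leq_trans lohi hiN.
  rewrite big_nat big1 => [|a /= alo]; last first.
    by rewrite loP (leqNgt lo) alo andbF.
  rewrite add0n (big_cat_nat (n := hi))//= [X in (_ + X)%N]big_nat.
  rewrite [X in (_ + X)%N]big1 ?addn0 => [|a /andP[ahi aN]]; last first.
    by rewrite hiP// ltnNge ahi.
  rewrite big_nat [RHS]big_nat; apply: eq_bigr => a /andP[loa ahi].
  have Uak : (U * a <= k)%N by rewrite hiP// -ltnS (leq_trans ahi).
  rewrite loP loa Uak /= -eqn_mod_dvd// eq_sym.
  by congr nat_of_bool; apply/eqP/eqP => /a0P.
have hi1 : (U * hi <= minn (U * N) k + U)%N.
  rewrite /hi mulnS addnC leq_add2r leq_min leq_mul2l geq_minl orbT /=.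
  by rewrite (leq_trans _ (leq_trunc_div k U))// mulnC leq_mul2r geq_minr orbT.
have hi2 : (minn (U * N) k <= U * hi)%N.
  rewrite /hi mulnS; have := ltn_ceil k U_gt0; rewrite mulSn.
  by case: (leqP N (k %/ U)) => _ h'; rewrite geq_min; apply/orP; [left; rewrite leq_addl|right; rewrite [(U * _)%N]mulnC ltnW].
have lo1 : (U * lo <= k - V * N + U.-1)%N by rewrite mulnC leq_trunc_div.
have lo2 : (k - V * N <= U * lo)%N.
  by have := ltn_ceil (k - V * N + U.-1) U_gt0; rewrite -/lo mulSn; clearbody lo; clear -U_gt0; lia.
have := count_residue hi a0V; have := count_residue lo a0V.
rewrite [X in _ -> X = _ -> _](big_cat_nat (n := lo))//= => -> h.
set c := (\sum_(_ <= _ < _) _)%N in h *.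
have [b1 b2] := residue_bound a0 lo V_gt0; have [b3 b4] := residue_bound a0 hi V_gt0.
rewrite -h in b3 b4; rewrite mulnDr in b3 b4.
set d := (lo %/ V + (a0 < lo %% V))%N in b1 b2 b3 b4; clearbody d lo hi.
have c1 : (V * c + lo <= hi + 2 * V)%N by clear -b1 b2 b3 b4; lia.
have c2 : (hi <= V * c + lo + 2 * V)%N by clear -b1 b2 b3 b4; lia.
have k1 : (U * V * c + U * lo <= U * hi + 2 * (U * V))%N.
  by have := leq_mul (leqnn U) c1; rewrite !mulnDr mulnA mulnCA; clear; lia.
have k2 : (U * hi <= U * V * c + U * lo + 2 * (U * V))%N.
  by have := leq_mul (leqnn U) c2; rewrite !mulnDr mulnA mulnCA; clear; lia.
have UV : (U <= U * V)%N by rewrite leq_pmulr.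
have VU : (V * N <= U * N)%N by rewrite leq_mul2r leVU orbT.
rewrite /profile mulnDr [(U * V * 3)%N]mulnC.
rewrite mulnDl in kM *; move: k1 k2 hi1 hi2 lo1 lo2 UV VU kM.
set uv := (U * V)%N; set uc := (uv * c)%N; set uh := (U * hi)%N; set ul := (U * lo)%N.
set un := (U * N)%N; set vn := (V * N)%N.
clearbody uv uc uh ul un vn; clear -U_gt0 => *; split; lia.
Qed.

End Counting.

(** The trapezoid has two mirror-image slopes of V N points and a plateau of (U - V) N + 1 points,
    both of its corners included. *)
Lemma sum_profile (R : realType) (U V N : nat) (F : nat -> R) : (V <= U)%N ->
  \sum_(k < ((U + V) * N).+1) F (profile U V N k) =
    2 * \sum_(0 <= k < V * N) F k + ((U - V) * N).+1%:R * F (V * N)%N.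
Proof.
move=> VU; rewrite -(big_mkord xpredT (fun k => F (profile U V N k))).
have VNUN : (V * N <= U * N)%N by rewrite leq_mul2r VU orbT.
rewrite /profile mulnDl mulnBl.
set a := (U * N)%N in VNUN *; set b := (V * N)%N in VNUN *.
have le1 : (b <= a.+1)%N by rewrite (leq_trans VNUN).
have le2 : (a.+1 <= (a + b).+1)%N by rewrite ltnS leq_addr.
rewrite (@big_cat_nat _ _ _ b)//=; last exact: leq_trans le2.
rewrite (@big_cat_nat _ _ _ a.+1 b)//=.
clearbody a b; clear VU.
have -> : \sum_(0 <= k < b) F (minn (minn k b) (a + b - k)) = \sum_(0 <= k < b) F k.
  rewrite big_nat [RHS]big_nat; apply: eq_bigr => k /= kb; congr F; lia.
have -> : \sum_(b <= k < a.+1) F (minn (minn k b) (a + b - k)) = (a - b).+1%:R * F b.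
  rewrite big_nat (eq_bigr (fun=> F b)) => [|k /= kb]; last by congr F; lia.
  by rewrite -big_nat sumr_const_nat subSn// mulr_natl.
have -> : \sum_(a.+1 <= k < (a + b).+1) F (minn (minn k b) (a + b - k)) =
    \sum_(0 <= k < b) F k.
  rewrite -{1}[a.+1]add0n big_addn subSS addKn [LHS]big_nat_rev [RHS]big_nat [LHS]big_nat.
  by apply: eq_bigr => k /= kb; congr F; lia.
ring.
Qed.

Lemma card_form_image (N : nat) (u v : int) (A : {set 'I_N.+1}) :
  binary_linear_form (u, v) ->
  #|` form_image (u, v) A| = image_size `|u|%N `|v|%N (v < 0) A.
Proof.
case=> /= u0 v0 vu _.
set U := `|u|%N; set V := `|v|%N; set neg := (v < 0).
pose c : int := if neg then (V * N)%:Z else 0.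
have fE (a b : 'I_N.+1) : u * (a : nat)%:Z + v * (b : nat)%:Z = (fval U V neg a b)%:Z - c.
  have uE : u = U%:Z by rewrite /U gez0_abs// (le_trans _ vu).
  have vE : v = if neg then - V%:Z else V%:Z.
    by rewrite /V /neg; case: ltrP => h; [rewrite ltz0_abs// opprK|rewrite gez0_abs].
  have bN := ltn_ord b; rewrite {1}uE {1}vE /fval /c {c}; clearbody U V neg; clear u0 v0 vu.
  case: neg {vE}; rewrite ?mulnBr PoszD ?subr0 ?PoszM//.
  by rewrite -subzn ?leq_mul2l -1?ltnS ?bN ?orbT// !PoszM; ring.
pose g (k : 'I_((U + V) * N).+1) : int := (k : nat)%:Z - c.
have -> : form_image (u, v) A = [fset g k | k in [set k : 'I_((U + V) * N).+1 | covered U V neg A k]%SET]%fset.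
  apply/fsetP => z; apply/imfset2P/imfsetP => /=.
    case=> a aA [b bA ->]; exists (Ordinal (fval_le U V neg a b)).
      by rewrite inE; apply/coveredP; exists a, b.
    by rewrite /g /= fE.
  case=> k; rewrite inE => /coveredP[a [b [aA bA h]]] ->.
  by exists a => //; exists b => //; rewrite /g fE h.
rewrite card_imfset//=; last first.
  by move=> k k' /addIr[h]; exact: val_inj.
by rewrite -cardE.
Qed.

(** * Auxiliary functions *)

Section Calculus.
Context {R : realType}.
Implicit Types (f df : R -> R) (a b c x y : R).

Lemma is_derive_linexp a b c x :
  is_derive x 1 (fun x => (a + b * x) * expR (c * x))
    ((b + c * (a + b * x)) * expR (c * x)).
Proof.
have d1 (k : R) : is_derive x 1 (fun x => k * x : R) k.
  have := @is_deriveZ _ _ _ id k x 1 1 (is_derive_id _ _).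
  by rewrite /GRing.scale /= mulr1.
have d2 : is_derive x 1 (fun x => a + b * x) b.
  by have := is_deriveD (is_derive_cst a x 1) (d1 b); rewrite add0r.
have d3 : is_derive x 1 (fun x => expR (c * x)) (c * expR (c * x)).
  by rewrite mulrC; exact: (@is_derive1_comp _ expR (fun x => c * x) x _ _ (is_derive_expR _) (d1 c)).
have h : is_derive x 1 (fun x => (a + b * x) * expR (c * x)) _ := is_deriveM d2 d3.
apply: is_derive_eq h _; rewrite /GRing.scale /=; ring.
Qed.

Lemma mvt f df a b : (forall x, is_derive x 1 f (df x)) -> a < b ->
  exists2 c, a < c < b & f b - f a = df c * (b - a).
Proof.
move=> fd ab.
have cf : {within `[a, b], continuous f} by apply: derivable_within_continuous.
have [c cab ->] := MVT ab (fun x _ => fd x) cf.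
by exists c => //; move: cab; rewrite in_itv.
Qed.

Lemma is_derive_continuous f df x : (forall x, is_derive x 1 f (df x)) ->
  {for x, continuous f}.
Proof. by move=> fd; apply/differentiable_continuous/derivable1_diffP; exact: ex_derive. Qed.

(** The remainder of [expR (- x)] after its linear part; [theta_int] is the antiderivative that
    vanishes at 0. *)
Definition theta x : R := x - 1 + expR (- x).
Definition theta_int x : R := x ^+ 2 / 2 - x + 1 - expR (- x).

Lemma theta_sub x y : 0 <= y <= x -> 0 <= theta x - theta y <= x * (x - y).
Proof.
case/andP=> y0 yx.
have e1 := expR_ge1Dx (x - y); have e2 := expR_ge1Dx (y - x).
have e3 := expR_ge1Dx (- x).
have k1 : expR (- y) = expR (- x) * expR (x - y) by rewrite -expRD; congr expR; ring.
have k2 : expR (- x) = expR (- y) * expR (y - x) by rewrite -expRD; congr expR; ring.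
have g0 := expR_gt0 (- x); have g1 := expR_gt0 (- y).
have l1 : expR (- y) <= 1 by rewrite expR_le1; lra.
rewrite /theta; apply/andP; split.
  by rewrite k2; nra.
rewrite k1; nra.
Qed.

Lemma theta_le x y : 0 <= y <= x -> theta y <= theta x.
Proof. by move=> /theta_sub; lra. Qed.

Lemma theta0 : theta 0 = 0.
Proof. by rewrite /theta oppr0 expR0; lra. Qed.

Lemma theta_ge0 x : 0 <= x -> 0 <= theta x.
Proof. by move=> x0; rewrite -theta0; apply: theta_le; rewrite lexx. Qed.

Lemma theta_le_sqr x : 0 <= x -> theta x <= x ^+ 2.
Proof.
move=> x0; have := @theta_sub x 0; rewrite lexx theta0 !subr0 -expr2 => /(_ x0).
by case/andP.
Qed.

Lemma is_derive_theta_int x : is_derive x 1 theta_int (theta x).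
Proof.
have d1 : is_derive x 1 (fun x : R => x ^+ 2 / 2) x.
  have := @is_deriveM _ _ id (fun x => x / 2) x 1 1 2^-1 (is_derive_id _ _).
  move=> h.
  have h2 : is_derive x 1 (fun x : R => x / 2) 2^-1.
    have := is_derive_linexp 0 2^-1 0 x; rewrite !mul0r !addr0 expR0 mulr1.
    by under eq_fun => z do rewrite add0r mul0r expR0 mulr1 mulrC.
  have := h h2; rewrite /GRing.scale /= mulr1 => h3.
  have e : (fun x : R => x ^+ 2 / 2) = (fun x => x * (x / 2)).
    by apply/funext => z; rewrite expr2 mulrA.
  by rewrite e; apply: is_derive_eq h3 _; lra.
have d2 := is_derive_linexp (-1) 0 (-1) x.
have d3 := is_derive_linexp 1 (-1) 0 x.
have e : theta_int = (fun x => x ^+ 2 / 2 + (((1 + -1 * x) * expR (0 * x)) + (-1 + 0 * x) * expR (-1 * x))).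
  by apply/funext => z; rewrite /theta_int !mul0r expR0 !mulN1r; lra.
rewrite e; apply: is_derive_eq (is_deriveD d1 (is_deriveD d3 d2)) _.
by rewrite /theta !mul0r expR0 !mulN1r; lra.
Qed.

Lemma theta_int_sub x y : 0 <= y <= x ->
  (x - y) * theta y <= theta_int x - theta_int y <= (x - y) * theta x.
Proof.
case/andP=> y0; rewrite le_eqVlt => /predU1P[->|yx]; first by rewrite !subrr !mul0r lexx.
have [c /andP[yc cx] ->] := mvt is_derive_theta_int yx.
have h1 : theta y <= theta c by apply: theta_le; lra.
have h2 : theta c <= theta x by apply: theta_le; lra.
by rewrite [theta c * _]mulrC !ler_pM2l ?subr_gt0// h1.
Qed.

Lemma theta_int0 : theta_int 0 = 0.
Proof. by rewrite /theta_int oppr0 expR0; lra. Qed.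

(** A left Riemann sum of an increasing function that vanishes at 0 falls short of the integral by
    at most its last value. *)
Lemma sum_theta (h : R) (K : nat) : 0 < h ->
  theta_int (h * K%:R) / h - theta (h * K%:R) <= \sum_(0 <= k < K) theta (h * k%:R)
    <= theta_int (h * K%:R) / h.
Proof.
move=> h0; elim: K => [|K ih].
  by rewrite big_nil mulr0 theta_int0 theta0 mul0r subrr lexx.
rewrite big_nat_recr//=.
set s := \sum_(_ <= _ < _) _ in ih *.
have st : h * K.+1%:R - h * K%:R = h by rewrite -mulrBr -natrB// subSnn mulr1.
have K0 : 0 <= h * K%:R by rewrite mulr_ge0// ltW.
have := @theta_int_sub (h * K.+1%:R) (h * K%:R); rewrite K0 st.
rewrite (_ : (h * K%:R <= h * K.+1%:R) = true); last by apply/idP; lra.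
move=> /(_ isT) /andP[h1 h2].
have h3 : theta (h * K%:R) <= (theta_int (h * K.+1%:R) - theta_int (h * K%:R)) / h.
  by rewrite ler_pdivlMr//; lra.
have h4 : (theta_int (h * K.+1%:R) - theta_int (h * K%:R)) / h <= theta (h * K.+1%:R).
  by rewrite ler_pdivrMr//; lra.
rewrite mulrBl in h3 h4.
by case/andP: ih => i1 i2; apply/andP; split; lra.
Qed.

Lemma expR_le_inv x : 0 <= x -> expR (- x) <= (1 + x)^-1.
Proof.
move=> x0; rewrite expRN lef_pV2 ?posrE ?expR_gt0//; last by lra.
exact: expR_ge1Dx.
Qed.

Lemma expR_le_invsqr x : 0 < x -> expR (- x) <= 4 / x ^+ 2.
Proof.
move=> x0.
have -> : expR (- x) = expR (- (x / 2)) ^+ 2 by rewrite -expRM_natl; congr expR; lra.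
have -> : 4 / x ^+ 2 = ((x / 2)^-1) ^+ 2 by field; lra.
rewrite ler_pXn2r// ?nnegrE ?expR_ge0// ?invr_ge0; try lra.
have x2 : 0 <= x / 2 by lra.
apply: le_trans (expR_le_inv x2) _.
by rewrite lef_pV2 ?posrE; lra.
Qed.

Lemma subX_le (m : nat) a b : 0 <= a <= 1 -> 0 <= b <= 1 ->
  `|a ^+ m - b ^+ m| <= m%:R * `|a - b|.
Proof.
move=> a01 b01; elim: m => [|m ih]; first by rewrite !expr0 subrr normr0 mul0r.
have -> : a ^+ m.+1 - b ^+ m.+1 = a ^+ m * (a - b) + (a ^+ m - b ^+ m) * b.
  by rewrite !exprS; ring.
apply: le_trans (ler_normD _ _) _; rewrite -[in leRHS]natr1 [leRHS]mulrDl mul1r [leRHS]addrC.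
rewrite !normrM lerD//.
  rewrite ler_piMl// ger0_norm ?exprn_ge0 ?exprn_ile1//; lra.
apply: le_trans ih; rewrite ler_piMr// ger0_norm; lra.
Qed.

End Calculus.

(** * Expected number of missed values *)

Section Estimates.
Context {R : realType}.
Variables (U V N : nat) (neg : bool).
Hypotheses (V_gt0 : (0 < V)%N) (leVU : (V <= U)%N) (cUV : coprime U V)
  (neg_eq : U = V -> neg) (N_gt0 : (0 < N)%N).
Variable p : R.
Hypothesis p01 : 0 < p < 1.

Local Notation K := ((U + V) * N).+1.
Local Notation S := (gen_missing U V N neg).
Local Notation q := (hit_prob p).
Local Notation lam := (N%:R * p ^+ 2).
Local Notation u := (U%:R : R).
Local Notation v := (V%:R : R).
Local Notation n := (N%:R : R).

Let u1 : 1 <= u. Proof. by rewrite ler1n (leq_trans V_gt0). Qed.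
Let v1 : 1 <= v. Proof. by rewrite ler1n. Qed.
Let vu : v <= u. Proof. by rewrite ler_nat. Qed.
Let n1 : 1 <= n. Proof. by rewrite ler1n. Qed.

Definition width (k : nat) : R := (profile U V N k)%:R / (u * v).

Lemma width_ge0 k : 0 <= width k.
Proof. by rewrite divr_ge0// mulr_ge0. Qed.

Lemma width_le k : width k <= n.
Proof.
have := u1; have := v1; have := n1 => a b c; rewrite /width ler_pdivrMr; last nra.
have : (profile U V N k <= V * N)%N by rewrite /profile -minnA minnCA geq_minl.
rewrite -(ler_nat R) natrM => h; apply: le_trans h _.
have : 0 <= v * n by nra.
nra.
Qed.

(** For x - y all N + 1 diagonal pairs represent one value, so [ndiag] has no uniform bound; it is
    kept in the error, and only its sum N + 1 is used. *)
Lemma nreps_width (k : nat) : (k < K)%N ->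
  `|(nreps U V N neg k)%:R - width k| <= 3 + (ndiag U V N neg k)%:R.
Proof.
rewrite ltnS => kK; have [h1 h2] := nrep_all_bounds V_gt0 leVU cUV neg_eq kK.
move: h1 h2; rewrite nrep_allE -!(ler_nat R) !natrM natrD !natrD natrM /width.
set m := (nreps _ _ _ _ k)%:R; set d := (ndiag _ _ _ _ k)%:R; set w := (profile _ _ _ k)%:R.
have uv0 : 0 < u * v by have := u1; have := v1; nra.
have d0 : 0 <= d by rewrite /d.
move=> h1 h2.
have e1 : w / (u * v) <= m + d + 3 by rewrite ler_pdivrMr//; lra.
have e2 : m + d - 3 <= w / (u * v) by rewrite ler_pdivlMr//; lra.
by rewrite ler_norml; apply/andP; split; lra.
Qed.

Lemma nreps_le (k : nat) : (k < K)%N -> (nreps U V N neg k)%:R <= n + 3.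
Proof.
rewrite ltnS => kK; have [_] := nrep_all_bounds V_gt0 leVU cUV neg_eq kK.
have := width_le k.
rewrite nrep_allE -(ler_nat R) !natrM natrD !natrD !natrM /width.
set m := (nreps _ _ _ _ k)%:R; set d := (ndiag _ _ _ _ k)%:R; set w := (profile _ _ _ k)%:R.
have uv0 : 0 < u * v by have := u1; have := v1; nra.
have d0 : 0 <= d by rewrite /d.
rewrite ler_pdivrMr// => h1 h2.
rewrite -(ler_pM2l uv0); nra.
Qed.

Lemma sum_ndiagR : \sum_(k < K) (ndiag U V N neg k)%:R = n + 1 :> R.
Proof. by rewrite -natr_sum sum_ndiag natr1. Qed.

Lemma sum_nrepsR : \sum_(k < K) (nreps U V N neg k)%:R = n * (n + 1) :> R.
Proof. by rewrite -natr_sum (sum_nreps N V_gt0 leVU neg_eq) natrM natr1. Qed.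

Let p0 : 0 < p. Proof. by case/andP: p01. Qed.
Let p1 : p < 1. Proof. by case/andP: p01. Qed.

Lemma valueE : K%:R = (u + v) * n + 1 :> R.
Proof. by rewrite -natr1 natrM natrD. Qed.

Lemma lam_gt0 : 0 < lam.
Proof. by rewrite mulr_gt0 ?exprn_gt0//; have := n1; lra. Qed.

Lemma hit_prob_ge : p ^+ 2 - 8 * p ^+ 3 <= q.
Proof.
have h (j : nat) : 1 - j%:R * p <= (1 - p) ^+ j.
  elim: j => [|j ih]; first by rewrite expr0 mul0r subr0.
  have j0 : 0 <= j%:R :> R by [].
  have jp : 0 <= j%:R * p by rewrite mulr_ge0// ltW.
  rewrite exprS -natr1; have := p0; have := p1; nra.
have := h 8%N; rewrite /hit_prob => h8; have p2 : 0 < p ^+ 2 by rewrite exprn_gt0.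
rewrite (exprS p 2); nra.
Qed.

Lemma hit_prob_le : q <= p ^+ 2.
Proof.
rewrite /hit_prob ler_piMr ?sqr_ge0//.
by rewrite exprn_ile1//; have := p0; have := p1; lra.
Qed.

(** The two bases differ by at most 9 p^3: the exponent 8 of [hit_prob] accounts for 8 p^3, the
    exponential for at most p^4. The power y^r is r-Lipschitz on [0, 1], and the r(k) add up to N (N
    + 1) <= 2 N^2. *)
Lemma gen_missing_sub (y : R) : 1 - p ^+ 2 <= y <= 1 - q ->
  `|S y - S (expR (- p ^+ 2))| <= 18 * n ^+ 2 * p ^+ 3.
Proof.
move=> /andP[y1 y2].
have p20 : 0 < p ^+ 2 by rewrite exprn_gt0.
have p30 : 0 < p ^+ 3 by rewrite exprn_gt0.
have p21 : p ^+ 2 <= 1 by rewrite exprn_ile1// ltW.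
have q0 := hit_prob_gt0 p01; have qge := hit_prob_ge.
have e0 := expR_gt0 (- p ^+ 2).
have e1 : expR (- p ^+ 2) <= 1 by rewrite expR_le1; lra.
have t0 := theta_ge0 (ltW p20); have t1 := theta_le_sqr (ltW p20).
have t2 : (p ^+ 2) ^+ 2 <= p ^+ 3.
  by rewrite -exprM ler_wiXn2l// ltW.
rewrite /theta in t0 t1.
have d : `|y - expR (- p ^+ 2)| <= 9 * p ^+ 3.
  rewrite ler_norml; apply/andP; split; lra.
rewrite /gen_missing -sumrB; apply: le_trans (ler_norm_sum _ _ _) _.
apply: (@le_trans _ _ (\sum_(k < K) (nreps U V N neg k)%:R * (9 * p ^+ 3))).
  apply: ler_sum => k _; apply: le_trans (subX_le _ _ _) _.
  - by apply/andP; split; lra.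
  - by apply/andP; split; lra.
  - by rewrite ler_wpM2l.
rewrite -mulr_suml sum_nrepsR.
have h : n * (n + 1) <= 2 * n ^+ 2 by have := n1 => a; nra.
have p90 : 0 <= 9 * p ^+ 3 by lra.
by apply: le_trans (ler_wpM2r p90 h) _; rewrite le_eqVlt; apply/orP; left; apply/eqP; ring.
Qed.

(** The linear parts of the exponentials add up to the same number for all forms; what distinguishes
    the forms is collected in the [theta] terms. *)
Lemma gen_missing_exp : S (expR (- p ^+ 2)) =
  K%:R - p ^+ 2 * (n * (n + 1)) + \sum_(k < K) theta (p ^+ 2 * (nreps U V N neg k)%:R).
Proof.
rewrite -sum_nrepsR mulr_sumr -[X in X%:R](card_ord K) -sum1_card natr_sum -sumrB -big_split /=.
apply: eq_bigr => k _; rewrite /theta -expRM_natr mulNr; lra.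
Qed.

Lemma theta_lip (M x y : R) : 0 <= x <= M -> 0 <= y <= M ->
  `|theta x - theta y| <= M * `|x - y|.
Proof.
wlog yx : x y / y <= x.
  move=> h; case: (leP y x) => [|/ltW] xy hx hy; first exact: h.
  by rewrite distrC [X in _ * X]distrC; apply: h.
move=> /andP[x0 xM] /andP[y0 yM].
have := @theta_sub _ x y; rewrite y0 yx => /(_ isT) /andP[h1 h2].
rewrite !ger0_norm ?subr_ge0//; last by lra.
by apply: le_trans h2 _; rewrite ler_wpM2r// subr_ge0.
Qed.

(** All arguments are at most 4 lambda, where [theta] is 4 lambda-Lipschitz, and the discrepancies
    of [nreps_width] add up to at most 8 (u + v) N. *)
Lemma sum_theta_nreps :
  `|\sum_(k < K) theta (p ^+ 2 * (nreps U V N neg k)%:R) -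
    \sum_(k < K) theta (p ^+ 2 * width k)| <= 32 * (u + v) * lam ^+ 2.
Proof.
have p20 : 0 < p ^+ 2 by rewrite exprn_gt0.
rewrite -sumrB; apply: le_trans (ler_norm_sum _ _ _) _.
apply: (@le_trans _ _ (\sum_(k < K) (4 * lam * p ^+ 2) * (3 + (ndiag U V N neg k)%:R))).
  apply: ler_sum => k _.
  apply: le_trans (@theta_lip (4 * lam) _ _ _ _) _.
  - rewrite mulr_ge0 ?(ltW p20)//=; have := nreps_le (ltn_ord k); have := n1.
    move=> a b; apply: (@le_trans _ _ (p ^+ 2 * (4 * n))); last by lra.
    by rewrite ler_wpM2l ?(ltW p20)//; lra.
  - rewrite mulr_ge0 ?width_ge0 ?(ltW p20)//=; have := width_le k; have := n1 => a b.
    apply: (@le_trans _ _ (p ^+ 2 * (4 * n))); last by lra.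
    by rewrite ler_wpM2l ?(ltW p20)//; lra.
  rewrite -mulrBr normrM (ger0_norm (ltW p20)) [leLHS]mulrA ler_wpM2l//.
    by have l0 := lam_gt0; apply: mulr_ge0; lra.
  exact: nreps_width.
have s3 : \sum_(k < K) 3 = 3 * ((u + v) * n + 1).
  by rewrite sumr_const card_ord -[LHS]mulr_natr valueE.
rewrite -mulr_sumr big_split /= sum_ndiagR s3.
have := u1; have := v1; have := n1 => a b c.
have h : 3 * ((u + v) * n + 1) + (n + 1) <= 8 * (u + v) * n by nra.
have l0 : 0 <= 4 * lam * p ^+ 2 by have l0 := lam_gt0; apply: mulr_ge0; lra.
apply: le_trans (ler_wpM2l l0 h) _.
by rewrite le_eqVlt; apply/orP; left; apply/eqP; ring.
Qed.

(* [Gamma_h] of the header. *)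
Definition collision_rate (U V : nat) (l : R) : R :=
  let x := l / U%:R in
  2 * V%:R * theta_int x / x + (U%:R - V%:R) * theta x.

(** Each slope is a Riemann sum with step p^2 / (u v), whose upper end is the plateau value lambda /
    u. *)
Lemma sum_theta_width :
  `|\sum_(k < K) theta (p ^+ 2 * width k) - n * collision_rate U V lam| <= 3 * lam ^+ 2.
Proof.
have p20 : 0 < p ^+ 2 by rewrite exprn_gt0.
have := u1; have := v1; have := n1 => a b c.
set h := p ^+ 2 / (u * v).
have h0 : 0 < h by rewrite divr_gt0//; nra.
rewrite (sum_profile N (fun k => theta (p ^+ 2 * (k%:R / (u * v)))) leVU).
have -> : \sum_(0 <= k < V * N) theta (p ^+ 2 * (k%:R / (u * v))) =
    \sum_(0 <= k < V * N) theta (h * k%:R).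
  by apply: eq_bigr => k _; rewrite mulrCA mulrC.
have /andP[] := sum_theta (V * N) h0.
have hx : h * (V * N)%:R = lam / u by rewrite natrM /h; field; lra.
have -> : p ^+ 2 * ((V * N)%:R / (u * v)) = lam / u by rewrite -hx mulrCA mulrC.
rewrite hx /collision_rate; set x := lam / u; set s := \sum_(_ <= _ < _) _.
have x0 : 0 < x by rewrite !divr_gt0 ?mulr_gt0//; lra.
have t0 := theta_ge0 (ltW x0); have t1 := theta_le_sqr (ltW x0).
have t2 : x ^+ 2 <= lam ^+ 2.
  have l0 := lam_gt0.
  rewrite ler_pXn2r ?nnegrE ?(ltW x0) ?(ltW l0)// /x ler_pdivrMr; last lra.
  by rewrite ler_peMr// ltW.
have -> : n * (2 * v * theta_int x / x + (u - v) * theta x) =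
    2 * (theta_int x / h) + (u - v) * n * theta x.
  rewrite /x -hx natrM; clearbody h.
  field; apply/andP; split; lra.
have -> : ((U - V) * N).+1%:R = (u - v) * n + 1 by rewrite -natr1 natrM natrB.
by move=> g1 g2; rewrite ler_norml; apply/andP; split; lra.
Qed.

Lemma gen_missing_estimate (y : R) : 1 - p ^+ 2 <= y <= 1 - q ->
  `|S y - (K%:R - p ^+ 2 * (n * (n + 1)) + n * collision_rate U V lam)| <=
    18 * n ^+ 2 * p ^+ 3 + 36 * (u + v) * lam ^+ 2.
Proof.
move=> hy; have := gen_missing_sub hy; rewrite gen_missing_exp.
have := sum_theta_nreps; have := sum_theta_width.
set s1 := \sum_(k < K) theta (p ^+ 2 * width k); set s2 := \sum_(k < K) _.
have l0 : 0 <= lam ^+ 2 by rewrite sqr_ge0.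
have : 3 * lam ^+ 2 <= 4 * (u + v) * lam ^+ 2 by have := u1; have := v1; nra.
rewrite !ler_norml => e /andP[a1 a2] /andP[b1 b2] /andP[c1 c2].
by apply/andP; split; lra.
Qed.

End Estimates.

(** * Expected number of missed values for large [lambda] *)

Section Supercritical.
Context {R : realType}.
Variables (U V N : nat) (neg : bool).
Hypotheses (V_gt0 : (0 < V)%N) (ltVU : (V < U)%N) (cUV : coprime U V)
  (N_gt0 : (0 < N)%N).
Variable p : R.
Hypotheses (p_gt0 : 0 < p) (p_small : p <= 1 / 32).

Local Notation K := ((U + V) * N).+1.
Local Notation S := (gen_missing U V N neg).
Local Notation q := (hit_prob p).
Local Notation lam := (N%:R * p ^+ 2).
Local Notation u := (U%:R : R).
Local Notation v := (V%:R : R).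
Local Notation n := (N%:R : R).
Local Notation w := (@width R U V N).

Lemma sum_expR (a : R) (k : nat) :
  (\sum_(0 <= i < k) expR (- (a * i%:R))) * (1 - expR (- a)) = 1 - expR (- (a * k%:R)).
Proof.
elim: k => [|k ih]; first by rewrite big_nil mulr0 oppr0 expR0 subrr mul0r.
rewrite big_nat_recr//= mulrDl ih.
have -> : expR (- (a * k.+1%:R)) = expR (- (a * k%:R)) * expR (- a).
  by rewrite -expRD -natr1; congr expR; ring.
ring.
Qed.

Lemma sum_expR_le (a : R) (k : nat) : 0 < a ->
  \sum_(0 <= i < k) expR (- (a * i%:R)) <= a^-1 + 1.
Proof.
move=> a0; have := sum_expR a k; set s := \sum_(_ <= _ < _) _ => h.
have := expR_gt0 (- (a * k%:R)) => e0.
have := @expR_le_inv _ a (ltW a0) => e1.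
have s0 : 0 <= s by apply: sumr_ge0 => i _; exact: expR_ge0.
have h2 : s * (1 - (1 + a)^-1) <= 1.
  by apply: (@le_trans _ _ (s * (1 - expR (- a)))); [rewrite ler_wpM2l//|]; lra.
have e : 1 - (1 + a)^-1 = (a^-1 + 1)^-1 by field; lra.
have c0 : 0 < a^-1 + 1 by have : 0 < a^-1 by [rewrite invr_gt0]; lra.
by move: h2; rewrite e -/(s / _) ler_pdivrMr// mul1r.
Qed.

Lemma sum_expR_ge (a : R) (k : nat) : 0 < a ->
  (1 - expR (- (a * k%:R))) / a <= \sum_(0 <= i < k) expR (- (a * i%:R)).
Proof.
move=> a0; rewrite -sum_expR ler_pdivrMr//; apply: ler_wpM2l.
  by apply: sumr_ge0 => i _; exact: expR_ge0.
by have := expR_ge1Dx (- a); lra.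
Qed.

Let leVU : (V <= U)%N. Proof. exact: ltnW. Qed.
Let nUV : U <> V. Proof. by move=> h; have := ltVU; rewrite h ltnn. Qed.
Let neg_eq : U = V -> neg. Proof. by move/nUV. Qed.
Let u1 : 1 <= u. Proof. by rewrite ler1n (leq_trans V_gt0). Qed.
Let v1 : 1 <= v. Proof. by rewrite ler1n. Qed.
Let vu : v <= u. Proof. by rewrite ler_nat. Qed.
Let n1 : 1 <= n. Proof. by rewrite ler1n. Qed.
Let p01 : 0 < p < 1. Proof. by rewrite p_gt0; have := p_small; lra. Qed.

(** For V < U a value has at most one diagonal representation, so the error becomes a constant. *)
Let nreps_width4 (k : nat) : (k < K)%N ->
  w k - 4 <= (nreps U V N neg k)%:R <= w k + 4.
Proof.
move=> kK; have := @nreps_width R U V N neg V_gt0 leVU cUV neg_eq k kK.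
have : (ndiag U V N neg k)%:R <= 1 :> R by rewrite lern1 (ndiag_le1 N V_gt0 leVU neg_eq).
set m := (nreps _ _ _ _ _)%:R; set d := (ndiag _ _ _ _ _)%:R; set x := w k.
by rewrite ler_norml => h /andP[h1 h2]; apply/andP; split; lra.
Qed.

Let sum_expR_width (t : R) :
  \sum_(k < K) expR (- (t * w k)) =
  2 * \sum_(0 <= k < V * N) expR (- (t / (u * v) * k%:R)) +
  ((u - v) * n + 1) * expR (- (t * n / u)).
Proof.
rewrite (sum_profile N (fun k => expR (- (t * (k%:R / (u * v))))) leVU).
congr (2 * _ + _ * _).
- by apply: eq_bigr => k _; congr (expR (- _)); rewrite mulrCA mulrC.
- by rewrite -natr1 natrM natrB.
- by congr (expR (- _)); rewrite natrM; field; have := u1; have := v1; lra.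
Qed.

(** Missed values concentrate at the two ends of the range, where r(k) grows linearly: each slope is
    a geometric series of sum about u v / q. The plateau is exponentially small in lambda, of which
    only an inverse square is kept. The rounding of r(k) costs a factor expR (4 q) <= 1 + p. *)
Lemma gen_missing_supercritical_le :
  p ^+ 2 * S (1 - q) <= 2 * u * v + 200 * u ^+ 3 * (p + lam^-1).
Proof.
have q0 := hit_prob_gt0 p01; have q1 := hit_prob_lt1 p01.
have qge := hit_prob_ge p01; have qle := hit_prob_le p01.
move: (hit_prob p) q0 q1 qge qle => Q q0 q1 qge qle.
have := u1; have := v1; have := n1; have := vu; have := p_gt0; have := p_small => ps p0 vu' n1' v1' u1'.
have p20 : 0 < p ^+ 2 by rewrite exprn_gt0.
have l0 : 0 < lam by rewrite mulr_gt0//; lra.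
have q34 : p ^+ 2 * (1 - 8 * p) <= Q by move: qge; rewrite (exprS p 2); lra.
set X := 2 * (u * v / Q + 1) + (u * n) * (4 / (Q * n / u) ^+ 2).
have SX : S (1 - Q) <= expR (4 * Q) * X.
  apply: (@le_trans _ _ (expR (4 * Q) * \sum_(k < K) expR (- (Q * w k)))).
    rewrite mulr_sumr; apply: ler_sum => k _; rewrite -expRD.
    apply: (@le_trans _ _ (expR (- Q) ^+ nreps U V N neg k)).
      rewrite lerXn2r ?nnegrE ?expR_ge0//; first lra.
      by have := expR_ge1Dx (- Q); lra.
    rewrite -expRM_natr ler_expR; have /andP[h _] := nreps_width4 (ltn_ord k).
    nra.
  rewrite ler_wpM2l ?expR_ge0// sum_expR_width /X.
  have qn0 : 0 < Q * n / u by rewrite divr_gt0 ?mulr_gt0//; lra.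
  apply: lerD.
    rewrite ler_pM2l//.
    have a0 : 0 < Q / (u * v) by rewrite divr_gt0 ?mulr_gt0//; lra.
    by apply: le_trans (sum_expR_le (V * N) a0) _; rewrite invf_div.
  apply: ler_pM; rewrite ?expR_ge0//; [nra|nra|exact: expR_le_invsqr].
have e4 : expR (4 * Q) <= 1 + p.
  have h := @expR_ge1Dx _ (- (4 * Q)).
  have h2 : expR (4 * Q) * expR (- (4 * Q)) = 1 by rewrite -expRD subrr expR0.
  have e0 := expR_gt0 (4 * Q).
  have p2p : p ^+ 2 <= p / 32 by rewrite expr2; nra.
  nra.
have X1 : p ^+ 2 * (u * v / Q) <= u * v * (1 + 16 * p).
  rewrite mulrA ler_pdivrMr//; apply: (@le_trans _ _ (u * v * (1 + 16 * p) * (p ^+ 2 * (1 - 8 * p)))).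
    have -> : u * v * (1 + 16 * p) * (p ^+ 2 * (1 - 8 * p)) =
      p ^+ 2 * (u * v) * ((1 + 16 * p) * (1 - 8 * p)) by ring.
    by rewrite ler_peMr ?mulr_ge0 ?(ltW p20)//; nra.
  by rewrite ler_wpM2l// mulr_ge0 ?mulr_ge0//; lra.
have X2 : p ^+ 2 * (u * n * (4 / (Q * n / u) ^+ 2)) <= 8 * u ^+ 3 * lam^-1.
  have -> : p ^+ 2 * (u * n * (4 / (Q * n / u) ^+ 2)) = 4 * u ^+ 3 * lam^-1 * (p ^+ 2 / Q) ^+ 2.
    field; do ?[apply/andP; split]; lra.
  have r : p ^+ 2 / Q <= 4 / 3.
    by rewrite ler_pdivrMr//; nra.
  have r0 : 0 <= p ^+ 2 / Q by rewrite divr_ge0 ?ltW.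
  have r2 : (p ^+ 2 / Q) ^+ 2 <= 2.
    by move: r r0; set x := p ^+ 2 / Q => r r0; rewrite expr2; nra.
  have c0 : 0 <= 4 * u ^+ 3 * lam^-1.
    by rewrite !mulr_ge0 ?exprn_ge0 ?invr_ge0 ?(ltW l0)//; lra.
  by apply: le_trans (ler_wpM2l c0 r2) _; lra.
have u3 : u * v <= u ^+ 3 by rewrite !exprS expr0; nra.
have u31 : 1 <= u ^+ 3 by rewrite exprn_ege1.
have i0 : 0 < lam^-1 by rewrite invr_gt0.
set i := lam^-1 in X2 i0 *; set z3 := u ^+ 3 in X2 u3 u31 *; set z := u * v in X1 u3 *.
have pX : p ^+ 2 * X <= 2 * z + 32 * z * p + 2 * p + 8 * z3 * i.
  rewrite /X mulrDr mulrDr mulrDr -/z; nra.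
have X0 : 0 <= X.
  rewrite /X; apply: addr_ge0; apply: mulr_ge0 => //.
  - by rewrite addr_ge0// divr_ge0// ?mulr_ge0// ltW.
  - by rewrite divr_ge0// sqr_ge0.
apply: (@le_trans _ _ ((1 + p) * (p ^+ 2 * X))).
  rewrite mulrCA ler_wpM2l ?(ltW p20)//.
  by apply: le_trans SX _; rewrite ler_wpM2r.
have z0 : 1 <= z by rewrite /z; nra.
have wi : 0 < z3 * i by rewrite mulr_gt0//; lra.
apply: (@le_trans _ _ ((1 + p) * (2 * z + 32 * z * p + 2 * p + 8 * z3 * i))).
  by rewrite ler_wpM2l//; lra.
have zp : z * p <= z3 * p by rewrite ler_wpM2r// ltW.
have wp : p <= z3 * p by rewrite ler_peMl// ltW.
have -> : 2 * u * v = 2 * z by rewrite /z mulrA.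
have zpp : z * p * p <= z3 * p by nra.
have pp : p * p <= z3 * p by nra.
have wip : z3 * i * p <= z3 * i by rewrite ler_piMr ?(ltW wi)//; lra.
have wp0 : 0 <= z3 * p by lra.
lra.
Qed.

Lemma gen_missing_supercritical_ge :
  2 * u * v - 200 * u ^+ 3 * (p + lam^-1) <= p ^+ 2 * S (1 - p ^+ 2).
Proof.
have := u1; have := v1; have := n1; have := vu; have := p_gt0; have := p_small => ps p0 vu' n1' v1' u1'.
have p20 : 0 < p ^+ 2 by rewrite exprn_gt0.
have p2p : p ^+ 2 <= p / 32 by rewrite expr2; nra.
have l0 : 0 < lam by rewrite mulr_gt0//; lra.
(* Chosen so that 1 - p^2 = (1 + t)^-1, which is at least [expR (- t)]. *)
set t := p ^+ 2 / (1 - p ^+ 2).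
have t0 : 0 < t by rewrite divr_gt0//; lra.
have tp : p ^+ 2 <= t by rewrite /t ler_pdivlMr; nra.
have tp2 : t <= p / 16 by rewrite /t ler_pdivrMr; nra.
have e1 : expR (- t) <= 1 - p ^+ 2.
  have -> : 1 - p ^+ 2 = (1 + t)^-1 by rewrite /t; field; lra.
  exact: expR_le_inv (ltW t0).
set s := \sum_(0 <= k < V * N) expR (- (t / (u * v) * k%:R)).
have Ss : (1 - 4 * t) * (2 * s) <= S (1 - p ^+ 2).
  have s0 : 0 <= s by apply: sumr_ge0 => k _; exact: expR_ge0.
  apply: (@le_trans _ _ (expR (- (4 * t)) * (2 * s))).
    by rewrite ler_wpM2r ?mulr_ge0//; have := expR_ge1Dx (- (4 * t)); lra.
  apply: (@le_trans _ _ (expR (- (4 * t)) * \sum_(k < K) expR (- (t * w k)))).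
    rewrite ler_wpM2l ?expR_ge0// sum_expR_width lerDl mulr_ge0 ?expR_ge0//; nra.
  rewrite mulr_sumr; apply: ler_sum => k _; rewrite -expRD.
  apply: (@le_trans _ _ (expR (- t) ^+ nreps U V N neg k)); last first.
    by rewrite lerXn2r ?nnegrE ?expR_ge0//; have := expR_ge0 (- t); lra.
  rewrite -expRM_natr ler_expR; have /andP[_ h] := nreps_width4 (ltn_ord k).
  nra.
have uv0 : 0 < u * v by rewrite mulr_gt0//; lra.
have a0 : 0 < t / (u * v) by exact: divr_gt0.
have := sum_expR_ge (V * N) a0; rewrite -/s.
have -> : t / (u * v) * (V * N)%:R = t * n / u.
  by rewrite natrM; field; lra.
have tn0 : 0 < t * n / u by apply: divr_gt0; [apply: mulr_gt0 => //|]; lra.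
have e2 : expR (- (t * n / u)) <= u * lam^-1.
  apply: le_trans (expR_le_inv (ltW tn0)) _.
  have -> : u * lam^-1 = (lam / u)^-1 by rewrite invf_div.
  rewrite lef_pV2 ?posrE ?divr_gt0//; try lra.
  have : lam / u <= t * n / u by rewrite ler_pM2r ?invr_gt0; [|lra]; rewrite mulrC ler_wpM2r//; lra.
  lra.
rewrite invf_div => hs.
have i0 : 0 < lam^-1 by rewrite invr_gt0.
have u3 : u * v <= u ^+ 3 by rewrite !exprS expr0; nra.
have u33 : u * (u * v) <= u ^+ 3 by rewrite !exprS expr0; nra.
set i := lam^-1 in e2 i0 *; set z3 := u ^+ 3 in u3 u33 *.
have -> : 2 * u * v = 2 * (u * v) by rewrite mulrA.
set z := u * v in hs u3 u33 *.
have z0 : 0 < z by rewrite /z; nra.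
have pt : p ^+ 2 / t = 1 - p ^+ 2 by rewrite /t; field; apply/andP; split; lra.
have hs2 : (1 - u * i) * z * (1 - p ^+ 2) <= p ^+ 2 * s.
  have -> : (1 - u * i) * z * (1 - p ^+ 2) = p ^+ 2 * ((1 - u * i) * (z / t)).
    by rewrite -pt; ring.
  rewrite ler_wpM2l ?(ltW p20)//; apply: le_trans hs.
  rewrite ler_wpM2r ?divr_ge0 ?(ltW z0) ?(ltW t0)//; lra.
apply: (@le_trans _ _ ((1 - 4 * t) * (2 * (p ^+ 2 * s)))); last first.
  have -> : (1 - 4 * t) * (2 * (p ^+ 2 * s)) = p ^+ 2 * ((1 - 4 * t) * (2 * s)) by ring.
  by rewrite ler_wpM2l ?(ltW p20).
apply: (@le_trans _ _ ((1 - 4 * t) * (2 * ((1 - u * i) * z * (1 - p ^+ 2))))); last first.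
  by rewrite ler_wpM2l//; [lra|rewrite ler_pM2l].
have zp : z * p <= z3 * p by rewrite ler_wpM2r// ltW.
have zi : u * z * i <= z3 * i by rewrite ler_wpM2r// ltW.
have ab : 0 <= (1 - 4 * t) * (1 - p ^+ 2) <= 1 by nra.
have ab2 : 1 - p <= (1 - 4 * t) * (1 - p ^+ 2) by nra.
set ab' := (1 - 4 * t) * (1 - p ^+ 2) in ab ab2.
have -> : (1 - 4 * t) * (2 * ((1 - u * i) * z * (1 - p ^+ 2))) = 2 * (ab' * z) - 2 * (ab' * (u * z * i)).
  by rewrite /ab'; ring.
have uzi : 0 <= u * z * i by rewrite !mulr_ge0//; lra.
have h1 : ab' * (u * z * i) <= u * z * i by rewrite ler_piMl//; lra.
have h2 : (1 - p) * z <= ab' * z by rewrite ler_wpM2r//; lra.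
have wp0 : 0 <= z3 * p by rewrite mulr_ge0 ?exprn_ge0// ltW.
have wi0 : 0 <= z3 * i by rewrite mulr_ge0 ?exprn_ge0// ltW.
lra.
Qed.

End Supercritical.

(** * Concentration and domination *)

Section Domination.
Context {R : realType}.

(** The absolute values of the coefficients and the sign of the second one. Coprimality and U = V
    force U = V = 1, so the last clause removes x + y only. *)
Definition admissible (U V : nat) (neg : bool) : Prop :=
  [/\ (0 < V)%N, (V <= U)%N, coprime U V & U = V -> neg].

Section Criterion.
Variables (N : nat) (p : R) (p01 : 0 < p < 1).
Variables (U1 V1 : nat) (neg1 : bool) (U2 V2 : nat) (neg2 : bool).

(** A union bound over three failures: the first form misses many values, the second misses few, or
    the second gains many diagonal values. Diagonal values of the first form can only help. *)
Lemma pr_dominates_ge (a1 a2 c : R) :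
  ((U2 + V2) * N).+1%:R - a2 + c <= ((U1 + V1) * N).+1%:R - a1 ->
  1 - (subset_prob p (fun A : {set 'I_N.+1} => (a1 <= nfree U1 V1 neg1 A)%R)
     + subset_prob p (fun A : {set 'I_N.+1} => (nfree U2 V2 neg2 A <= a2)%R)
     + subset_prob p (fun A : {set 'I_N.+1} => (c <= diag_only U2 V2 neg2 A)%R))
  <= subset_prob p (fun A : {set 'I_N.+1} =>
       (image_size U2 V2 neg2 A < image_size U1 V1 neg1 A)%N).
Proof.
move=> h.
rewrite lerBlDr -lerBlDl -prC.
apply: le_trans (le_trans (pr_or p01 _ _) (lerD (pr_or p01 _ _) (lexx _))).
apply: pr_le => // A; apply: contraR; rewrite !negb_or -!ltNge => /andP[/andP[h1 h2] h3].
rewrite -(ltr_nat R).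
have := @image_size_ge U1 V1 N neg1 R A; have := @image_size_le U2 V2 N neg2 R A.
set i1 := (image_size U1 _ _ _)%:R; set i2 := (image_size _ _ _ _)%:R.
by move=> g1 g2; lra.
Qed.

End Criterion.

Lemma variance_nfree (U V N : nat) (neg : bool) (p : R) : admissible U V neg ->
  0 < p <= 1 / 2 ->
  mean p (fun A : {set 'I_N.+1} => nfree U V neg A ^+ 2) - mean p (nfree U V (N := N) neg) ^+ 2 <=
  (1 + 2 * p ^+ 2) * gen_missing U V N neg (1 - hit_prob p) ^+ 2 +
  2 * gen_missing U V N neg (1 - hit_prob p) -
  gen_missing U V N neg (1 - p ^+ 2) ^+ 2.
Proof.
case=> V0 VU cUV negE /andP[p0 p2].
have p01 : 0 < p < 1 by rewrite p0; lra.
have := mean_nfree2 N V0 VU negE p01; have /andP[h _] := mean_nfree N V0 VU negE p01.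
have q0 := hit_prob_gt0 p01; have q1 := hit_prob_lt1 p01; have qle := hit_prob_le p01.
move: (hit_prob p) q0 q1 qle => q q0 q1 qle.
set S1 := gen_missing _ _ _ _ (1 - q); set S2 := gen_missing _ _ _ _ _ in h *.
have S20 : 0 <= S2.
  by apply: sumr_ge0 => k _; rewrite exprn_ge0// expr2; nra.
have p22 : p ^+ 2 <= 1 / 2 by rewrite expr2; nra.
have qi : (1 - q)^-1 <= 1 + 2 * p ^+ 2.
  by rewrite -[leLHS]div1r ler_pdivrMr; nra.
have h1 : (1 - q)^-1 * S1 ^+ 2 <= (1 + 2 * p ^+ 2) * S1 ^+ 2 by rewrite ler_wpM2r ?sqr_ge0.
have h2 : S2 ^+ 2 <= mean p (nfree U V (N:=N) neg) ^+ 2.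
  by rewrite ler_pXn2r// ?nnegrE// (le_trans S20).
by move=> h3; lra.
Qed.

Lemma gen_missing_ge0 (U V N : nat) (neg : bool) (y : R) : 0 <= y ->
  0 <= gen_missing U V N neg y.
Proof. by move=> y0; apply: sumr_ge0 => k _; exact: exprn_ge0. Qed.

Lemma gen_missing_le (U V N : nat) (neg : bool) (y : R) : 0 <= y <= 1 ->
  gen_missing U V N neg y <= ((U + V) * N).+1%:R.
Proof.
move=> y01; rewrite -[X in _ <= X%:R]card_ord -sum1_card natr_sum; apply: ler_sum => k _.
by rewrite exprn_ile1//; case/andP: y01.
Qed.

(** The bounds for the mean are O(N) and differ by O(N^2 p^3), so their squares differ by O((N
    p)^3). The correction factor 1 + 2 p^2 contributes O((N p)^2), and the exceptional pairs of
    values contribute O(N). *)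
Lemma variance_nfree_critical (U V N : nat) (neg : bool) (p : R) :
  admissible U V neg -> (0 < N)%N -> 0 < p <= 1 / 2 -> 1 <= N%:R * p ->
  mean p (fun A : {set 'I_N.+1} => nfree U V neg A ^+ 2) - mean p (nfree U V (N := N) neg) ^+ 2 <=
    200 * (U + V)%:R ^+ 2 * ((N%:R * p) ^+ 3 + N%:R).
Proof.
move=> ad N0 p02 m1; apply: le_trans (variance_nfree N ad p02) _.
case: ad => V0 VU cUV negE; case/andP: p02 => p0 p2.
have p01 : 0 < p < 1 by rewrite p0; lra.
have q0 := hit_prob_gt0 p01; have q1 := hit_prob_lt1 p01; have qle := hit_prob_le p01.
have y1 : 1 - p ^+ 2 <= 1 - hit_prob p <= 1 - hit_prob p by rewrite lexx andbT; lra.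
have y2 : 1 - p ^+ 2 <= 1 - p ^+ 2 <= 1 - hit_prob p by rewrite lexx; lra.
have := gen_missing_sub V0 VU negE N0 p01 y1.
have := gen_missing_sub V0 VU negE N0 p01 y2.
move: (hit_prob p) q0 q1 qle {y1 y2} => q q0 q1 qle.
have p22 : p ^+ 2 <= 1 / 2 by rewrite expr2; nra.
have p20 : 0 < p ^+ 2 by rewrite exprn_gt0.
have := @gen_missing_le U V N neg (1 - q); have := @gen_missing_ge0 U V N neg (1 - q).
have := @gen_missing_le U V N neg (1 - p ^+ 2); have := @gen_missing_ge0 U V N neg (1 - p ^+ 2).
set S1 := gen_missing _ _ _ _ (1 - q); set S2 := gen_missing _ _ _ _ _.
set S3 := gen_missing _ _ _ _ _.
rewrite !ler_norml => /(_ ltac:(lra)) a1 /(_ ltac:(lra)) a2 /(_ ltac:(lra)) a3 /(_ ltac:(lra)) a4.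
move=> /andP[a5 a6] /andP[a7 a8].
rewrite -natr1 natrM in a2 a4.
have s2 : 2 <= (U + V)%:R :> R by rewrite ler_nat (@leq_add 1 1)// (leq_trans V0).
have n1 : 1 <= N%:R :> R by rewrite ler1n.
move: s2 n1 a2 a4; set s := (U + V)%:R; set n := N%:R => s2 n1 a2 a4.
set m := n * p in m1 *.
have sn : s * n + 1 <= 2 * (s * n) by nra.
have b1 : S1 <= 2 * (s * n) by lra.
have b2 : S2 <= 2 * (s * n) by lra.
have d12 : S1 - S2 <= 36 * n ^+ 2 * p ^+ 3 by lra.
have sn0 : 0 < s * n by nra.
have c1 : S1 ^+ 2 <= 4 * s ^+ 2 * n ^+ 2.
  have -> : 4 * s ^+ 2 * n ^+ 2 = (2 * (s * n)) ^+ 2 by ring.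
  by rewrite ler_pXn2r// nnegrE; lra.
have c2 : S1 ^+ 2 - S2 ^+ 2 <= 144 * s * m ^+ 3.
  have -> : 144 * s * m ^+ 3 = (36 * n ^+ 2 * p ^+ 3) * (4 * (s * n)) by rewrite /m; ring.
  rewrite subr_sqr.
  apply: (@le_trans _ _ ((36 * n ^+ 2 * p ^+ 3) * (S1 + S2))).
    by apply: ler_wpM2r => //; lra.
  by apply: ler_wpM2l; [rewrite !mulr_ge0 ?exprn_ge0//; lra|lra].
have c3 : 2 * p ^+ 2 * S1 ^+ 2 <= 8 * s ^+ 2 * m ^+ 2.
  have -> : 8 * s ^+ 2 * m ^+ 2 = 2 * p ^+ 2 * (4 * s ^+ 2 * n ^+ 2) by rewrite /m; ring.
  by apply: ler_wpM2l => //; lra.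
have m23 : m ^+ 2 <= m ^+ 3 by rewrite ler_weXn2l.
have m3 : 0 < m ^+ 3 by rewrite exprn_gt0//; lra.
have ss : s <= s ^+ 2 by rewrite expr2; nra.
have ss0 : 0 < s ^+ 2 by rewrite exprn_gt0//; lra.
have e1 : s * m ^+ 3 <= s ^+ 2 * m ^+ 3 by rewrite ler_wpM2r// ltW.
have e2 : s ^+ 2 * m ^+ 2 <= s ^+ 2 * m ^+ 3 by rewrite ler_wpM2l// ltW.
have e3 : s * n <= s ^+ 2 * n by rewrite ler_wpM2r//; lra.
have e4 : 0 < s ^+ 2 * m ^+ 3 by rewrite mulr_gt0.
lra.
Qed.

End Domination.

(** * Domination for bounded [lambda] *)

Section Regimes.
Context {R : realType}.

(** The margin d lambda^2 has the order at which collision rates differ as lambda tends to 0. Hence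
    [B] depends on K, d and eps but not on lambda, and small lambda is covered too. *)
Lemma critical_domination U1 V1 neg1 U2 V2 neg2 (K d eps : R) :
  admissible U1 V1 neg1 -> admissible U2 V2 neg2 -> 0 < K -> 0 < d -> 0 < eps ->
  exists2 B : R, 0 < B & forall (N : nat) (p : R), (0 < N)%N -> 0 < p <= 1 / 2 ->
    N%:R * p ^+ 2 <= K -> B <= N%:R ^+ 3 * p ^+ 5 ->
    d * (N%:R * p ^+ 2) ^+ 2 <=
      collision_rate U2 V2 (N%:R * p ^+ 2) - collision_rate U1 V1 (N%:R * p ^+ 2) ->
    1 - eps <= subset_prob p (fun A : {set 'I_N.+1} =>
       (image_size U2 V2 neg2 A < image_size U1 V1 neg1 A)%N).
Proof.
move=> ad1 ad2 K0 d0 eps0.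
pose s : R := (U1 + V1)%:R + (U2 + V2)%:R.
have s2 (U V : nat) neg : admissible U V neg -> 2 <= (U + V)%:R :> R.
  by case=> V0 VU _ _; rewrite ler_nat (@leq_add 1 1)// (leq_trans V0).
have s21 := s2 _ _ _ ad1; have s22 := s2 _ _ _ ad2; have s4 : 4 <= s by rewrite /s; lra.
(* [c1] serves the error of the means, [c2] the two variances, and [c3] the diagonal values. *)
pose c1 := 24 * (24 * s) * K ^+ 2 / d; pose c2 := 8 * (96 * (100 * s ^+ 2)) / (d ^+ 2 * eps).
pose c3 := 48 * K / (d * eps).
have K20 : 0 < K ^+ 2 by rewrite exprn_gt0.
have d20 : 0 < d ^+ 2 by rewrite exprn_gt0.
have s20 : 0 < s ^+ 2 by rewrite exprn_gt0//; lra.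
have s0 : 0 < s by lra.
have c10 : 0 < c1 by apply: divr_gt0 => //; do 2?apply: mulr_gt0 => //; apply: mulr_gt0.
have c20 : 0 < c2 by apply: divr_gt0 => //; [do 3?apply: mulr_gt0 => //|exact: mulr_gt0].
have c30 : 0 < c3 by apply: divr_gt0; exact: mulr_gt0.
exists (1 + K + K ^+ 2 + c1 + c2 + c3); first lra.
move=> N p N0 p02 lK XB dl.
have p01 : 0 < p < 1 by case/andP: p02 => p0 ?; rewrite p0; lra.
case/andP: (p02) => p0 p2.
have n1 : 1 <= N%:R :> R by rewrite ler1n.
have p20 : 0 < p ^+ 2 by rewrite exprn_gt0.
set n := N%:R : R; set l := n * p ^+ 2 in lK dl *; pose m := n * p.
set X := N%:R ^+ 3 * p ^+ 5 in XB.
have n0 : 0 < n by rewrite /n; lra.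
have m0 : 0 < m by rewrite mulr_gt0.
have l0 : 0 < l by rewrite mulr_gt0.
have Xm : X = m * l ^+ 2 by rewrite /X /m /l -/n; ring.
have mn : m <= n by rewrite /m; nra.
have l2K : l ^+ 2 <= K ^+ 2 by rewrite ler_pXn2r// nnegrE ltW.
have XmK : X <= m * K ^+ 2 by rewrite Xm ler_wpM2l// ltW.
have m1 : 1 <= m.
  by rewrite -(ler_pM2r K20) mul1r; apply: le_trans XmK; lra.
have md : 24 * (24 * s) / d <= m.
  rewrite -(ler_pM2r K20); apply: le_trans XmK.
  have -> : 24 * (24 * s) / d * K ^+ 2 = c1 by rewrite /c1; field; rewrite gt_eqF.
  lra.
have msd : 24 * (24 * s) <= m * d by rewrite -ler_pdivrMr.
have ml1 : 1 <= m * l.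
  rewrite -(ler_pM2r K0) mul1r; apply: (@le_trans _ _ X); first lra.
  by rewrite Xm expr2 mulrA ler_wpM2l// mulr_ge0// ltW.
have c2X : 8 * (96 * (100 * s ^+ 2)) <= X * (d ^+ 2 * eps).
  by rewrite -ler_pdivrMr ?mulr_gt0// -/c2; lra.
have c3X : 48 * K <= X * (d * eps) by rewrite -ler_pdivrMr ?mulr_gt0// -/c3; lra.
have lE0 : n * p ^+ 2 = l by [].
have lE : l = m * p by rewrite /l /m; ring.
have mE : m = n * p by [].
have nE : n = m ^+ 2 / l by rewrite /m /l; field; rewrite !gt_eqF.
have s11 : (U1 + V1)%:R <= s by rewrite lerDl.
have s12 : (U2 + V2)%:R <= s by rewrite lerDr.
clear c10 c20 c30 XB md; clearbody l m X s; clear c1 c2 c3.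
(* An eighth of the guaranteed difference d N lambda^2 of the means. Five multiples of [t] are
   spent: two errors of the means, two deviations and the diagonal values. *)
pose t := d * m ^+ 2 * l / 8.
have t0 : 0 < t by rewrite divr_gt0// !mulr_gt0// exprn_gt0.
have tE : t = d * (n * l ^+ 2) / 8 by rewrite /t nE; field; rewrite gt_eqF.
have tml : t = d * m * (m * l) / 8 by rewrite /t; ring.
have t2X : t ^+ 2 = d ^+ 2 * X * m ^+ 3 / 64 by rewrite /t Xm; field.
clearbody t.
have q0 := hit_prob_gt0 p01; have qle := hit_prob_le p01.
have y1 : 1 - p ^+ 2 <= 1 - hit_prob p <= 1 - hit_prob p by rewrite lexx andbT lerB.
have y2 : 1 - p ^+ 2 <= 1 - p ^+ 2 <= 1 - hit_prob p by rewrite lexx lerB.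
have err (U V : nat) : (U + V)%:R <= s ->
    18 * N%:R ^+ 2 * p ^+ 3 + 36 * (U%:R + V%:R) * (N%:R * p ^+ 2) ^+ 2 <= t.
  rewrite natrD -/n lE0 => sUV.
  have -> : 18 * n ^+ 2 * p ^+ 3 = 18 * (m * l) by rewrite lE mE; ring.
  have ml0 : 0 < m * l by rewrite mulr_gt0.
  have e1 : 18 * (m * l) <= t / 2.
    have -> : t / 2 = (m * d) / 16 * (m * l) by rewrite tml; field.
    by apply: ler_wpM2r; [exact: ltW|clear -msd s4; lra].
  have nl0 : 0 < l ^+ 2 by rewrite exprn_gt0.
  have e2 : 36 * (U%:R + V%:R) * l ^+ 2 <= t / 2.
    have -> : t / 2 = (n * d) / 16 * l ^+ 2 by rewrite tE; field.
    apply: ler_wpM2r; first exact: ltW.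
    have h3 : m * d <= n * d by rewrite ler_wpM2r// ltW.
    by clear -msd h3 sUV; lra.
  by clear -e1 e2; lra.
have err1 := err U1 V1 s11; have err2 := err U2 V2 s12.
have var (U V : nat) neg : admissible U V neg -> (U + V)%:R <= s ->
    (200 * (U + V)%:R ^+ 2 * (m ^+ 3 + n)) / t ^+ 2 <= eps / 3.
  move=> /s2 h2 hs.
  have t20 : 0 < t ^+ 2 by rewrite exprn_gt0.
  rewrite ler_pdivrMr//.
  have X0 : 0 < X by rewrite Xm mulr_gt0// exprn_gt0.
  have h3 : (U + V)%:R ^+ 2 <= s ^+ 2 by clear -h2 hs s4; rewrite ler_pXn2r// nnegrE; lra.
  have mn0 : 0 < m ^+ 3 + n by rewrite addr_gt0// exprn_gt0.
  apply: (@le_trans _ _ (200 * s ^+ 2 * (m ^+ 3 + n))).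
    by clear -h3 mn0; rewrite ler_wpM2r ?(ltW mn0)//; lra.
  have nm : n <= m ^+ 3.
    rewrite nE ler_pdivrMr//; have -> : m ^+ 3 * l = m ^+ 2 * (m * l) by ring.
    by rewrite ler_peMr ?sqr_ge0.
  have -> : eps / 3 * t ^+ 2 = (eps * d ^+ 2 * X / 192) * m ^+ 3.
    by rewrite t2X; field.
  have h4 : 400 * s ^+ 2 <= eps * d ^+ 2 * X / 192.
    by clear -c2X; lra.
  apply: (@le_trans _ _ (400 * s ^+ 2 * m ^+ 3)); last first.
    by apply: ler_wpM2r => //; rewrite exprn_ge0// ltW.
  have h5 : s ^+ 2 * n <= s ^+ 2 * m ^+ 3 by rewrite ler_wpM2l// ltW.
  by clear -h5; lra.
case: (ad1) => V10 VU1 cUV1 negE1; case: (ad2) => V20 VU2 cUV2 negE2.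
have /andP[_ f2] := mean_nfree N V10 VU1 negE1 p01.
have /andP[g1 _] := mean_nfree N V20 VU2 negE2 p01.
have vc (U V : nat) neg : admissible U V neg ->
    mean p (fun A : {set 'I_N.+1} => nfree U V neg A ^+ 2)
      - mean p (nfree U V (N := N) neg) ^+ 2 <= 200 * (U + V)%:R ^+ 2 * (m ^+ 3 + n).
  by move=> ad; rewrite mE; apply: variance_nfree_critical => //; rewrite -/n -mE.
have P1 := le_trans (chebyshev_upper p01 t0 f2 (vc _ _ _ ad1)) (var _ _ _ ad1 s11).
have P2 := le_trans (chebyshev_lower p01 t0 g1 (vc _ _ _ ad2)) (var _ _ _ ad2 s12).
have P3 : subset_prob p (fun A : {set 'I_N.+1} => t <= diag_only U2 V2 neg2 A) <= eps / 3.
  have : mean p (@diag_only U2 V2 N neg2 R) <= 2 * m.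
    apply: (@le_trans _ _ (mean p (fun A : {set 'I_N.+1} => #|A|%:R))).
      by apply: mean_le => // A; exact: diag_only_le.
    by rewrite mean_card -natr1 -/n mE; clear -m1 mE p2; lra.
  move=> h; have d0' A : 0 <= @diag_only U2 V2 N neg2 R A.
    by apply: sumr_ge0 => a _; rewrite mulr_ge0.
  apply: le_trans (markov_upper p01 t0 d0' h) _.
  rewrite ler_pdivrMr//.
  have -> : eps / 3 * t = 2 * m * (eps * d * (m * l) / 48) by rewrite tml; field.
  apply: ler_peMr; first by rewrite mulr_ge0// ltW.
  have h3 : X * (d * eps) <= K * (m * l) * (d * eps).
    apply: ler_wpM2r; first by apply: ltW; exact: mulr_gt0.
    by rewrite Xm expr2 mulrA [leRHS]mulrC ler_wpM2l// ltW// mulr_gt0.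
  have h4 : 48 * K <= K * (eps * d * (m * l)) by clear -h3 c3X; lra.
  by rewrite ler_pdivlMr// mul1r -(ler_pM2l K0) mulrC.
have e1 := gen_missing_estimate V10 VU1 cUV1 negE1 N0 p01 y1.
have e2 := gen_missing_estimate V20 VU2 cUV2 negE2 N0 p01 y2.
apply: le_trans (@pr_dominates_ge _ _ p p01 _ _ _ _ _ _ _ _ t _).
  by apply: lerB; [exact: lexx|]; apply: le_trans (lerD (lerD P1 P2) P3) _; clear; lra.
move: e1 e2; rewrite !ler_norml -/n lE0 => /andP[_ a1] /andP[a2 _].
have nd : n * (d * l ^+ 2) <= n * (collision_rate U2 V2 l - collision_rate U1 V1 l).
  by rewrite ler_wpM2l// ltW.
have tE8 : n * (d * l ^+ 2) = 8 * t by rewrite tE; field.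
rewrite tE8 mulrBr in nd; rewrite -/n lE0 in err1 err2.
move: a1 a2 nd err1 err2; set k1 := _.+1%:R; set k2 := _.+1%:R.
move: t0; clear; move=> *; lra.
Qed.

End Regimes.

(** * Domination for large [lambda] *)

Section SupercriticalRegime.
Context {R : realType}.

Lemma admissible_lt U V neg : admissible U V neg -> (2 < U + V)%N -> (V < U)%N.
Proof.
case=> V0 VU cUV _ s3; rewrite ltn_neqAle VU andbT; apply: contraTneq s3 => VUE.
by move: cUV; rewrite -VUE /coprime gcdnn => /eqP ->.
Qed.

(** Meant for S1 and S2 equal to [gen_missing] at 1 - q and at 1 - p^2, with c = 2 U V; (2 p^2)^-1
    is the deviation in Chebyshev's inequality. After scaling by p^2 the bound for the second moment
    exceeds the squared mean only by terms in e and p. *)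
Lemma scaled_variance_le (p c e B eps S1 S2 : R) :
  0 < p -> p <= 1 / 32 -> 0 < c -> c + 1 <= B -> 1 < B -> 0 < e -> e <= 1 / 4 ->
  8 * (12 * B) * (B * p) <= eps -> 8 * (12 * B) * e <= eps ->
  p ^+ 2 * S1 <= c + e -> c - e <= p ^+ 2 * S2 -> 0 <= S1 -> 0 <= S2 ->
  ((1 + 2 * p ^+ 2) * S1 ^+ 2 + 2 * S1 - S2 ^+ 2) / (2 * p ^+ 2)^-1 ^+ 2 <= eps / 3.
Proof.
move=> p0 p32 c0 cB B0 e0 e4 pB eB h1 h2 S10 S20.
have p20 : 0 < p ^+ 2 by rewrite exprn_gt0.
set x := p ^+ 2 * S1 in h1; set y := p ^+ 2 * S2 in h2.
have -> : ((1 + 2 * p ^+ 2) * S1 ^+ 2 + 2 * S1 - S2 ^+ 2) / (2 * p ^+ 2)^-1 ^+ 2 =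
    4 * ((1 + 2 * p ^+ 2) * x ^+ 2 + 2 * p ^+ 2 * x - y ^+ 2).
  by rewrite /x /y exprVn invrK; ring.
have x0 : 0 <= x by rewrite mulr_ge0// ltW.
have y0 : 0 <= y by rewrite mulr_ge0// ltW.
clearbody x y.
have pp : p ^+ 2 <= p / 32 by rewrite expr2; clear -p0 p32; nra.
have xB : x <= B by lra.
have xx : x ^+ 2 <= (c + e) ^+ 2 by rewrite ler_pXn2r// nnegrE; lra.
have xBB : x ^+ 2 <= B ^+ 2 by rewrite ler_pXn2r// nnegrE; lra.
have BB : B <= B ^+ 2 by rewrite expr2; clear -B0; nra.
have eeB : e * B <= eps / 96 by clear -eB; lra.
have pBB : p * B ^+ 2 <= eps / 96 by rewrite expr2; clear -pB; lra.
(* The correction 2 (e B) covers the case e > c, in which c - e is negative. *)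
have yy : (c - e) ^+ 2 - 2 * (e * B) <= y ^+ 2.
  clear -h2 y0 e0 c0 cB e4; case: (lerP e c) => ec; first by nra.
  nra.
have pxx : p ^+ 2 * x ^+ 2 <= p / 32 * B ^+ 2.
  apply: (@le_trans _ _ (p ^+ 2 * B ^+ 2)); first by apply: ler_wpM2l => //; exact: ltW.
  by apply: ler_wpM2r => //; exact: sqr_ge0.
have px : p ^+ 2 * x <= p / 32 * B ^+ 2.
  apply: (@le_trans _ _ (p ^+ 2 * B ^+ 2)); last by apply: ler_wpM2r => //; exact: sqr_ge0.
  by apply: ler_wpM2l; [exact: ltW|exact: le_trans BB].
have ce : c * e <= e * B by rewrite mulrC; apply: ler_wpM2l; [exact: ltW|lra].
have cce : (c + e) ^+ 2 - (c - e) ^+ 2 = 4 * (c * e) by ring.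
have eps0 : 0 <= eps by apply: le_trans eB; clear -B0 e0; nra.
clear h1 h2 pB eB pp xB xBB BB B0 c0 cB e4 p32 p0 e0 p20 x0 y0 S10 S20.
lra.
Qed.

Lemma gen_missing_supercritical U V neg : admissible U V neg -> (V < U)%N ->
  exists2 C : R, 0 < C & forall (N : nat) (p : R), (0 < N)%N -> 0 < p <= 1 / 32 ->
    p ^+ 2 * gen_missing U V N neg (1 - hit_prob p) <=
      2 * U%:R * V%:R + C * (p + (N%:R * p ^+ 2)^-1) /\
    2 * U%:R * V%:R - C * (p + (N%:R * p ^+ 2)^-1) <=
      p ^+ 2 * gen_missing U V N neg (1 - p ^+ 2).
Proof.
move=> [V0 VU' cUV _] VU; exists (200 * U%:R ^+ 3).
  by rewrite mulr_gt0// ?ltr0n// exprn_gt0// ltr0n (leq_trans V0).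
move=> N p N0 /andP[p0 p32]; split; first exact: gen_missing_supercritical_le.
exact: gen_missing_supercritical_ge.
Qed.

(** The range of the first form is longer by at least N, while it misses only O(p^-2) = O(N /
    lambda) values on average. Markov's inequality and the trivial bound for the second image
    suffice. *)
Lemma supercritical_domination U1 V1 neg1 U2 V2 neg2 (eps : R) :
  admissible U1 V1 neg1 -> admissible U2 V2 neg2 -> (U2 + V2 < U1 + V1)%N -> 0 < eps ->
  exists2 L : R, 0 < L & forall (N : nat) (p : R), (0 < N)%N -> 0 < p <= 1 / 32 ->
    L <= N%:R * p ^+ 2 ->
    1 - eps <= subset_prob p (fun A : {set 'I_N.+1} =>
       (image_size U2 V2 neg2 A < image_size U1 V1 neg1 A)%N).
Proof.
move=> ad1 ad2 s21 eps0.
have VU1 : (V1 < U1)%N.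
  apply: (admissible_lt ad1); apply: leq_trans s21; rewrite ltnS.
  by case: ad2 => V0 VU _ _; rewrite (@leq_add 1 1)// (leq_trans V0).
have [C' C'0 bound] := gen_missing_supercritical ad1 VU1.
case: ad1 => V10 VU1' cUV1 negE1.
pose C : R := 2 * U1%:R * V1%:R + C' * 2.
have C0 : 0 < C.
  have u0 : 0 < U1%:R :> R by rewrite ltr0n (leq_trans V10).
  have v0 : 0 < V1%:R :> R by rewrite ltr0n.
  by apply: addr_gt0; rewrite !mulr_gt0.
have Ce0 : 0 < C / eps by rewrite divr_gt0.
exists (1 + C / eps); first lra.
move=> N p N0 /andP[p0 p32] lL.
have p01 : 0 < p < 1 by rewrite p0; lra.
have p20 : 0 < p ^+ 2 by rewrite exprn_gt0.
have n0 : 0 < N%:R :> R by rewrite ltr0n.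
have l0 : 0 < N%:R * p ^+ 2 by rewrite mulr_gt0.
have /andP[_ E1] := mean_nfree N V10 VU1' negE1 p01.
have [S1 _] := bound N p N0 ltac:(by rewrite p0).
have E2 : mean p (nfree U1 V1 (N := N) neg1) <= C / p ^+ 2.
  apply: le_trans E1 _; rewrite ler_pdivlMr// mulrC; apply: le_trans S1 _.
  rewrite /C lerD2l ler_wpM2l ?(ltW C'0)//.
  have : (N%:R * p ^+ 2)^-1 <= 1 by rewrite invf_le1//; lra.
  lra.
have nf0 A : 0 <= @nfree U1 V1 N neg1 R A by apply: sumr_ge0 => k _; rewrite ler0n.
have P1 := markov_upper p01 n0 nf0 E2.
have P2 : C / p ^+ 2 / N%:R <= eps.
  have -> : C / p ^+ 2 / N%:R = C / (N%:R * p ^+ 2) by field; apply/andP; split; lra.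
  by rewrite ler_pdivrMr// mulrC -ler_pdivrMr//; lra.
rewrite lerBlDr -lerBlDl; apply: le_trans (le_trans P1 P2).
rewrite -prC; apply: pr_le => // A; rewrite -leqNgt => h.
rewrite leNgt; apply/negP => h2; move: h; apply/negP; rewrite -ltnNge -(ltr_nat R).
have := @image_size_ge U1 V1 N neg1 R A.
have : (image_size U2 V2 neg2 A)%:R <= ((U2 + V2) * N).+1%:R :> R.
  by rewrite ler_nat /image_size (leq_trans (max_card _))// card_ord.
have : ((U2 + V2) * N).+1%:R + N%:R <= ((U1 + V1) * N).+1%:R :> R.
  by rewrite -natrD ler_nat addSn ltnS -[X in (_ + X)%N]mul1n -mulnDl addn1 leq_mul2r s21 orbT.
set x := _.+1%:R; set y := _.+1%:R => a b c; lra.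
Qed.

(** The ranges have equal length, so the numbers of missed values, about 2 U V / p^2, must
    themselves be compared; this takes concentration on both sides. *)
Lemma supercritical_domination_eq U1 V1 neg1 U2 V2 neg2 (eps : R) :
  admissible U1 V1 neg1 -> admissible U2 V2 neg2 -> (U2 + V2 = U1 + V1)%N ->
  (V1 < U1)%N -> (V2 < U2)%N -> (U1 * V1 < U2 * V2)%N -> 0 < eps ->
  exists2 c : R, 0 < c & exists2 L : R, 0 < L &
    forall (N : nat) (p : R), (0 < N)%N -> 0 < p <= c -> L <= N%:R * p ^+ 2 ->
    1 - eps <= subset_prob p (fun A : {set 'I_N.+1} =>
       (image_size U2 V2 neg2 A < image_size U1 V1 neg1 A)%N).
Proof.
move=> ad1 ad2 s21 VU1 VU2 uv12 eps0.
case: (ad1) => V10 VU1' cUV1 negE1; case: (ad2) => V20 VU2' cUV2 negE2.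
have ab : 2 * U1%:R * V1%:R + 2 <= 2 * U2%:R * V2%:R :> R.
  have : (U1 * V1).+1%:R <= (U2 * V2)%:R :> R by rewrite ler_nat.
  by rewrite -natr1 !natrM; lra.
have ge1 (n : nat) : (0 < n)%N -> 1 <= n%:R :> R by rewrite ler1n.
have v11 := ge1 _ V10; have v21 := ge1 _ V20.
have u11 := ge1 _ (leq_trans V10 VU1'); have u21 := ge1 _ (leq_trans V20 VU2').
pose a : R := 2 * U1%:R * V1%:R; pose b : R := 2 * U2%:R * V2%:R.
have a0 : 0 < a by rewrite /a !mulr_gt0//; lra.
have b0 : 0 < b by rewrite /b !mulr_gt0//; lra.
have [C1 C10 bound1] := gen_missing_supercritical ad1 VU1.
have [C2 C20 bound2] := gen_missing_supercritical ad2 VU2.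
pose B := a + b + 1; pose w := C1 + C2.
have w0 : 0 < w by exact: addr_gt0.
have B0 : 1 < B by rewrite /B; lra.
pose M := 8 * (12 * B) / eps.
have M0 : 0 < M by rewrite divr_gt0// !mulr_gt0//; lra.
have Me : M * eps = 8 * (12 * B) by rewrite /M divfK// gt_eqF.
pose eta := (4 + M)^-1.
have eta0 : 0 < eta by rewrite invr_gt0; lra.
have eta4 : eta * (4 + M) = 1 by rewrite /eta mulVf// gt_eqF//; lra.
pose L := 2 * w / eta.
have L0 : 0 < L by rewrite divr_gt0// mulr_gt0.
have Le : L * eta = 2 * w by rewrite /L divfK// gt_eqF.
have MB0 : 0 < M * B by rewrite mulr_gt0//; lra.
have aB : a + 1 <= B by rewrite /B; lra.
have bB : b + 1 <= B by rewrite /B; lra.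
have wC1 : C1 <= w by rewrite /w; lra.
have wC2 : C2 <= w by rewrite /w; lra.
clearbody w eta M B L; exists ((32 + L + M * B)^-1); first by rewrite invr_gt0; lra.
exists L => // N p N0 /andP[p0 pc] lL.
have pc' : (32 + L + M * B) * p <= 1.
  have c0 : 0 < 32 + L + M * B by lra.
  by rewrite mulrC -(ler_pdivlMr _ _ c0) div1r.
have Lp0 : 0 < L * p by rewrite mulr_gt0.
have MBp0 : 0 < M * B * p by rewrite mulr_gt0.
have p32 : 0 < p <= 1 / 32 by rewrite p0; clear -pc' Lp0 MBp0; lra.
have pw : 2 * w * p <= eta.
  by rewrite -Le mulrAC -[leRHS]mul1r ler_pM2r//; clear -pc' p0 MBp0; lra.
have pB : 8 * (12 * B) * (B * p) <= eps.
  by rewrite -Me mulrAC -[leRHS]mul1r ler_pM2r//; clear -pc' p0 Lp0; lra.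
have p32' : p <= 1 / 32 by case/andP: p32.
have p01 : 0 < p < 1 by rewrite p0; clear -p32'; lra.
have p02 : 0 < p <= 1 / 2 by rewrite p0; clear -p32'; lra.
have p20 : 0 < p ^+ 2 by rewrite exprn_gt0.
have l0 : 0 < N%:R * p ^+ 2 by rewrite mulr_gt0// ltr0n.
have [f1 f2] := bound1 N p N0 p32; have [g1 g2] := bound2 N p N0 p32.
have lw : 2 * w * (N%:R * p ^+ 2)^-1 <= eta.
  by rewrite ler_pdivrMr// -Le [leRHS]mulrC ler_pM2r.
have il0 : 0 < (N%:R * p ^+ 2)^-1 by rewrite invr_gt0.
move: ((N%:R * p ^+ 2)^-1) il0 lw f1 f2 g1 g2 => il il0 lw f1 f2 g1 g2.
clear bound1 bound2 pc pc' Lp0 MBp0 L0 Le lL.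
pose e := w * (p + il).
have e0 : 0 < e by rewrite mulr_gt0// addr_gt0.
have eeta : e <= eta by rewrite /e mulrDr; clear -pw lw; lra.
have pil : 0 <= p + il by rewrite addr_ge0// ltW.
have e1 : C1 * (p + il) <= e by rewrite ler_wpM2r.
have e2 : C2 * (p + il) <= e by rewrite ler_wpM2r.
clearbody e.
have e4 : e <= 1 / 4.
  have h : 0 < eta * M by rewrite mulr_gt0.
  by clear -h eeta eta4; lra.
have eB : 8 * (12 * B) * e <= eps.
  rewrite -Me mulrAC -[leRHS]mul1r ler_pM2r//.
  by apply: (@le_trans _ _ (M * eta)); [rewrite ler_pM2l|clear -eta0 eta4; lra].
clear pw lw wC1 wC2 w0 il0 pil eeta eta4 eta0 Me M0 MB0.
rewrite -/a -/b in f1 f2 g1 g2 ab.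
have {}f1 := le_trans f1 (lerD (lexx a) e1).
have {}g1 := le_trans g1 (lerD (lexx b) e2).
have {}f2 := le_trans (lerB (lexx a) e1) f2.
have {}g2 := le_trans (lerB (lexx b) e2) g2.
(* By integrality 2 U V differs by at least 2, so the means differ by about 2 / p^2. Two deviations
   and the diagonal values use 3 [t]; the remaining 1 / (2 p^2) absorbs the two errors e <= 1/4. *)
pose t := (2 * p ^+ 2)^-1.
have t0 : 0 < t by rewrite invr_gt0 mulr_gt0.
have tp : t * p ^+ 2 = 1 / 2 by rewrite /t; field; rewrite gt_eqF.
have p12 : 0 <= 1 - p ^+ 2 by clear -p0 p32'; nra.
have q12 : 0 <= 1 - hit_prob p by rewrite subr_ge0 ltW// hit_prob_lt1.
have v1 := scaled_variance_le p0 p32' a0 aB B0 e0 e4 pB eB f1 f2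
  (gen_missing_ge0 U1 V1 N neg1 q12) (gen_missing_ge0 U1 V1 N neg1 p12).
have v2 := scaled_variance_le p0 p32' b0 bB B0 e0 e4 pB eB g1 g2
  (gen_missing_ge0 U2 V2 N neg2 q12) (gen_missing_ge0 U2 V2 N neg2 p12).
have /andP[m1 m2] := mean_nfree N V10 VU1' negE1 p01.
have /andP[m3 m4] := mean_nfree N V20 VU2' negE2 p01.
have P1 := le_trans (chebyshev_upper p01 t0 m2 (variance_nfree N ad1 p02)) v1.
have P2 := le_trans (chebyshev_lower p01 t0 m3 (variance_nfree N ad2 p02)) v2.
have P3 : subset_prob p (fun A : {set 'I_N.+1} => t <= diag_only U2 V2 neg2 A) <= eps / 3.
  have nUV2 : U2 <> V2 by move=> h; move: VU2; rewrite h ltnn.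
  have h := mean_diag_only N V20 VU2' negE2 p01 nUV2.
  have d0' A : 0 <= @diag_only U2 V2 N neg2 R A.
    by apply: sumr_ge0 => i _; rewrite mulr_ge0.
  apply: le_trans (markov_upper p01 t0 d0' h) _.
  rewrite ler_pdivrMr//; apply: le_trans (ler_wpM2l (ltW p0) m4) _.
  rewrite -(ler_pM2r p20) -[leRHS]mulrA tp.
  apply: (@le_trans _ _ (p * B)).
    by rewrite -mulrA ler_wpM2l ?(ltW p0)// [leLHS]mulrC (le_trans g1)//; clear -e4 bB; lra.
  have h2 : p * B <= p * B ^+ 2 by rewrite ler_wpM2l ?(ltW p0)// expr2; clear -B0; nra.
  have h3 : 0 < p * B by rewrite mulr_gt0// (lt_trans _ B0).
  by clear -h2 h3 pB; lra.
apply: le_trans (@pr_dominates_ge _ _ p p01 _ _ _ _ _ _ _ _ t _).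
  by apply: lerB; [exact: lexx|]; apply: le_trans (lerD (lerD P1 P2) P3) _; clear; lra.
rewrite s21; set k := _.+1%:R.
have : p ^+ 2 * (gen_missing U1 V1 N neg1 (1 - hit_prob p) + 3 * t) <=
       p ^+ 2 * gen_missing U2 V2 N neg2 (1 - p ^+ 2).
  by rewrite mulrDr; clear -f1 g2 tp ab e4; lra.
rewrite ler_pM2l//.
set x := gen_missing _ _ _ _ _; set y := gen_missing _ _ _ _ _.
by clear; move=> h; lra.
Qed.

End SupercriticalRegime.

(** * Comparison of the limiting densities *)

Section SignAnalysis.
Context {R : realType}.
Implicit Types (f df : R -> R) (u v x y l : R).

(* The fraction of hit values in the limit, multiplied by [l] to clear the
   denominator. *)
Definition gain u v l : R :=
  (u + v) * l - 2 * u * v + (2 * u * v - (u - v) * l) * expR (- l / u).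

Definition gain1 u v l : R := (u + v) - ((u + v) - (u - v) / u * l) * expR (- l / u).

Definition gain2 u v l : R := (2 - (u - v) / u ^+ 2 * l) * expR (- l / u).

Lemma is_derive_gain u v l : 0 < u -> is_derive l 1 (gain u v) (gain1 u v l).
Proof.
move=> u0.
have d1 := is_derive_linexp (- (2 * u * v)) (u + v) 0 l.
have d2 := is_derive_linexp (2 * u * v) (- (u - v)) (- u^-1) l.
have -> : gain u v = (fun x => (- (2 * u * v) + (u + v) * x) * expR (0 * x)
   + (2 * u * v + - (u - v) * x) * expR (- u^-1 * x)).
  apply/funext => x; rewrite /gain mul0r expR0 mulr1.
  by rewrite (_ : - x / u = - u^-1 * x); [|lra]; ring.
apply: is_derive_eq (is_deriveD d1 d2) _; rewrite /gain1 !mul0r expR0.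
by rewrite (_ : - l / u = - u^-1 * l); [|lra]; field; lra.
Qed.

Lemma is_derive_gain1 u v l : 0 < u -> is_derive l 1 (gain1 u v) (gain2 u v l).
Proof.
move=> u0.
have d1 := is_derive_linexp (u + v) 0 0 l.
have d2 := is_derive_linexp (- (u + v)) ((u - v) / u) (- u^-1) l.
have -> : gain1 u v = (fun x => ((u + v) + 0 * x) * expR (0 * x)
   + (- (u + v) + (u - v) / u * x) * expR (- u^-1 * x)).
  apply/funext => x; rewrite /gain1 !mul0r expR0.
  by rewrite (_ : - x / u = - u^-1 * x); [ring|lra].
apply: is_derive_eq (is_deriveD d1 d2) _; rewrite /gain2 !mul0r expR0.
by rewrite (_ : - l / u = - u^-1 * l); [|lra]; field; lra.
Qed.

Lemma gain0 u v : gain u v 0 = 0.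
Proof. by rewrite /gain oppr0 mul0r expR0; lra. Qed.

Lemma gain10 u v : gain1 u v 0 = 0.
Proof. by rewrite /gain1 oppr0 mul0r expR0; lra. Qed.

(** A sign pattern, at most one change and from plus to minus, that survives integration from 0 and
    multiplication by positive functions. *)
Definition once_nonpos f : Prop := forall x y, 0 < x < y -> f x <= 0 -> f y < 0.

Lemma once_nonpos_derive f df : (forall x, is_derive x 1 f (df x)) -> f 0 = 0 ->
  once_nonpos df -> once_nonpos f.
Proof.
move=> fd f0 hdf x y /andP[x0 xy] fx.
have [c /andP[c0 cx]] := mvt fd x0; rewrite f0 !subr0 => hc.
have dc : df c <= 0 by rewrite -(pmulr_lle0 _ x0) -hc.
have [c' /andP[xc' c'y] hc'] := mvt fd xy.
have dc' : df c' < 0 by apply: (hdf c) => //; rewrite c0 (lt_trans cx).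
have : df c' * (y - x) < 0 by rewrite pmulr_llt0// subr_gt0.
lra.
Qed.

Lemma pos_derive f df e : (forall x, is_derive x 1 f (df x)) -> f 0 = 0 ->
  (forall x, 0 < x < e -> 0 < df x) -> forall x, 0 < x < e -> 0 < f x.
Proof.
move=> fd f0 h x /andP[x0 xe].
have [c /andP[c0 cx]] := mvt fd x0; rewrite f0 !subr0 => ->.
by rewrite mulr_gt0// h// c0 (lt_trans cx).
Qed.

(** Only the growth over the upper half [x / 2, x] is used, where the derivative is at least c (x /
    2)^k; hence the denominator 2^(k + 1) instead of k + 1. *)
Lemma power_derive f df e (k : nat) (c : R) : 0 <= c ->
  (forall x, is_derive x 1 f (df x)) -> f 0 = 0 ->
  (forall x, 0 < x < e -> c * x ^+ k <= df x) ->
  forall x, 0 < x < e -> c / 2 ^+ k.+1 * x ^+ k.+1 <= f x.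
Proof.
move=> c0 fd f0 h x /andP[x0 xe].
have pos y : 0 < y < e -> 0 <= f y.
  move=> /andP[y0 ye]; have [z /andP[z0 zy]] := mvt fd y0; rewrite f0 !subr0 => ->.
  rewrite mulr_ge0 ?(ltW y0)//; apply: (@le_trans _ _ (c * z ^+ k)).
    by rewrite mulr_ge0// exprn_ge0// ltW.
  by rewrite h// z0 (lt_trans zy).
have x2 : x / 2 < x by lra.
have [z /andP[z0 zx] hz] := mvt fd x2.
have : 0 <= f (x / 2) by apply: pos; lra.
have hd : c * (x / 2) ^+ k <= df z.
  apply: (@le_trans _ _ (c * z ^+ k)); last by apply: h; lra.
  by rewrite ler_wpM2l// lerXn2r ?nnegrE; lra.
have -> : c / 2 ^+ k.+1 * x ^+ k.+1 = c * (x / 2) ^+ k * (x - x / 2).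
  rewrite (_ : x - x / 2 = x / 2); last by lra.
  by rewrite -[RHS]mulrA -exprSr expr_div_n [RHS]mulrA mulrAC.
have : c * (x / 2) ^+ k * (x - x / 2) <= df z * (x - x / 2).
  by rewrite ler_wpM2r//; lra.
lra.
Qed.

Section TwoForms.
Variables u1 v1 u2 v2 : R.
Hypotheses (v10 : 0 < v1) (v20 : 0 < v2) (vu1 : v1 <= u1) (vu2 : v2 <= u2).

Definition gap l : R := gain u1 v1 l - gain u2 v2 l.
Definition gap1 l : R := gain1 u1 v1 l - gain1 u2 v2 l.
Definition gap2 l : R := gain2 u1 v1 l - gain2 u2 v2 l.

Local Notation A1 := ((u1 - v1) / u1 ^+ 2).
Local Notation A2 := ((u2 - v2) / u2 ^+ 2).
Local Notation k := (u2^-1 - u1^-1).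

(* [gap2e] and [gap3ee] are the second derivative of [gap] and the first
   derivative of [gap2e], each with one exponential factor removed. *)
Definition gap2e l : R := (2 - A1 * l) - (2 - A2 * l) * expR (- k * l).
Definition gap3e l : R := - A1 + (A2 + 2 * k - k * A2 * l) * expR (- k * l).
Definition gap3ee l : R := - A1 * expR (k * l) + (A2 + 2 * k - k * A2 * l).

Let u10 : 0 < u1. Proof. exact: lt_le_trans vu1. Qed.
Let u20 : 0 < u2. Proof. exact: lt_le_trans vu2. Qed.

Lemma is_derive_gap x : is_derive x 1 gap (gap1 x).
Proof. exact: is_deriveB (is_derive_gain v1 x u10) (is_derive_gain v2 x u20). Qed.

Lemma is_derive_gap1 x : is_derive x 1 gap1 (gap2 x).
Proof. exact: is_deriveB (is_derive_gain1 v1 x u10) (is_derive_gain1 v2 x u20). Qed.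

Lemma is_derive_gap2e x : is_derive x 1 gap2e (gap3e x).
Proof.
have d1 := is_derive_linexp 2 (- A1) 0 x.
have d2 := is_derive_linexp (- 2) A2 (- k) x.
have -> : gap2e = (fun x => (2 + - A1 * x) * expR (0 * x) + (- 2 + A2 * x) * expR (- k * x)).
  by apply/funext => z; rewrite /gap2e !mul0r expR0; lra.
apply: is_derive_eq (is_deriveD d1 d2) _; rewrite /gap3e !mul0r expR0.
by ring.
Qed.

Lemma gap_0 : gap 0 = 0. Proof. by rewrite /gap !gain0 subrr. Qed.
Lemma gap1_0 : gap1 0 = 0. Proof. by rewrite /gap1 !gain10 subrr. Qed.
Lemma gap2e_0 : gap2e 0 = 0.
Proof. by rewrite /gap2e !mulr0 expR0; lra. Qed.

Lemma gap2E l : gap2 l = expR (- l / u1) * gap2e l.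
Proof.
rewrite /gap2 /gap2e /gain2 mulrBr; congr (_ - _); first by rewrite mulrC.
rewrite mulrCA -expRD; congr (_ * expR _); field.
by apply/andP; split; rewrite gt_eqF// ?u10 ?u20.
Qed.

Lemma gap3E l : gap3e l = expR (- k * l) * gap3ee l.
Proof.
have h : expR (- k * l) * expR (k * l) = 1 by rewrite -expRD mulNr addNr expR0.
rewrite /gap3e /gap3ee [RHS]mulrDr [in RHS]mulrCA h mulr1.
by congr (_ + _); rewrite mulrC.
Qed.

Lemma gap3ee_0 : gap3ee 0 = (3 * u2 - v2) / u2 ^+ 2 - (3 * u1 - v1) / u1 ^+ 2.
Proof.
rewrite /gap3ee !mulr0 expR0; field.
by apply/andP; split; rewrite gt_eqF// ?u10 ?u20.
Qed.

Lemma once_nonpos_mul (g h : R -> R) : (forall x, exists2 e, 0 < e & g x = e * h x) ->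
  once_nonpos h -> once_nonpos g.
Proof.
move=> gh hh x y xy; have [e e0 ->] := gh x; have [e' e0' ->] := gh y.
by rewrite pmulr_rle0// pmulr_rlt0//; exact: hh.
Qed.

Lemma gap_pos_of_gap3ee e : (forall x, 0 < x < e -> 0 < gap3ee x) ->
  forall x, 0 < x < e -> 0 < gap x.
Proof.
move=> h; apply: (pos_derive is_derive_gap gap_0).
apply: (pos_derive is_derive_gap1 gap1_0) => x xe.
rewrite gap2E mulr_gt0 ?expR_gt0//; move: x xe.
apply: (pos_derive is_derive_gap2e gap2e_0) => x xe.
by rewrite gap3E mulr_gt0 ?expR_gt0// h.
Qed.

Lemma continuous_gap3ee : continuous gap3ee.
Proof.
move=> x; have d1 := is_derive_linexp (- A1) 0 k; have d2 := is_derive_linexp (A2 + 2 * k) (- (k * A2)) 0.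
have -> : gap3ee = (fun x => (- A1 + 0 * x) * expR (k * x) + (A2 + 2 * k + - (k * A2) * x) * expR (0 * x)).
  by apply/funext => z; rewrite /gap3ee !mul0r expR0 addr0 mulr1; lra.
exact: is_derive_continuous (fun x => is_deriveD (d1 x) (d2 x)).
Qed.

Lemma continuous_gap : continuous gap.
Proof. by move=> x; apply: is_derive_continuous is_derive_gap. Qed.

Lemma gap3ee_near0 : 0 < gap3ee 0 -> exists2 e, 0 < e &
  forall x, 0 < x < e -> gap3ee 0 / 2 <= gap3ee x.
Proof.
move=> h; have c2 : 0 < gap3ee 0 / 2 by lra.
have := continuous_gap3ee (x := 0); move/cvgrPdist_le => /(_ _ c2).
move=> /nbhs_ballP [e /= e0 he]; exists e => // x /andP[x0 xe].
have := he x; rewrite /ball /= sub0r normrN gtr0_norm// => /(_ xe).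
rewrite ler_norml => /andP[_]; lra.
Qed.

(** A positive third-order term, integrated three times. Staying below 1 bounds the removed
    exponential factors from below. As [gap] carries a factor l, the cube corresponds to the
    quadratic margin of [critical_domination]. *)
Lemma gap_near0 : 0 < gap3ee 0 -> exists e d, [/\ 0 < e, 0 < d &
  forall x, 0 < x < e -> d * x ^+ 3 <= gap x].
Proof.
move=> h; have [e e0 he] := gap3ee_near0 h.
pose e' := Num.min e 1.
have e'0 : 0 < e' by rewrite /e' lt_min e0 ltr01.
have e'e x : 0 < x < e' -> 0 < x < e by rewrite /e' lt_min => /and3P[-> -> _].
have e'1 x : 0 < x < e' -> x <= 1 by rewrite /e' lt_min => /and3P[_ _ /ltW].
pose m := expR (- `|k|); have m0 : 0 < m by exact: expR_gt0.
pose m' := expR (- u1^-1); have m'0 : 0 < m' by exact: expR_gt0.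
set c := gap3ee 0 / 2 in he; have c0 : 0 < c by rewrite /c; lra.
have h1 x : 0 < x < e' -> (m * c) * x ^+ 0 <= gap3e x.
  move=> xe; rewrite expr0 mulr1 gap3E ler_pM ?(ltW m0) ?(ltW c0)//; last exact: he (e'e _ xe).
  rewrite ler_expR mulNr lerN2; apply: le_trans (ler_norm _) _.
  rewrite normrM ler_piMr// ger0_norm ?e'1//; case/andP: xe => x0 _; exact: ltW.
have mc : 0 <= m * c by rewrite mulr_ge0 ?ltW.
have h2 := power_derive mc is_derive_gap2e gap2e_0 h1.
set c2 := m * c / 2 ^+ 1 in h2; have c20 : 0 < c2 by rewrite /c2 divr_gt0// mulr_gt0.
have h3 x : 0 < x < e' -> (m' * c2) * x ^+ 1 <= gap2 x.
  move=> xe; have x0 : 0 < x by case/andP: xe.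
  rewrite gap2E -mulrA; apply: ler_pM; rewrite ?(ltW m'0) ?h2//.
    by rewrite mulr_ge0 ?(ltW c20) ?expr1 ?(ltW x0).
  rewrite ler_expR mulNr lerN2 ler_piMl ?invr_ge0 ?(ltW u10)//; exact: e'1.
have mc2 : 0 <= m' * c2 by rewrite mulr_ge0 ?ltW.
have h4 := power_derive mc2 is_derive_gap1 gap1_0 h3.
have mc3 : 0 <= m' * c2 / 2 ^+ 2 by rewrite divr_ge0// exprn_ge0.
have h5 := power_derive mc3 is_derive_gap gap_0 h4.
exists e', (m' * c2 / 2 ^+ 2 / 2 ^+ 3); split => //.
by rewrite !divr_gt0 ?mulr_gt0 ?exprn_gt0.
Qed.

(** Cubic growth near 0, and a positive minimum by compactness on the rest of the interval. *)
Lemma gap_lower_bound K : 0 < gap3ee 0 -> 0 < K -> (forall x, 0 < x <= K -> 0 < gap x) ->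
  exists2 d, 0 < d & forall x, 0 < x <= K -> d * x ^+ 3 <= gap x.
Proof.
move=> h K0 pos; have [e [d [e0 d0 he]]] := gap_near0 h.
case: (ltP K e) => [Ke|eK].
  exists d => // x /andP[x0 xK]; apply: he; rewrite x0; exact: le_lt_trans Ke.
have cg : {within `[e, K], continuous gap}.
  by apply: continuous_subspaceT => x; exact: continuous_gap.
have [c cI hc] := EVT_min eK cg.
have gc : 0 < gap c.
  by apply: pos; move: cI; rewrite in_itv /= => /andP[ec ->]; rewrite (lt_le_trans e0).
pose d' := gap c / K ^+ 3; have K30 : 0 < K ^+ 3 by rewrite exprn_gt0.
have d'0 : 0 < d' by rewrite divr_gt0.
exists (Num.min d d'); first by rewrite lt_min d0.
move=> x /andP[x0 xK]; have x30 : 0 <= x ^+ 3 by rewrite exprn_ge0// ltW.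
case: (ltP x e) => xe.
  apply: le_trans (he x _); last by rewrite x0.
  by rewrite ler_wpM2r// ge_min lexx.
apply: (@le_trans _ _ (d' * x ^+ 3)); first by rewrite ler_wpM2r// ge_min lexx orbT.
apply: (@le_trans _ _ (gap c)); last by apply: hc; rewrite in_itv /= xe.
by rewrite /d' mulrAC ler_pdivrMr// ler_pM2l// lerXn2r// nnegrE ltW.
Qed.

(** For u2 < u1 the rate k is positive, so [gap3ee] is strictly decreasing. *)
Lemma once_nonpos_gap3ee : u2 < u1 -> v1 < u1 -> once_nonpos gap3ee.
Proof.
move=> u21 vu x y /andP[x0 xy].
have k0 : 0 < k by rewrite subr_gt0 ltf_pV2 ?posrE.
have A10 : 0 < A1 by rewrite divr_gt0 ?exprn_gt0// subr_gt0.
have A20 : 0 <= A2 by rewrite divr_ge0 ?exprn_ge0 ?(ltW u20)// subr_ge0.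
suff : gap3ee y < gap3ee x by lra.
have e : expR (k * x) < expR (k * y) by rewrite ltr_expR ltr_pM2l.
have : A1 * expR (k * x) < A1 * expR (k * y) by rewrite ltr_pM2l.
have : k * A2 * x <= k * A2 * y by rewrite ler_wpM2l ?(ltW xy)// mulr_ge0// ltW.
rewrite /gap3ee; lra.
Qed.

Lemma once_nonpos_gap2 : u2 < u1 -> v1 < u1 -> once_nonpos gap2.
Proof.
move=> u21 vu; apply: (@once_nonpos_mul _ gap2e).
  by move=> x; exists (expR (- x / u1)); rewrite ?expR_gt0// gap2E.
apply: (once_nonpos_derive is_derive_gap2e gap2e_0).
apply: (@once_nonpos_mul _ gap3ee); last exact: once_nonpos_gap3ee.
by move=> x; exists (expR (- k * x)); rewrite ?expR_gt0// gap3E.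
Qed.

Lemma once_nonpos_gap : u2 < u1 -> v1 < u1 -> once_nonpos gap.
Proof.
move=> u21 vu; apply: (once_nonpos_derive is_derive_gap gap_0).
apply: (once_nonpos_derive is_derive_gap1 gap1_0); exact: once_nonpos_gap2.
Qed.

End TwoForms.

Lemma gain1_limit u v (e : R) : 0 < v -> v <= u -> 0 < e ->
  exists2 L, 0 < L & forall l, L <= l -> `|gain1 u v l - (u + v)| <= e.
Proof.
move=> v0 vu e0; have u0 : 0 < u by lra.
pose C := (u + v + 1) * (4 * u ^+ 2).
have C0 : 0 < C by rewrite !mulr_gt0 ?exprn_gt0//; lra.
have Ce : 0 < C / e by rewrite divr_gt0.
exists (1 + C / e); first lra.
move=> l lL; have l1 : 1 <= l by lra.
have -> : gain1 u v l - (u + v) = - (((u + v) - (u - v) / u * l) * expR (- l / u)).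
  by rewrite /gain1; ring.
rewrite normrN normrM (ger0_norm (expR_ge0 _)).
have h1 : `|u + v - (u - v) / u * l| <= (u + v + 1) * l.
  have w0 : 0 <= (u - v) / u <= 1.
    by rewrite divr_ge0 ?ler_pdivrMr//; lra.
  move: ((u - v) / u) w0 => w /andP[w0 w1].
  have : w * l <= l by rewrite ler_piMl//; lra.
  have : 0 <= w * l by rewrite mulr_ge0//; lra.
  have : u + v <= (u + v) * l by rewrite ler_peMr//; lra.
  by rewrite ler_norml => *; apply/andP; split; lra.
have lu0 : 0 < l / u by rewrite divr_gt0//; lra.
have h2 := expR_le_invsqr lu0; rewrite -mulNr in h2.
apply: le_trans (ler_pM (normr_ge0 _) (expR_ge0 _) h1 h2) _.
have -> : (u + v + 1) * l * (4 / (l / u) ^+ 2) = C / l.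
  by rewrite /C; field; apply/andP; split; rewrite gt_eqF//; lra.
by rewrite ler_pdivrMr ?(lt_le_trans _ l1)// mulrC -ler_pdivrMr//; lra.
Qed.

Lemma gap_swap u1 v1 u2 v2 l : gap u2 v2 u1 v1 l = - gap u1 v1 u2 v2 l.
Proof. by rewrite /gap opprB. Qed.

Section Signs.
Variables u1 v1 u2 v2 : R.
Hypotheses (v10 : 0 < v1) (v20 : 0 < v2) (vu1 : v1 <= u1) (vu2 : v2 <= u2).
Hypotheses (lt1 : u2 < u1 -> v1 < u1) (lt2 : u1 < u2 -> v2 < u2).

Let u10 : 0 < u1. Proof. exact: lt_le_trans vu1. Qed.
Let u20 : 0 < u2. Proof. exact: lt_le_trans vu2. Qed.

(** If [gap1] were nonpositive somewhere, then [gap2] would be negative from there on, and [gap1]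
    would decrease strictly and stay below a negative constant; but its limit (u1 + v1) - (u2 + v2)
    is nonnegative. *)
Lemma gap_gt0_of_gt l : u2 < u1 -> u2 + v2 <= u1 + v1 -> 0 < l -> 0 < gap u1 v1 u2 v2 l.
Proof.
move=> u21 s21 l0.
have nn := once_nonpos_gap2 v10 v20 vu1 vu2 u21 (lt1 u21).
have d1 x := is_derive_gap1 v10 v20 vu1 vu2 x.
have pos x : 0 < x -> 0 < gap1 u1 v1 u2 v2 x.
  move=> x0; rewrite ltNge; apply/negP => g1x.
  have [c /andP[c0 cx]] := mvt d1 x0; rewrite gap1_0 !subr0 => hc.
  have dc : gap2 u1 v1 u2 v2 c <= 0 by rewrite -(pmulr_lle0 _ x0) -hc.
  have dec y z : x <= y -> y < z -> gap1 u1 v1 u2 v2 z < gap1 u1 v1 u2 v2 y.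
    move=> xy yz; have [c' /andP[yc' _] hc'] := mvt d1 yz.
    have : gap2 u1 v1 u2 v2 c' < 0 by apply: (nn c) => //; rewrite c0; lra.
    have yz0 : 0 < z - y by lra.
    rewrite -(pmulr_llt0 _ yz0) -hc'; lra.
  have g2 : gap1 u1 v1 u2 v2 (x + 1) < 0.
    by apply: lt_le_trans g1x; apply: dec; lra.
  set eta := - gap1 u1 v1 u2 v2 (x + 1); have e0 : 0 < eta / 3 by rewrite /eta; lra.
  have [L1 L10 h1] := gain1_limit v10 vu1 e0; have [L2 L20 h2] := gain1_limit v20 vu2 e0.
  pose z := x + 1 + L1 + L2; have xz : x + 1 < z by rewrite /z; lra.
  have := dec (x + 1) z _ xz; move=> /(_ ltac:(lra)).
  have := h1 z ltac:(rewrite /z; lra); have := h2 z ltac:(rewrite /z; lra).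
  rewrite !ler_norml => /andP[_ a1] /andP[a2 _].
  rewrite [X in X < _ -> _]/gap1 -[gap1 _ _ _ _ (x + 1)]opprK -/eta.
  by move=> a3; lra.
have := pos_derive (fun x => is_derive_gap v10 v20 vu1 vu2 x) (gap_0 u1 v1 u2 v2) (e := l + 1).
by apply; [move=> x /andP[x0 _]; exact: pos|rewrite l0; lra].
Qed.

(** For u1 < u2 the pattern [once_nonpos] holds for the negated gap, so positivity near 0 persists;
    for u1 = u2 the function [gap3ee] is constant. *)
Lemma gap_gt0 l : u2 + v2 <= u1 + v1 -> 0 < gap3ee u1 v1 u2 v2 0 -> 0 < l ->
  0 < gap u1 v1 u2 v2 l.
Proof.
move=> s21 a12 l0; case: (ltgtP u1 u2) => u12.
- have [e [d [e0 d0 he]]] := gap_near0 v10 v20 vu1 vu2 a12.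
  pose y := Num.min (e / 2) (l / 2).
  have y0 : 0 < y by rewrite lt_min; apply/andP; split; lra.
  have ye : y <= e / 2 by rewrite ge_min lexx.
  have yl : y <= l / 2 by rewrite ge_min lexx orbT.
  have gy : 0 < gap u1 v1 u2 v2 y.
    apply: lt_le_trans (he y _); first by rewrite mulr_gt0// exprn_gt0.
    by rewrite y0; lra.
  have nn := once_nonpos_gap v20 v10 vu2 vu1 u12 (lt2 u12).
  have := nn y l; rewrite !(gap_swap u1 v1 u2 v2) y0 oppr_le0 oppr_lt0; apply; last exact: ltW.
  by lra.
- exact: gap_gt0_of_gt.
- apply: (gap_pos_of_gap3ee v10 v20 vu1 vu2 (e := l + 1)); last by rewrite l0; lra.
  move=> x _; suff -> : gap3ee u1 v1 u2 v2 x = gap3ee u1 v1 u2 v2 0 by [].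
  by rewrite /gap3ee u12 subrr !mul0r !subr0.
Qed.

Lemma gap_eventually_gt0 : u2 + v2 < u1 + v1 -> exists2 l, 0 < l & 0 < gap u1 v1 u2 v2 l.
Proof.
move=> s21; pose D := u1 + v1 - (u2 + v2); have D0 : 0 < D by rewrite /D; lra.
have C0 : 0 < 2 * u1 * v1 + u1 * (u1 - v1) + 1.
  have : 0 < u1 * v1 by rewrite mulr_gt0.
  have : 0 <= u1 * (u1 - v1) by rewrite mulr_ge0 ?(ltW u10)// subr_ge0.
  lra.
(* The linear term l D then exceeds all negative contributions by 1, since l [expR (- l / u1)] never
   exceeds u1. *)
pose l := (2 * u1 * v1 + u1 * (u1 - v1) + 1) / D.
have l0 : 0 < l by rewrite divr_gt0.
have lD : l * D = 2 * u1 * v1 + u1 * (u1 - v1) + 1 by rewrite /l divfK// gt_eqF.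
exists l => //; clearbody l.
have h1 : l * expR (- l / u1) <= u1.
  have lu : 0 <= l / u1 by rewrite divr_ge0 ?ltW.
  rewrite mulNr; apply: le_trans (ler_wpM2l (ltW l0) (expR_le_inv lu)) _.
  rewrite ler_pdivrMr; last by lra.
  have -> : u1 * (1 + l / u1) = u1 + l by field; rewrite gt_eqF.
  by rewrite lerDr ltW.
have e1 := expR_gt0 (- l / u1); have e2 := expR_gt0 (- l / u2).
have e21 : expR (- l / u2) <= 1.
  by rewrite expR_le1 mulNr oppr_le0 divr_ge0 ?ltW.
have f1 : 0 <= u1 * v1 * expR (- l / u1) by rewrite !mulr_ge0 ?ltW.
have f2 : (u1 - v1) * (l * expR (- l / u1)) <= (u1 - v1) * u1.
  by rewrite ler_wpM2l// subr_ge0.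
have f3 : u2 * v2 * expR (- l / u2) <= u2 * v2 by rewrite ler_piMr// mulr_ge0 ?ltW.
have f4 : 0 <= (u2 - v2) * l * expR (- l / u2).
  by rewrite !mulr_ge0 ?subr_ge0 ?(ltW l0) ?(ltW e2).
rewrite /gap /gain; rewrite /D in lD; lra.
Qed.

(** The gap is negative near 0 and positive far out. The first fact forces u1 < u2, so the negated
    gap is [once_nonpos] and the zero is the only sign change. *)
Lemma gap_crossing : u2 + v2 < u1 + v1 -> gap3ee u1 v1 u2 v2 0 < 0 ->
  exists r, [/\ 0 < r, gap u1 v1 u2 v2 r = 0,
    forall l, 0 < l < r -> gap u1 v1 u2 v2 l < 0 &
    forall l, r < l -> 0 < gap u1 v1 u2 v2 l].
Proof.
move=> s21 a12.
have a21 : 0 < gap3ee u2 v2 u1 v1 0 by move: a12; rewrite !gap3ee_0//; lra.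
have [e [d [e0 d0 he]]] := gap_near0 v20 v10 vu2 vu1 a21.
have neg x : 0 < x < e -> gap u1 v1 u2 v2 x < 0.
  move=> xe; rewrite -oppr_gt0 -(gap_swap u1 v1 u2 v2); apply: lt_le_trans (he x xe).
  by case/andP: xe => x0 _; rewrite mulr_gt0// exprn_gt0.
have u12 : u1 < u2.
  case: (ltgtP u1 u2) => // u12.
    have e2 : 0 < e / 2 < e by apply/andP; split; lra.
    have := neg _ e2; rewrite ltNge ltW//; apply: gap_gt0_of_gt => //; lra.
  move: a12; rewrite gap3ee_0// u12 -mulrBl.
  rewrite pmulr_llt0 ?invr_gt0 ?exprn_gt0//; lra.
have nn := once_nonpos_gap v20 v10 vu2 vu1 u12 (lt2 u12).
have [L L0 gL] := gap_eventually_gt0 s21.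
have eL : e <= L.
  by rewrite leNgt; apply/negP => Le; have := neg L; rewrite L0 Le => /(_ isT); lra.
pose y := e / 2; have ye : 0 < y < e by rewrite /y; apply/andP; split; lra.
have yL : y <= L by rewrite /y; lra.
have cg : {within `[y, L], continuous (gap u1 v1 u2 v2)}.
  by apply: continuous_subspaceT => x; exact: continuous_gap.
have [r rI gr] : exists2 c, c \in `[y, L]%R & gap u1 v1 u2 v2 c = 0.
  apply: IVT => //; have := neg y ye => gy.
  by rewrite ge_min le_max (ltW gy) (ltW gL) orbT.
have r0 : 0 < r by move: rI; rewrite in_itv /= => /andP[yr _]; case/andP: ye; lra.
exists r; split => //.
- move=> l /andP[l0 lr]; rewrite ltNge; apply/negP => gl.
  have := nn l r; rewrite !(gap_swap u1 v1 u2 v2) gr oppr0 ltxx l0 lr oppr_le0 gl.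
  by move=> /(_ isT isT).
- move=> l rl; have := nn r l; rewrite !(gap_swap u1 v1 u2 v2) gr oppr0 lexx r0 rl oppr_lt0.
  exact.
Qed.

End Signs.

Lemma gain_collision_rate (U V : nat) l : (0 < U)%N -> 0 < l ->
  gain U%:R V%:R l = l * (l - collision_rate U V l).
Proof.
move=> U0 l0; have u0 : 0 < U%:R :> R by rewrite ltr0n.
rewrite /gain /collision_rate /theta /theta_int mulNr.
by field; rewrite !gt_eqF.
Qed.

End SignAnalysis.

(** * Asymptotics of the parameter *)

Section Asymptotics.
Context {R : realType}.
Implicit Types (p : nat -> R).

Lemma near_cvg0_le (f : nat -> R) (e : R) : f @ \oo --> (0 : R) -> 0 < e ->
  \forall N \near \oo, f N <= e.
Proof.
move=> /cvgrPdist_le h e0; have := h e e0; apply: filterS => N.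
by rewrite sub0r normrN; apply: le_trans; exact: ler_norm.
Qed.

Lemma near_gt0 : \forall N \near \oo, (0 < N)%N.
Proof. by exists 1%N. Qed.

Lemma near_small p (e : R) : parameter p -> 0 < e -> \forall N \near \oo, p N <= e.
Proof.
case=> p01 _ p1 e0; have := near_cvg0_le p1 e0.
by apply: filterS => N; rewrite divr1.
Qed.

Lemma powR_npow (s : R) (k m : nat) (N : nat) : s *+ k = - m%:R ->
  (npow s N : R) ^+ k = (N%:R ^+ m)^-1.
Proof.
move=> sk; rewrite /npow -powR_mulrn ?powR_ge0// -powRrM mulr_natr sk.
by rewrite powRN powR_mulrn.
Qed.

(** Taking k-th powers removes the real exponent: N^(-3/5) = o(p) becomes the divergence of N^3
    p^5. *)
Lemma near_large p (s : R) (k m : nat) (B : R) : (forall N, 0 < p N < 1) ->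
  (0 < k)%N -> s *+ k = - m%:R -> is_o (npow s) p -> 0 < B ->
  \forall N \near \oo, B <= N%:R ^+ m * p N ^+ k.
Proof.
move=> p01 k0 sk sp B0.
(* This bound is at most 1, so its k-th power is no larger. *)
have e0 : 0 < (1 + B)^-1 by rewrite invr_gt0; lra.
have := near_cvg0_le sp e0; apply: filterS2 near_gt0 => N N0 h.
have /andP[p0 _] := p01 N.
have e1 : (1 + B)^-1 <= 1 by rewrite invf_le1; lra.
have n0 : 0 < N%:R :> R by rewrite ltr0n.
have q0 : 0 <= npow s N / p N by rewrite divr_ge0 ?powR_ge0// ltW.
have hk : (npow s N / p N) ^+ k <= (1 + B)^-1.
  apply: (@le_trans _ _ ((1 + B)^-1 ^+ k)).
    by rewrite lerXn2r// nnegrE// ltW.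
  by case: k k0 {sk} => // k _; rewrite exprS ler_piMr ?exprn_ile1 ?(ltW e0).
rewrite expr_div_n (powR_npow _ sk) in hk.
have nm0 : 0 < N%:R ^+ m * p N ^+ k by rewrite mulr_gt0 ?exprn_gt0.
have : (N%:R ^+ m * p N ^+ k)^-1 <= (1 + B)^-1 by rewrite invfM.
rewrite lef_pV2 ?posrE//; lra.
Qed.

Lemma near_large_npow35 p (B : R) : parameter p -> is_o (npow (- (3 / 5))) p -> 0 < B ->
  \forall N \near \oo, B <= N%:R ^+ 3 * p N ^+ 5.
Proof. by case=> p01 _ _; apply: near_large => //; rewrite -mulr_natr; field. Qed.

Lemma near_large_npow12 p (B : R) : parameter p -> is_o (npow (- (1 / 2))) p -> 0 < B ->
  \forall N \near \oo, B <= N%:R * p N ^+ 2.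
Proof.
case=> p01 _ _ sp B0; have := @near_large p (- (1 / 2)) 2 1 B p01 isT _ sp B0.
by apply; rewrite -mulr_natr; field.
Qed.

Lemma near_large_npow1 p (B : R) : parameter p -> 0 < B ->
  \forall N \near \oo, B <= N%:R * p N.
Proof.
case=> p01 sp _ B0; have := @near_large p (- 1) 1 1 B p01 isT _ sp B0.
by apply; rewrite mulr1n.
Qed.

Lemma near_small_npow12 p (K : R) : parameter p -> is_o p (npow (- (1 / 2))) -> 0 < K ->
  \forall N \near \oo, N%:R * p N ^+ 2 <= K.
Proof.
case=> p01 _ _ sp K0.
have e0 : 0 < Num.min K 1 by rewrite lt_min K0 ltr01.
have := near_cvg0_le sp e0; apply: filterS2 near_gt0 => N N0 h.
have /andP[p0 _] := p01 N.
have q0 : 0 <= p N / npow (- (1 / 2)) N by rewrite divr_ge0 ?powR_ge0// ltW.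
have : (p N / npow (- (1 / 2)) N) ^+ 2 <= K.
  move: h; rewrite le_min => /andP[hK h1].
  by rewrite expr2 (le_trans _ hK)// ler_piMr.
rewrite expr_div_n (@powR_npow _ 2 1) ?invrK 1?mulrC//.
by rewrite -mulr_natr; field.
Qed.

Lemma near_critical p (c : R) : eventually_critical c p ->
  \forall N \near \oo, N%:R * p N ^+ 2 = c ^+ 2.
Proof.
apply: filterS2 near_gt0 => N N0 ->.
rewrite exprMn (@powR_npow _ 2 1); last by rewrite -mulr_natr; field.
by rewrite mulrCA expr1 divff ?mulr1// pnatr_eq0 -lt0n.
Qed.

Lemma near_large_critical p (c B : R) : parameter p -> 0 < c -> eventually_critical c p ->
  0 < B -> \forall N \near \oo, B <= N%:R ^+ 3 * p N ^+ 5.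
Proof.
move=> pp c0 pc B0; have c40 : 0 < c ^+ 4 by rewrite exprn_gt0.
have Bc : 0 < B / c ^+ 4 by rewrite divr_gt0.
have := near_large_npow1 pp Bc; apply: filterS2 (near_critical pc) => N h.
rewrite ler_pdivrMr//.
suff -> : N%:R ^+ 3 * p N ^+ 5 = N%:R * p N * c ^+ 4 by [].
by rewrite (_ : c ^+ 4 = (c ^+ 2) ^+ 2); [rewrite -h|]; ring.
Qed.

Definition dominating_prob (N : nat) (q : R) (U1 V1 : nat) neg1 (U2 V2 : nat) neg2 : R :=
  subset_prob q (fun A : {set 'I_N.+1} =>
    (image_size U2 V2 neg2 A < image_size U1 V1 neg1 A)%N).

Lemma dominates_of_near p (u1 v1 u2 v2 : int) : parameter p ->
  binary_linear_form (u1, v1) -> binary_linear_form (u2, v2) ->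
  (forall eps : R, 0 < eps -> \forall N \near \oo,
    1 - eps <= dominating_prob N (p N) `|u1|%N `|v1|%N (v1 < 0) `|u2|%N `|v2|%N (v2 < 0)) ->
  dominates p (u1, v1) (u2, v2).
Proof.
case=> p01 _ _ hf hg h; apply/cvgrPdist_le => e e0; have := h e e0.
apply: filterS => N.
rewrite /dominating_prob => h1.
rewrite (_ : (fun A : {set 'I_N.+1} => _) = (fun A : {set 'I_N.+1} =>
    (image_size `|u2|%N `|v2|%N (v2 < 0)%R A < image_size `|u1|%N `|v1|%N (v1 < 0)%R A)%N)); last first.
  by apply/funext => A; rewrite !card_form_image.
rewrite ger0_norm ?subr_ge0; last exact: pr_le1.
by rewrite lerBlDr -lerBlDl.
Qed.

Lemma admissible_form (u v : int) : binary_linear_form (u, v) -> (u, v) <> (1, 1) ->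
  admissible `|u|%N `|v|%N (v < 0).
Proof.
case=> /= u0 v0 vu /eqP; rewrite /gcdz => cuv n11.
have uE : u = `|u|%N%:Z by rewrite gez0_abs// (le_trans _ vu).
have VU : (`|v| <= `|u|)%N by rewrite -lez_nat -uE.
split=> //; first by rewrite absz_gt0.
move=> UV; move: cuv; rewrite UV gcdnn => /eqP[v1].
have u1 : u = 1 by rewrite uE UV v1.
by rewrite ltNge; apply/negP => v0'; apply: n11; rewrite u1 -[v]gez0_abs// v1.
Qed.

End Asymptotics.

(** * Combination of the regimes of [lambda] *)

Section MainParts.
Context {R : realType}.
Implicit Types (p : nat -> R).
Variables (U1 V1 : nat) (neg1 : bool) (U2 V2 : nat) (neg2 : bool).
Hypotheses (ad1 : admissible U1 V1 neg1) (ad2 : admissible U2 V2 neg2).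

Local Notation gap12 := (gap (U1%:R : R) V1%:R U2%:R V2%:R).
Local Notation curvature := (gap3ee (U1%:R : R) V1%:R U2%:R V2%:R 0).

Let U10 : (0 < U1)%N. Proof. by case: ad1 => V0 VU _ _; exact: leq_trans VU. Qed.
Let U20 : (0 < U2)%N. Proof. by case: ad2 => V0 VU _ _; exact: leq_trans VU. Qed.
Let v10 : 0 < V1%:R :> R. Proof. by case: ad1 => V0 *; rewrite ltr0n. Qed.
Let v20 : 0 < V2%:R :> R. Proof. by case: ad2 => V0 *; rewrite ltr0n. Qed.
Let vu1 : V1%:R <= U1%:R :> R. Proof. by case: ad1 => *; rewrite ler_nat. Qed.
Let vu2 : V2%:R <= U2%:R :> R. Proof. by case: ad2 => *; rewrite ler_nat. Qed.

Lemma admissible_gt1 (U V : nat) neg : admissible U V neg -> (1 < U)%N -> (V < U)%N.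
Proof.
move=> ad U1'; apply: (admissible_lt ad); case: (ad) => V0 _ _ _.
by rewrite -[3%N]/(2 + 1)%N leq_add.
Qed.

Let lt1 : U2%:R < U1%:R :> R -> V1%:R < U1%:R :> R.
Proof. by rewrite !ltr_nat => h; apply: (admissible_gt1 ad1); exact: leq_ltn_trans h. Qed.
Let lt2 : U1%:R < U2%:R :> R -> V2%:R < U2%:R :> R.
Proof. by rewrite !ltr_nat => h; apply: (admissible_gt1 ad2); exact: leq_ltn_trans h. Qed.

Lemma gap_collision_rate (l : R) : 0 < l ->
  gap12 l = l * (collision_rate U2 V2 l - collision_rate U1 V1 l).
Proof. by move=> l0; rewrite /gap !gain_collision_rate//; ring. Qed.

(** The bound on lambda is a premise for each N separately, since lambda may cross K infinitely
    often. *)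
Lemma near_critical_domination p (K d eps : R) : parameter p -> 0 < K -> 0 < d -> 0 < eps ->
  (forall B, 0 < B -> \forall N \near \oo, B <= N%:R ^+ 3 * p N ^+ 5) ->
  \forall N \near \oo, N%:R * p N ^+ 2 <= K ->
    d * (N%:R * p N ^+ 2) ^+ 3 <= gap12 (N%:R * p N ^+ 2) ->
    1 - eps <= dominating_prob N (p N) U1 V1 neg1 U2 V2 neg2.
Proof.
move=> pp K0 d0 eps0 large.
have [B B0 hB] := critical_domination ad1 ad2 K0 d0 eps0.
have p2 := near_small pp (_ : 0 < 1 / 2); near=> N => lK hd.
have [/(_ N)/andP[p0 _] _ _] := pp.
have N0 : (0 < N)%N by near: N; exact: near_gt0.
apply: hB => //.
- by rewrite p0; near: N; apply: p2; lra.
- by near: N; exact: large.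
- have l0 : 0 < N%:R * p N ^+ 2 by rewrite mulr_gt0 ?ltr0n// exprn_gt0.
  rewrite gap_collision_rate// in hd; rewrite -(ler_pM2l l0).
  apply: le_trans hd; rewrite le_eqVlt; apply/orP; left; apply/eqP; ring.
Unshelve. all: by end_near. Qed.

Lemma near_supercritical p (eps : R) : parameter p -> 0 < eps ->
  (U2 + V2 < U1 + V1)%N ->
  exists2 L : R, 0 < L & \forall N \near \oo, L <= N%:R * p N ^+ 2 ->
    1 - eps <= dominating_prob N (p N) U1 V1 neg1 U2 V2 neg2.
Proof.
move=> pp eps0 s21.
have [L' L0 hL] := supercritical_domination ad1 ad2 s21 eps0.
exists L' => //; have p2 := near_small pp (_ : 0 < 1 / 32); near=> N => lL.
have [/(_ N)/andP[p0 _] _ _] := pp.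
have N0 : (0 < N)%N by near: N; exact: near_gt0.
by apply: hL => //; rewrite p0; near: N; apply: p2; lra.
Unshelve. all: by end_near. Qed.

(** With U + V fixed, positive curvature forces U2 < U1: the second form is the more balanced one,
    has the larger product U V, and so misses more values for large lambda. *)
Lemma curvature_sum_eq : (U2 + V2 = U1 + V1)%N -> 0 < curvature ->
  [/\ (V1 < U1)%N, (V2 < U2)%N & (U1 * V1 < U2 * V2)%N].
Proof.
move=> s21; rewrite gap3ee_0//.
have s21R : U2%:R + V2%:R = U1%:R + V1%:R :> R by rewrite -!natrD s21.
have x0 : 0 < U1%:R :> R by rewrite ltr0n.
have y0 : 0 < U2%:R :> R by rewrite ltr0n.
rewrite subr_gt0 ltr_pdivrMr ?exprn_gt0// mulrAC ltr_pdivlMr ?exprn_gt0//.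
have := vu1; have := vu2.
rewrite (_ : V2%:R = U1%:R + V1%:R - U2%:R); last by lra.
set x := U1%:R in x0 s21R *; set y := U2%:R in y0 s21R *; set v := V1%:R in s21R *.
move=> vy vx h.
(* If x <= y, then x + v <= 2 x and x + y <= 2 y make the factor 4 x y - (x + v) (x + y)
   nonnegative. *)
have yx : y < x.
  rewrite ltNge; apply/negP => xy; move: h; apply/negP; rewrite -leNgt -subr_ge0.
  have -> : (3 * x - v) * y ^+ 2 - (3 * y - (x + v - y)) * x ^+ 2 =
    (y - x) * (4 * x * y - (x + v) * (x + y)) by ring.
  by rewrite mulr_ge0 ?subr_ge0//; clear s21R; nra.
have U21 : (U2 < U1)%N by rewrite -(ltr_nat R).
have VU1 : (V1 < U1)%N by apply: (admissible_gt1 ad1); exact: leq_ltn_trans U21.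
split => //.
  apply: (admissible_lt ad2); rewrite s21.
  have : (1 < U1)%N by exact: leq_ltn_trans U21.
  by case: ad1 => V0 _ _ _ U11; rewrite -[3%N]/(2 + 1)%N leq_add.
have {vy vx h s21R x0 y0 x y v yx} : (U2 + V2 = U1 + V1)%N by [].
case: ad2 => _ VU2 _ _; clear -U21 VU1 VU2 => s21.
have -> : V2 = (U1 + V1 - U2)%N by lia.
have : (V1 + (U1 - U2) <= U2)%N by lia.
have -> : (U1 + V1 - U2 = V1 + (U1 - U2))%N by lia.
move: (U1 - U2)%N (subnKC (ltnW U21)) => d; clear s21 VU2; nia.
Qed.

Lemma near_dominates_of_curvature p (eps : R) : parameter p -> 0 < eps ->
  is_o (npow (- (3 / 5))) p -> (U2 + V2 <= U1 + V1)%N -> 0 < curvature ->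
  \forall N \near \oo, 1 - eps <= dominating_prob N (p N) U1 V1 neg1 U2 V2 neg2.
Proof.
move=> pp eps0 p35 s21 curv.
have s21R : U2%:R + V2%:R <= U1%:R + V1%:R :> R by rewrite -!natrD ler_nat.
have pos l : 0 < l -> 0 < gap12 l by exact: gap_gt0.
(* [L] is fixed before the margin [d], which is then taken on the bounded interval up to [L]. *)
have [L L0 hL] : exists2 L : R, 0 < L & \forall N \near \oo, L <= N%:R * p N ^+ 2 ->
    1 - eps <= dominating_prob N (p N) U1 V1 neg1 U2 V2 neg2.
  move: s21; rewrite leq_eqVlt => /predU1P[s21|s21]; last exact: near_supercritical.
  have [VU1 VU2 uv] := curvature_sum_eq s21 curv.
  have [c c0 [L L0 h]] := supercritical_domination_eq ad1 ad2 s21 VU1 VU2 uv eps0.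
  exists L => //; have p2 := near_small pp c0; near=> N => lL.
  have [/(_ N)/andP[p0 _] _ _] := pp.
  have N0 : (0 < N)%N by near: N; exact: near_gt0.
  by apply: h => //; rewrite p0; near: N; apply: p2.
have [d d0 hd] := gap_lower_bound v10 v20 vu1 vu2 curv L0 (fun x xL => pos x (proj1 (andP xL))).
have h1 := near_critical_domination pp L0 d0 eps0 (fun B B0 => near_large_npow35 pp p35 B0).
near=> N.
have [/(_ N)/andP[p0 _] _ _] := pp.
have N0 : (0 < N)%N by near: N; exact: near_gt0.
case: (lerP (N%:R * p N ^+ 2) L) => lL; last first.
  by have := ltW lL; near: N; exact: hL.
have l0 : 0 < N%:R * p N ^+ 2 by rewrite mulr_gt0 ?ltr0n// exprn_gt0.
have := hd (N%:R * p N ^+ 2); rewrite l0 lL => /(_ isT); move: lL {l0 N0 p0}; near: N.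
exact: h1.
Unshelve. all: by end_near. Qed.

Lemma near_dominates_subcritical p (K eps : R) : parameter p -> 0 < eps -> 0 < K ->
  0 < curvature -> (forall l, 0 < l <= K -> 0 < gap12 l) ->
  (forall B, 0 < B -> \forall N \near \oo, B <= N%:R ^+ 3 * p N ^+ 5) ->
  (\forall N \near \oo, N%:R * p N ^+ 2 <= K) ->
  \forall N \near \oo, 1 - eps <= dominating_prob N (p N) U1 V1 neg1 U2 V2 neg2.
Proof.
move=> pp eps0 K0 curv pos large lK.
have [d d0 hd] := gap_lower_bound v10 v20 vu1 vu2 curv K0 pos.
have h1 := near_critical_domination pp K0 d0 eps0 large.
near=> N.
have [/(_ N)/andP[p0 _] _ _] := pp.
have N0 : (0 < N)%N by near: N; exact: near_gt0.
have l0 : 0 < N%:R * p N ^+ 2 by rewrite mulr_gt0 ?ltr0n// exprn_gt0.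
have lL : N%:R * p N ^+ 2 <= K by near: N.
have := hd (N%:R * p N ^+ 2); rewrite l0 lL => /(_ isT); move: lL {l0 N0 p0}; near: N.
exact: h1.
Unshelve. all: by end_near. Qed.

(** Here lambda is eventually equal to K, so the margin is read off at this single point. This
    serves c > c_{f,g}, where the gap is negative near 0 and has no positive lower bound on an
    interval from 0. *)
Lemma near_dominates_critical p (K eps : R) : parameter p -> 0 < eps -> 0 < K ->
  0 < gap12 K ->
  (forall B, 0 < B -> \forall N \near \oo, B <= N%:R ^+ 3 * p N ^+ 5) ->
  (\forall N \near \oo, N%:R * p N ^+ 2 = K) ->
  \forall N \near \oo, 1 - eps <= dominating_prob N (p N) U1 V1 neg1 U2 V2 neg2.
Proof.
move=> pp eps0 K0 pos large lK.
have d0 : 0 < gap12 K / K ^+ 3 by rewrite divr_gt0// exprn_gt0.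
have h1 := near_critical_domination pp K0 d0 eps0 large.
apply: filterS2 lK h1 => N -> h; apply: h => //.
by rewrite divfK// gt_eqF// exprn_gt0.
Qed.

End MainParts.

(** * Translation between integer forms and absolute values *)

Section Forms.
Context {R : realType}.

Lemma formE (u v : int) : binary_linear_form (u, v) ->
  [/\ (0 < `|u|)%N, u%:~R = `|u|%N%:R :> R & `|v|%:~R = `|v|%N%:R :> R].
Proof.
case=> /= u0 v0 vu _; split; first by rewrite absz_gt0.
  by rewrite -[in LHS](gez0_abs (le_trans (normr_ge0 v) vu)).
by rewrite -abszE.
Qed.

Lemma form_sumE (u v : int) : binary_linear_form (u, v) -> u + `|v| = (`|u| + `|v|)%N%:Z.
Proof.
by case=> /= u0 v0 vu _; rewrite PoszD -{1}(gez0_abs (le_trans (normr_ge0 v) vu)) abszE.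
Qed.

Lemma ratr_alpha (u v : int) : binary_linear_form (u, v) ->
  ratr (alpha u v) * 6 = (3 * `|u|%N%:R - `|v|%N%:R) / `|u|%N%:R ^+ 2 :> R.
Proof.
move=> h; have [U0 uE vE] := formE h; case: h => /= u0 _ _ _.
rewrite alphaE// fmorph_div rmorphM rmorphXn /= !ratr_int rmorphB rmorphM /= uE vE.
rewrite (_ : ratr 6 = 6); last by rewrite -[6]/(6%:~R) ratr_int.
by field; rewrite gt_eqF// ltr0n.
Qed.

Lemma alpha_lt_curvature (u1 v1 u2 v2 : int) :
  binary_linear_form (u1, v1) -> binary_linear_form (u2, v2) ->
  (alpha u1 v1 < alpha u2 v2) =
    (0 < gap3ee (`|u1|%N%:R : R) `|v1|%N%:R `|u2|%N%:R `|v2|%N%:R 0).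
Proof.
move=> h1 h2; have [U10 _ _] := formE h1; have [U20 _ _] := formE h2.
have vu (u v : int) : binary_linear_form (u, v) ->
    0 < `|v|%N%:R :> R /\ `|v|%N%:R <= `|u|%N%:R :> R.
  case=> /= u0 v0 vu _; rewrite ltr0n absz_gt0 v0 ler_nat; split => //.
  by rewrite -lez_nat !abszE [leRHS]ger0_norm// (le_trans _ vu).
have [? ?] := vu _ _ h1; have [? ?] := vu _ _ h2.
rewrite gap3ee_0// -!ratr_alpha// -(ltr_rat R) subr_gt0 ltr_pM2r//.
Qed.

(** Hence the equation that defines c_{f,g} says that [gap] vanishes at c^2. *)
Lemma g_gain (u v : int) (l : R) : binary_linear_form (u, v) -> 0 < l ->
  l * g_ u v (l / u%:~R) = gain `|u|%N%:R `|v|%N%:R l.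
Proof.
move=> h l0; have [U0 uE vE] := formE h; have u0 : 0 < `|u|%N%:R :> R by rewrite ltr0n.
rewrite /g_ /gain rmorphD rmorphB /= uE vE mulNr.
by field; rewrite !gt_eqF.
Qed.

End Forms.

Theorem theorem3p3 (R : realType) (u1 v1 u2 v2 : int)
  (hf : binary_linear_form (u1, v1)) (hf1 : (u1, v1) <> (1, 1))
  (hg : binary_linear_form (u2, v2)) (hg1 : (u2, v2) <> (1, 1))
  (hfg : (u2, v2) <> (u1, v1)) (hfgN : (u2, v2) <> (u1, - v1)) :
  [/\ (* (i) *)
      u2 + `|v2| <= u1 + `|v1| -> alpha u1 v1 < alpha u2 v2 ->
      forall p : nat -> R, parameter p ->
        is_o (npow (- (3 / 5))) p -> dominates p (u1, v1) (u2, v2),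
      (* (i), the special case g(x, y) = x - y *)
      forall u v : int, binary_linear_form (u, v) -> `|v| < u ->
      forall p : nat -> R, parameter p ->
        is_o (npow (- (3 / 5))) p -> dominates p (u, v) (1, - 1) &
      (* (ii) *)
      u2 + `|v2| < u1 + `|v1| -> alpha u2 v2 < alpha u1 v1 ->
      exists cfg : R,
        [/\ 0 < cfg,
            forall c : R, 0 < c ->
              (g_ u1 v1 (c ^+ 2 / u1%:~R) = g_ u2 v2 (c ^+ 2 / u2%:~R)
               <-> c = cfg),
            forall p : nat -> R, parameter p ->
              (is_o (npow (- (3 / 5))) p /\ is_o p (npow (- (1 / 2))))
              \/ (exists2 c : R, 0 < c < cfg & eventually_critical c p) ->
              dominates p (u2, v2) (u1, v1) &
            forall p : nat -> R, parameter p ->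
              (exists2 c : R, cfg < c & eventually_critical c p)
              \/ is_o (npow (- (1 / 2))) p ->
              dominates p (u1, v1) (u2, v2)]].
Proof.
have adf := admissible_form hf hf1; have adg := admissible_form hg hg1.
have partI (u v u' v' : int) : binary_linear_form (u, v) -> (u, v) <> (1, 1) ->
    binary_linear_form (u', v') -> (u', v') <> (1, 1) ->
    u' + `|v'| <= u + `|v| -> alpha u v < alpha u' v' ->
    forall p : nat -> R, parameter p ->
      is_o (npow (- (3 / 5))) p -> dominates p (u, v) (u', v').
  move=> h h1 h' h1'; rewrite !form_sumE// lez_nat (alpha_lt_curvature (R := R))// => s al p pp p35.
  apply: dominates_of_near => // eps eps0.
  by apply: near_dominates_of_curvature => //; exact: admissible_form.
split.
- exact: partI.
- move=> u v h vu.
  have ugt1 : 1 < u by case: h => /= _ v0 _ _; apply: le_lt_trans vu; rewrite -gtz0_ge1 normr_gt0.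
  have h1 : binary_linear_form (1, - 1) by split.
  apply: partI; [exact: h| |exact: h1|by []| |].
  + by case=> uE _; rewrite uE in ugt1.
  + rewrite (_ : `|- 1| = 1)//; case: h => /= _ v0 _ _.
    by apply: lerD; [exact: ltW|rewrite -gtz0_ge1 normr_gt0].
  + rewrite (alpha_lt_curvature (R := R))//.
    have [U0 _ _] := @formE R _ _ h.
    have V0 : (0 < `|v|)%N by case: h => /= _ v0 _ _; rewrite absz_gt0.
    have V0' : 0 < `|v|%N%:R :> R by rewrite ltr0n.
    have U2 : (1 < `|u|)%N by rewrite -ltz_nat gez0_abs// ltW// (lt_trans _ ugt1).
    have U2' : 2 <= `|u|%N%:R :> R by rewrite ler_nat.
    have VU : `|v|%N%:R <= `|u|%N%:R :> R.
      by rewrite ler_nat -lez_nat !abszE [leRHS]ger0_norm ?(ltW vu)// (le_trans _ (ltW vu)).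
    (* Six times alpha is 2 for x - y, while (3 x - y) / x^2 < 2 for x >= 2 and y > 0. *)
    rewrite gap3ee_0//= subr_gt0 ltr_pdivrMr ?exprn_gt0 ?ltr0n//.
    move: (`|u|%N%:R) (`|v|%N%:R) V0' U2' VU => x y *; rewrite expr1n; nra.
- rewrite !form_sumE// ltz_nat (alpha_lt_curvature (R := R))// => s al.
  case: (adf) => V10 VU1 _ _; case: (adg) => V20 VU2 _ _.
  have v10 : 0 < `|v1|%N%:R :> R by rewrite ltr0n.
  have v20 : 0 < `|v2|%N%:R :> R by rewrite ltr0n.
  have vu1 : `|v1|%N%:R <= `|u1|%N%:R :> R by rewrite ler_nat.
  have vu2 : `|v2|%N%:R <= `|u2|%N%:R :> R by rewrite ler_nat.
  have sR : `|u2|%N%:R + `|v2|%N%:R < `|u1|%N%:R + `|v1|%N%:R :> R by rewrite -!natrD ltr_nat.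
  have al' : gap3ee (`|u1|%N%:R : R) `|v1|%N%:R `|u2|%N%:R `|v2|%N%:R 0 < 0.
    by move: al; rewrite !gap3ee_0//; lra.
  have lt1 : `|u2|%N%:R < `|u1|%N%:R :> R -> `|v1|%N%:R < `|u1|%N%:R :> R.
    rewrite !ltr_nat => h; apply: (admissible_gt1 adf); apply: leq_ltn_trans h; exact: leq_trans VU2.
  have lt2 : `|u1|%N%:R < `|u2|%N%:R :> R -> `|v2|%N%:R < `|u2|%N%:R :> R.
    rewrite !ltr_nat => h; apply: (admissible_gt1 adg); apply: leq_ltn_trans h; exact: leq_trans VU1.
  have [r [r0 gr neg pos]] := gap_crossing v10 v20 vu1 vu2 lt1 lt2 sR al'.
  have sq : Num.sqrt r ^+ 2 = r by rewrite sqr_sqrtr// ltW.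
  have s0 : 0 < Num.sqrt r by rewrite sqrtr_gt0.
  have pos' K : K < r -> forall l, 0 < l <= K ->
      0 < gap (`|u2|%N%:R : R) `|v2|%N%:R `|u1|%N%:R `|v1|%N%:R l.
    move=> Kr l /andP[l0 lK]; rewrite gap_swap oppr_gt0; apply: neg.
    by rewrite l0 (le_lt_trans lK).
  (* For p = c N^(-1/2) lambda equals c^2, and [r] is the crossing point in terms of lambda. *)
  exists (Num.sqrt r); split => //.
  + move=> c c0; have l0 : 0 < c ^+ 2 by rewrite exprn_gt0.
    split=> [gE|->].
      have ge : gap (`|u1|%N%:R : R) `|v1|%N%:R `|u2|%N%:R `|v2|%N%:R (c ^+ 2) = 0.
        by rewrite /gap -!g_gain// gE subrr.
      suff cr : c ^+ 2 = r by rewrite -cr sqrtr_sqr gtr0_norm.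
      case: (ltgtP (c ^+ 2) r) => // cr.
        by have := neg (c ^+ 2); rewrite ge l0 cr ltxx => /(_ isT).
      by have := pos _ cr; rewrite ge ltxx.
    apply: (mulfI (lt0r_neq0 r0)); rewrite sq !g_gain//.
    by apply/eqP; rewrite -subr_eq0; apply/eqP.
  + move=> p pp hp; apply: dominates_of_near => // eps eps0.
    case: hp => [[p35 p12]|[c /andP[c0 cr] pc]].
      (* Since lambda tends to 0 here, it eventually stays below any fixed positive bound less than
         [r]. *)
      have K0 : 0 < r / 2 by lra.
      apply: (near_dominates_subcritical adg adf pp eps0 K0 al); first by apply: pos'; lra.
        by move=> B B0; exact: near_large_npow35.
      exact: near_small_npow12.
    have c20 : 0 < c ^+ 2 by rewrite exprn_gt0.
    apply: (near_dominates_subcritical adg adf pp eps0 c20 al).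
      by apply: pos'; rewrite -sq ltr_pXn2r// nnegrE ltW.
      by move=> B B0; exact: (near_large_critical pp c0 pc).
    by apply: filterS (near_critical pc) => N ->.
  + move=> p pp hp; apply: dominates_of_near => // eps eps0.
    case: hp => [[c cr pc]|p12].
      have c0 : 0 < c by exact: lt_trans cr.
      have c20 : 0 < c ^+ 2 by rewrite exprn_gt0.
      apply: (near_dominates_critical adf adg pp eps0 c20).
      * by apply: pos; rewrite -sq ltr_pXn2r// nnegrE ltW.
      * by move=> B B0; exact: (near_large_critical pp c0 pc).
      * exact: near_critical.
    have [L L0 hL] := near_supercritical adf adg pp eps0 s.
    by apply: filterS2 (near_large_npow12 pp p12 L0) hL => N lL; apply.
Qed.
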